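(* Let $A\in\{0,1\}$ and assume: (consistency) $Y=Y(A)$; (latent ignorability) for each $a$, $Y(a)$ is conditionally independent of $\{A,Z\}$ given $(U,L)$; (IV independence) $Z$ is conditionally independent of $U$ given $L$. Let $\pi(Z,L)$ be any (fixed, known) regular weighting function for $A$, and $$\psi_\pi^o:=\mathbb{E}\left[\frac{\mathrm{Cov}\{Y,\pi(Z,L)\mid L\}}{\mathrm{Cov}\{A,\pi(Z,L)\mid L\}}\right].$$ Then, in the nonparametric model for the law of $O=(Z,A,Y,L)$, the efficient influence function for $\psi_\pi^o$ is $\varphi_\pi(O;\psi_\pi^o,\alpha_\pi^o)$, where $$\varphi_\pi(O;\psi_\pi,\alpha_\pi):=\frac{\pi(Z,L)-\rho_\pi(L)}{\kappa_\pi(L)}\{Y-\eta(L)\}-\psi_\pi+\left(1-\frac{\{\pi(Z,L)-\rho_\pi(L)\}\{A-\delta(L)\}}{\kappa_\pi(L)}\right)\gamma_\pi(L),$$ $\alpha_\pi=[\delta,\kappa_\pi,\rho_\pi,\eta,\gamma_\pi]$, and $\alpha^o_\pi=[\delta^o,\kappa_\pi^o,\rho_\pi^o,\eta^o,\gamma_\pi^o]$ is the vector of true nuisance functions defined in the context.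
   Context: $Z$ is an instrument (multi-categorical or continuous), $U$ unmeasured confounders, $L$ observed covariates, $Y\in\mathbb{R}$ the outcome, $Y(a)$ potential outcomes. $\pi(Z,L)$ is a regular weighting function for binary $A$ if it is uniformly bounded and there exists $\epsilon_0>0$ with $|\mathrm{Cov}\{A,\pi(Z,L)\mid L\}|\ge\epsilon_0$ uniformly for all $L$. True nuisance functions: $\delta^o(L)=\mathbb{E}[A\mid L]$, $\eta^o(L)=\mathbb{E}[Y\mid L]$, $\kappa_\pi^o(L)=\mathrm{Cov}\{A,\pi(Z,L)\mid L\}$, $\rho_\pi^o(L)=\mathbb{E}[\pi(Z,L)\mid L]$, $\gamma_\pi^o(L)=\mathrm{Cov}\{Y,\pi(Z,L)\mid L\}/\mathrm{Cov}\{A,\pi(Z,L)\mid L\}$. The semiparametric analysis is carried out in the fully nonparametric model for the observed data (tangent space equal to all mean-zero square-integrable functions of $O$), so the efficient influence function is the unique influence function: the mean-zero square-integrable $\varphi$ with $\frac{d}{d\theta}\psi_\pi(P_\theta)|_{\theta=0}=\mathbb{E}[\varphi(O)s(O)]$ for every regular parametric submodel $P_\theta$ through the true law with score $s$ at $\theta=0$, where $\psi_\pi(P)$ is the functional given by the displayed formula for $\psi_\pi^o$ under $P$.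
   Formalization: The formal theorem assumes E[Y^2] finite (otherwise φ need not be square-integrable), and regular submodels are those differentiable in quadratic mean with E[Y^2] locally bounded and the covariance bound ε0 holding with one constant near θ=0. *)

(* Defs.v *)
From HB Require Import structures.
From mathcomp Require Import all_boot all_order all_algebra.
From mathcomp Require Import all_classical all_reals all_analysis.

Set Implicit Arguments.
Unset Strict Implicit.
Unset Printing Implicit Defensive.

Import Order.TTheory GRing.Theory Num.Theory.
Import numFieldNormedType.Exports.

Local Open Scope classical_set_scope.
Local Open Scope ring_scope.

Section conditioning.
Context {R : realType} {d d' : measure_display}
  {T : measurableType d} {T' : measurableType d'}.
Implicit Types (P : probability T R) (V : T -> T') (X W : T -> R).

(* e is a version of v |-> E_P[X | V = v]. *)
Definition is_cond_exp P V X (e : T' -> R) : Prop :=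
  [/\ measurable_fun setT e,
      P.-integrable setT (EFin \o (e \o V)) &
      forall B, measurable B ->
        (\int[P]_(t in V @^-1` B) (X t)%:E =
         \int[P]_(t in V @^-1` B) (e (V t))%:E)%E].

(* A chosen version, which exists whenever X is P-integrable and V is
   measurable; the value is 0 if there is no version. *)
Definition cond_exp P V X : T' -> R := xget (cst 0) (is_cond_exp P V X).

Definition cond_prob P V (E : set T) : T' -> R := cond_exp P V \1_E.

Definition cond_cov P V X W : T' -> R :=
  cond_exp P V (fun t => (X t - cond_exp P V X (V t)) *
                         (W t - cond_exp P V W (V t))).

Definition cond_indep {d1 d2 : measure_display} {T1 : measurableType d1}
    {T2 : measurableType d2} P (X1 : T -> T1) (X2 : T -> T2) V : Prop :=
  forall (E : set T1) (F : set T2), measurable E -> measurable F ->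
  {ae P, forall t,
     cond_prob P V (X1 @^-1` E `&` X2 @^-1` F) (V t) =
     cond_prob P V (X1 @^-1` E) (V t) * cond_prob P V (X2 @^-1` F) (V t)}.

End conditioning.

Section influence_functions.
Context {R : realType} {d : measure_display} {T : measurableType d}.
Implicit Types (P : probability T R) (Pt : R -> probability T R).

(* The family Pt is dominated near 0 by a sigma-finite measure mu with densities
   p t, and t |-> sqrt (p t) is differentiable in L^2(mu) at 0 with derivative
   s * sqrt (p 0) / 2. *)
Definition qmd_at0 Pt (s : T -> R) : Prop :=
  exists (mu : {sigma_finite_measure set T -> \bar R}) (p : R -> T -> R),
    (\forall t \near (0 : R),
       [/\ measurable_fun setT (p t),
           forall x, 0 <= p t x &
           forall B, measurable B ->
             Pt t B = (\int[mu]_(x in B) (p t x)%:E)%E]) /\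
    ((\int[mu]_x
        (((Num.sqrt (p t x) - Num.sqrt (p 0 x)) / t
          - s x * Num.sqrt (p 0 x) / 2) ^+ 2)%:E)%E
       @[t --> (0 : R)^'] --> (0 : \bar R)%E).

Definition influence_function
    (submodel : (R -> probability T R) -> (T -> R) -> Prop)
    (Psi : probability T R -> R) P (phi : T -> R) : Prop :=
  [/\ phi \in Lfun P 2%:E,
      ('E_P[phi] = 0)%E &
      forall Pt s, submodel Pt s ->
        is_derive (0 : R) (1 : R) (fun t => Psi (Pt t))
                  (fine 'E_P[fun x => (phi x * s x)%R])].

(* In a nonparametric model the efficient influence function is the unique
   influence function. *)
Definition nonparametric_eif
    (submodel : (R -> probability T R) -> (T -> R) -> Prop)
    (Psi : probability T R -> R) P (phi : T -> R) : Prop :=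
  influence_function submodel Psi P phi /\
  (forall phi', influence_function submodel Psi P phi' ->
     {ae P, forall x, phi' x = phi x}).

End influence_functions.

Notation obs_space R TZ TL := (TZ * bool * R * TL)%type.

Section observed_data.
Context {R : realType} {dZ dL : measure_display}
  {TZ : measurableType dZ} {TL : measurableType dL}.

Local Notation O := (obs_space R TZ TL).

Implicit Types (o : O) (P : probability O R)
  (pi : TZ * TL -> R).

Definition oZ o : TZ := o.1.1.1.
Definition oA o : R := (o.1.1.2)%:R.
Definition oY o : R := o.1.2.
Definition oL o : TL := o.2.
Definition opi pi o : R := pi (oZ o, oL o).

Record nuisance := Nuisance {
  delta : TL -> R;
  kappa : TL -> R;
  rho : TL -> R;
  eta : TL -> R;
  gamma : TL -> R }.

Definition true_nuisance pi P : nuisance := {|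
  delta := cond_exp P oL oA;
  kappa := cond_cov P oL oA (opi pi);
  rho := cond_exp P oL (opi pi);
  eta := cond_exp P oL oY;
  gamma := fun l => cond_cov P oL oY (opi pi) l / cond_cov P oL oA (opi pi) l
|}.

Definition relevance_bound pi P (eps : R) : Prop :=
  {ae P, forall o, eps <= `|cond_cov P oL oA (opi pi) (oL o)|}.

Definition regular_weighting pi P : Prop :=
  [/\ measurable_fun setT pi,
      (exists M : R, forall x, `|pi x| <= M) &
      (exists2 eps : R, 0 < eps & relevance_bound pi P eps)].

Definition psi pi P : R :=
  fine 'E_P[fun o => (cond_cov P oL oY (opi pi) (oL o) /
                      cond_cov P oL oA (opi pi) (oL o))%R].

Definition phi pi (psi0 : R) (alpha : nuisance) o : R :=
  (opi pi o - rho alpha (oL o)) / kappa alpha (oL o) * (oY o - eta alpha (oL o))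
  - psi0
  + (1 - (opi pi o - rho alpha (oL o)) * (oA o - delta alpha (oL o))
         / kappa alpha (oL o)) * gamma alpha (oL o).

(* Regular one-dimensional submodels through P with score s: the path is
   differentiable in quadratic mean, E[Y^2] is bounded along it and pi stays a
   regular weighting function along it, with one constant eps, so that psi pi is
   given by its formula (no division by 0) at every law of the path near P. The
   laws are otherwise unrestricted. *)
Definition regular_submodel pi P (Pt : R -> probability O R)
    (s : O -> R) : Prop :=
  [/\ forall B, measurable B -> Pt 0 B = P B,
      s \in Lfun P 2%:E,
      qmd_at0 Pt s,
      (exists M : R, \forall t \near (0 : R),
         ('E_(Pt t)[fun o => (oY o ^+ 2)%R] <= M%:E)%E) &
      (exists2 eps : R, 0 < eps &
         \forall t \near (0 : R), relevance_bound pi (Pt t) eps)].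

End observed_data.

Section observation.
Context {R : realType} {d dZ dL : measure_display} {T : measurableType d}
  {TZ : measurableType dZ} {TL : measurableType dL}.
Variables (Z : {mfun T >-> TZ}) (A : {mfun T >-> bool}) (Y : {mfun T >-> R})
  (L : {mfun T >-> TL}).

Definition observation (w : T) : obs_space R TZ TL := (Z w, A w, Y w, L w).

Lemma measurable_observation : measurable_fun setT observation.
Proof.
apply: measurable_fun_pair => //.
apply: measurable_fun_pair => //.
exact: measurable_fun_pair.
Qed.

HB.instance Definition _ :=
  isMeasurableFun.Build _ _ _ _ observation measurable_observation.

End observation.

Definition observed_law {R : realType} {d dZ dL : measure_display}
    {T : measurableType d} {TZ : measurableType dZ} {TL : measurableType dL}
    (P : probability T R) (Z : {mfun T >-> TZ}) (A : {mfun T >-> bool})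
    (Y : {mfun T >-> R}) (L : {mfun T >-> TL})
    : probability (obs_space R TZ TL) R :=
  distribution P (observation Z A Y L).

(* Main.v *)
(** Let P be the true law, Q another law of a submodel with score s at distance
t, gamma_P = Cov_P(Y, pi | L) / Cov_P(A, pi | L), and
Y' = Y - eta - gamma_P (A - delta) the residual under P. On every set of values
of L the identity
<<
  E_Q[gamma_Q] - E_P[gamma_P] = (E_Q - E_P)[gamma_P + Y' (pi - rho_Q) / kappa_Q]
>>
is exact, because Cov_Q(Y', pi | L) = kappa_Q (gamma_Q - gamma_P) and both
E_P[Y' | L] and Cov_P(Y', pi | L) vanish. As rho_Q - rho_P and
kappa_Q - kappa_P are O(t) in L^1, the integrand is the influence function up to
an error that disappears in the limit. Differentiability in quadratic mean
linearizes (E_Q - E_P)[Phi], uniformly over all Phi whose second moments under P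
and Q are bounded. The second moments of Y are only known to be bounded along the
path, and eta_P, gamma_P need not be integrable under Q; so the identity is used
only where eta_P^2 + gamma_P^2 <= t^-2, a set whose complement has probability
o(t^2) under both laws. Uniqueness follows from the submodels (1 + t s) P with
bounded centred s, along which relevance is preserved. *)
Require Import Defs.
From HB Require Import structures.
From mathcomp Require Import all_boot all_order all_algebra.
From mathcomp Require Import all_classical all_reals all_analysis.
From mathcomp Require Import measurable_realfun ring lra.

Set Implicit Arguments.
Unset Strict Implicit.
Unset Printing Implicit Defensive.

Import Order.TTheory GRing.Theory Num.Theory.
Import numFieldNormedType.Exports.

Local Open Scope classical_set_scope.
Local Open Scope ring_scope.

(** No regularity in [t] is assumed of the nuisance functions of [Pt t]: they are mere versions of
    conditional expectations, under a law that need not be absolutely continuous with respect to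
    [P], nor [P] with respect to it. They are therefore compared only in integrated form, by testing
    against bounded functions of [V], and an almost sure property of one law holds under the other
    outside an event whose probability is bounded by the Hellinger distance on that event. The L^1
    rate for the nuisance functions does not suffice by itself, because their drift is multiplied by
    the residual and the score, whose product is merely integrable. Two scales repair this. The
    accuracy [e] is fixed first; [w] is then taken so small that every event of probability at most
    a constant times [w ^+ 2] carries at most [e ^+ 2] of the integral of [s ^+ 2] plus the squared
    nuisances; finally |t| is at most [e ^+ 2 * w ^+ 2]. All exceptional events are then small in
    that sense, and every error is at most a constant times e |t|, with a constant that does not
    depend on [t], [e] or [w]. *)

Section integrable_real.
Context {R : realType} {d : measure_display} {T : measurableType d}.
Implicit Types (mu : {measure set T -> \bar R}) (f g h : T -> R).

Definition L1 mu f : Prop := mu.-integrable setT (EFin \o f).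

Definition L2 mu f : Prop := measurable_fun setT f /\ L1 mu (fun x => f x ^+ 2).

(** The bound holds at every point, so that one and the same function is admissible under all laws
    at once. *)
Definition bm f : Prop :=
  measurable_fun setT f /\ exists C, forall x, `|f x| <= C.

Lemma L1_meas mu f : L1 mu f -> measurable_fun setT f.
Proof. by move=> /integrableP[/measurable_EFinP]. Qed.

Lemma L2_meas mu f : L2 mu f -> measurable_fun setT f.
Proof. by case. Qed.

Lemma bm_meas f : bm f -> measurable_fun setT f.
Proof. by case. Qed.

Lemma L1_le mu f g : measurable_fun setT f -> (forall x, `|f x| <= `|g x|) ->
  L1 mu g -> L1 mu f.
Proof.
move=> mf fg; apply: le_integrable => //; first exact/measurable_EFinP.
by move=> x _ /=; rewrite lee_fin.
Qed.

Lemma L1D mu f g : L1 mu f -> L1 mu g -> L1 mu (fun x => f x + g x).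
Proof.
move=> Lf Lg; rewrite /L1 (_ : _ \o _ = (EFin \o f) \+ (EFin \o g))%E//.
exact: integrableD.
Qed.

Lemma L1Z mu c f : L1 mu f -> L1 mu (fun x => c * f x).
Proof. by move=> Lf; exact: (integrableZl measurableT c Lf). Qed.

Lemma L1B mu f g : L1 mu f -> L1 mu g -> L1 mu (fun x => f x - g x).
Proof.
move=> Lf Lg; rewrite /L1 (_ : _ \o _ = (EFin \o f) \- (EFin \o g))%E//.
exact: integrableB.
Qed.

Lemma L1_bm mu f h : bm h -> L1 mu f -> L1 mu (fun x => h x * f x).
Proof.
move=> [mh [C hC]] Lf; apply: (L1_le _ _ (L1Z C Lf)).
  by apply: measurable_funM => //; exact: L1_meas Lf.
by move=> x; rewrite !normrM ler_wpM2r// (le_trans (hC x))// ler_norm.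
Qed.

Lemma L1_abs mu f : L1 mu f -> L1 mu (fun x => `|f x|).
Proof.
move=> Lf; apply: (L1_le _ _ Lf); last by move=> x; rewrite normr_id.
by apply: measurableT_comp => //; exact: L1_meas Lf.
Qed.

Lemma L2L2 mu f g : L2 mu f -> L2 mu g -> L1 mu (fun x => f x * g x).
Proof.
move=> [mf Lf] [mg Lg]; apply: (L1_le _ _ (L1D Lf Lg)).
  exact: measurable_funM.
move=> x; rewrite [leRHS]ger0_norm ?addr_ge0 ?sqr_ge0//.
by rewrite ler_norml; apply/andP; split; nra.
Qed.

Lemma L2_le mu f g : measurable_fun setT f -> (forall x, `|f x| <= `|g x|) ->
  L2 mu g -> L2 mu f.
Proof.
move=> mf fg [mg Lg]; split=> //; apply: (L1_le _ _ Lg).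
  exact: measurable_funX.
by move=> x; rewrite !normrX lerXn2r.
Qed.

Lemma L2D mu f g : L2 mu f -> L2 mu g -> L2 mu (fun x => f x + g x).
Proof.
move=> Lf Lg; have [mf Lf2] := Lf; have [mg Lg2] := Lg.
split; first exact: measurable_funD.
have := L1D (L1D Lf2 Lg2) (L1Z 2 (L2L2 Lf Lg)); rewrite /L1.
by apply: eq_integrable => // x _ /=; congr EFin; ring.
Qed.

Lemma L2_bm mu f h : bm h -> L2 mu f -> L2 mu (fun x => h x * f x).
Proof.
move=> [mh [C hC]] [mf Lf]; split; first exact: measurable_funM.
apply: (L1_le _ _ (L1Z (C ^+ 2) Lf)).
  by apply: measurable_funX => //; exact: measurable_funM.
move=> x; rewrite exprMn normrM [leRHS]normrM ler_wpM2r// !normrX lerXn2r ?nnegrE//.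
by rewrite (le_trans (hC x))// ler_norm.
Qed.

Lemma bm_cst c : bm (fun=> c).
Proof. by split => //; exists `|c|. Qed.

Lemma bm_indic D : measurable D -> bm (\1_D).
Proof.
move=> mD; split; first exact: measurable_indic.
by exists 1 => x; rewrite indicE ger0_norm ?ler0n// lern1 leq_b1.
Qed.

Lemma bmD f g : bm f -> bm g -> bm (fun x => f x + g x).
Proof.
move=> [mf [C fC]] [mg [D gD]]; split; first exact: measurable_funD.
by exists (C + D) => x; rewrite (le_trans (ler_normD _ _))// lerD.
Qed.

Lemma bmM f g : bm f -> bm g -> bm (fun x => f x * g x).
Proof.
move=> [mf [C fC]] [mg [D gD]]; split; first exact: measurable_funM.
by exists (C * D) => x; rewrite normrM ler_pM.
Qed.

Lemma bmN f : bm f -> bm (fun x => - f x).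
Proof.
move=> [mf [C fC]]; split; first exact: measurableT_comp.
by exists C => x; rewrite normrN.
Qed.

Lemma bmB f g : bm f -> bm g -> bm (fun x => f x - g x).
Proof. by move=> bf bg; apply: bmD => //; exact: bmN. Qed.

Lemma L2B mu f g : L2 mu f -> L2 mu g -> L2 mu (fun x => f x - g x).
Proof.
move=> Lf Lg; apply: L2D => //.
have := L2_bm (bm_cst (-1)) Lg.
by rewrite (_ : (fun x => -1 * g x) = (fun x => - g x))//; apply/funext => x; ring.
Qed.

(** Off 0 the inverse is [f / f ^+ 2], and real powers of the nonnegative [f ^+ 2] are measurable;
    where [f] is 0, the conventions make both sides 0. *)
Lemma measurable_inv f : measurable_fun setT f ->
  measurable_fun setT (fun x => (f x)^-1).
Proof.
move=> mf; rewrite (_ : (fun x => _) = (fun x => f x * ((f x ^+ 2) `^ (-1)))).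
  apply: measurable_funM => //.
  apply: (measurableT_comp (measurable_powR (-1))).
  exact: measurable_funX.
apply/funext => x; rewrite powR_inv1 ?sqr_ge0//.
have [->|f0] := eqVneq (f x) 0; first by rewrite expr0n /= invr0 mul0r.
by rewrite expr2 invfM mulrA divff// mul1r.
Qed.

Lemma RintD mu f g : L1 mu f -> L1 mu g ->
  \int[mu]_x (f x + g x) = \int[mu]_x f x + \int[mu]_x g x.
Proof. exact: RintegralD. Qed.

Lemma RintB mu f g : L1 mu f -> L1 mu g ->
  \int[mu]_x (f x - g x) = \int[mu]_x f x - \int[mu]_x g x.
Proof. exact: RintegralB. Qed.

Lemma RintZ mu c f : L1 mu f -> \int[mu]_x (c * f x) = c * \int[mu]_x f x.
Proof. exact: RintegralZl. Qed.

Lemma Rint_eq mu f g : (forall x, f x = g x) ->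
  \int[mu]_x f x = \int[mu]_x g x.
Proof. by move=> fg; apply: eq_Rintegral => x _. Qed.

Lemma Rint_le mu f g : L1 mu f -> L1 mu g -> (forall x, f x <= g x) ->
  \int[mu]_x f x <= \int[mu]_x g x.
Proof. by move=> Lf Lg fg; apply: le_Rintegral. Qed.

Lemma Rint_ge0 mu f : (forall x, 0 <= f x) -> 0 <= \int[mu]_x f x.
Proof. by move=> f0; apply: Rintegral_ge0. Qed.

Lemma Rint_abs mu f : L1 mu f -> `|\int[mu]_x f x| <= \int[mu]_x `|f x|.
Proof. exact: le_normr_Rintegral. Qed.

Lemma L1_ext mu f g : (forall x, f x = g x) -> L1 mu f -> L1 mu g.
Proof. by move=> fg; rewrite (_ : f = g)//; exact/funext. Qed.

Lemma EFin_Rint mu f : L1 mu f ->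
  (\int[mu]_x (f x)%:E)%E = (\int[mu]_x f x)%:E.
Proof. by move=> Lf; rewrite fineK// integrable_fin_num. Qed.

Lemma Rint_ae_eq mu f g : measurable_fun setT f -> measurable_fun setT g ->
  {ae mu, forall x, f x = g x} -> \int[mu]_x f x = \int[mu]_x g x.
Proof.
move=> mf mg fg; congr fine; apply: ae_eq_integral => //.
- exact/measurable_EFinP.
- exact/measurable_EFinP.
- by apply: filterS fg => x /= -> .
Qed.

Lemma L1_ae_eq mu f g : measurable_fun setT g ->
  {ae mu, forall x, f x = g x} -> L1 mu f -> L1 mu g.
Proof.
move=> mg fg /integrableP[mf foo]; apply/integrableP; split.
  exact/measurable_EFinP.
rewrite (_ : (\int[mu]_x _)%E = (\int[mu]_x `|(EFin \o f) x|)%E)//.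
apply: ae_eq_integral => //.
- by apply: measurableT_comp => //; exact/measurable_EFinP.
- exact: measurableT_comp.
- by apply: filterS fg => x /= -> .
Qed.

(** The maximum of the two absolute values agrees almost everywhere with that of [g], hence is
    integrable, and it dominates [f] at every point. *)
Lemma L1_ae_le mu f g : measurable_fun setT f ->
  {ae mu, forall x, `|f x| <= `|g x|} -> L1 mu g -> L1 mu f.
Proof.
move=> mf fg Lg; have mg := L1_meas Lg.
have mm : measurable_fun setT (fun x => Num.max `|f x| `|g x|).
  by apply: measurable_maxr; apply: measurableT_comp.
have : L1 mu (fun x => Num.max `|f x| `|g x|).
  apply: L1_ae_eq (L1_abs Lg) => //.
  by apply: filterS fg => x /= h; rewrite max_r.
apply: L1_le => // x; rewrite [leRHS]ger0_norm ?le_max ?lexx//.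
by rewrite normr_ge0.
Qed.

Lemma L2_ae_le mu f g : measurable_fun setT f ->
  {ae mu, forall x, `|f x| <= `|g x|} -> L2 mu g -> L2 mu f.
Proof.
move=> mf fg [mg Lg]; split=> //; apply: (L1_ae_le _ _ Lg).
  exact: measurable_funX.
by apply: filterS fg => x h; rewrite !normrX lerXn2r.
Qed.

Lemma Rint_ae_le mu f g : L1 mu f -> L1 mu g ->
  {ae mu, forall x, f x <= g x} -> \int[mu]_x f x <= \int[mu]_x g x.
Proof.
move=> Lf Lg fg.
have mf := L1_meas Lf; have mg := L1_meas Lg.
have mm : measurable_fun setT (fun x => Num.max (f x) (g x)).
  exact: measurable_maxr.
have e : {ae mu, forall x, g x = Num.max (f x) (g x)}.
  by apply: filterS fg => x h; rewrite max_r.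
rewrite (Rint_ae_eq mg mm e); apply: Rint_le => //.
  exact: L1_ae_eq e Lg.
by move=> x; rewrite le_max lexx.
Qed.

Lemma cauchy_schwarz mu f g : L2 mu f -> L2 mu g ->
  (\int[mu]_x (f x * g x)) ^+ 2 <=
  (\int[mu]_x f x ^+ 2) * (\int[mu]_x g x ^+ 2).
Proof.
move=> Lf Lg; set a := \int[mu]_x f x ^+ 2; set b := \int[mu]_x g x ^+ 2.
set c := \int[mu]_x _.
have Lfg := L2L2 Lf Lg; have [_ Lf2] := Lf; have [_ Lg2] := Lg.
have quad l m : 0 <= l ^+ 2 * a + m ^+ 2 * b + 2 * l * m * c.
  rewrite /a /b /c -!RintZ// -!RintD//;
    try by repeat first [exact: L1Z | apply: L1D].
  apply: Rint_ge0 => x.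
  by rewrite (_ : _ + _ = (l * f x + m * g x) ^+ 2) ?sqr_ge0//; ring.
have a0 : 0 <= a by apply: Rint_ge0 => x; exact: sqr_ge0.
have b0 : 0 <= b by apply: Rint_ge0 => x; exact: sqr_ge0.
(* With these coefficients the form equals [b * (a * b - c ^+ 2)] and [a * (a * b - c ^+ 2)]. Their
   sum decides the claim unless [a + b = 0], where both vanish and the coefficients 1 and [- c]
   force [c = 0]. *)
have q1 := quad b (- c); have q2 := quad (- c) a.
have [ab0|ab] := eqVneq (a + b) 0.
  have a00 : a = 0 by lra.
  have b00 : b = 0 by lra.
  have := quad 1 (- c); rewrite a00 b00; nra.
have abp : 0 < a + b by rewrite lt_neqAle eq_sym ab addr_ge0.
rewrite -subr_ge0 -(pmulr_rge0 _ abp).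
nra.
Qed.

End integrable_real.

(** * Conditional expectation *)

(** The identity on sets determines [q], up to a [mu]-null set, as the Radon-Nikodym derivative of
    [nu], and integrals change variables along that derivative. *)
Lemma ge0_integral_density {R : realType} {d : measure_display}
    {T : measurableType d} (nu : {finite_measure set T -> \bar R})
    (mu : {sigma_finite_measure set T -> \bar R}) (q f : T -> R) :
  measurable_fun setT q -> (forall x, 0 <= q x) ->
  (forall B, measurable B -> nu B = \int[mu]_(x in B) (q x)%:E)%E ->
  measurable_fun setT f -> (forall x, 0 <= f x) ->
  (\int[nu]_x (f x)%:E = \int[mu]_x (f x * q x)%:E)%E.
Proof.
move=> mq q0 nuE mf f0.
have dom : nu `<< mu.
  apply/null_content_dominatesP => A mA A0; rewrite nuE//.
  apply: null_set_integral => //.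
  exact/measurable_funTS/measurable_EFinP.
have f0' x : (0 <= (f x)%:E)%E by rewrite lee_fin.
rewrite -(Radon_Nikodym_SigmaFinite.change_of_variables dom f0' measurableT)//;
  last exact/measurable_EFinP.
have RNi := Radon_Nikodym_SigmaFinite.f_integrable dom.
apply: ae_eq_integral => //.
- apply: emeasurable_funM; first exact/measurable_EFinP.
  exact: measurable_int RNi.
- by apply/measurable_EFinP; exact: measurable_funM.
have : ae_eq mu setT (Radon_Nikodym_SigmaFinite.f nu mu) (EFin \o q).
  apply: integral_ae_eq => //; first exact/measurable_EFinP.
  by move=> E _ mE; rewrite -Radon_Nikodym_SigmaFinite.f_integral// nuE.
by apply: filterS => x /= h _; rewrite h// EFinM.
Qed.

Section weighted_measure.
Context {R : realType} {d : measure_display} {T : measurableType d}.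
Variables (P : probability T R) (q : T -> R).
Hypotheses (q0 : forall x, 0 <= q x) (Lq : L1 P q).

(** The measure with density [q]. The two proofs are arguments of the set function so that its
    measure structure can be inferred from the term. *)
Definition weighted of (forall x, 0 <= q x) & L1 P q : set T -> \bar R :=
  fun B => (\int[P]_(x in B) (q x)%:E)%E.

Local Notation nu := (weighted q0 Lq).

Let nu_set0 : nu set0 = 0%E. Proof. by rewrite /weighted integral_set0. Qed.

Let nu_ge0 B : (0 <= nu B)%E.
Proof. by apply: integral_ge0 => x _; rewrite lee_fin. Qed.

Let nu_sigma_additive : semi_sigma_additive nu.
Proof.
apply: semi_sigma_additive_nng_induced => //.
by apply/measurable_EFinP; exact: L1_meas Lq.
Qed.

HB.instance Definition _ :=
  isMeasure.Build _ _ _ nu nu_set0 nu_ge0 nu_sigma_additive.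

Let nu_fin : fin_num_fun nu.
Proof.
move=> B mB; apply: integrable_fin_num => //.
exact: (integrableS measurableT).
Qed.

HB.instance Definition _ := Measure_isFinite.Build _ _ _ nu nu_fin.

End weighted_measure.

Section conditional_expectation.
Context {R : realType} {d d' : measure_display}
  {T : measurableType d} {T' : measurableType d'}.
Variables (P : probability T R) (V : {mfun T >-> T'}).
Implicit Types (X : T -> R) (m g : T' -> R).

(** The version is the Radon-Nikodym derivative, relative to the law of [V], of the image under [V]
    of the charge with density [X]. It is finite everywhere, so [fine] loses nothing. *)
Lemma is_cond_exp_cond_exp X : L1 P X -> is_cond_exp P V X (cond_exp P V X).
Proof.
move=> LX; apply: (@xgetPex _ (cst 0) (is_cond_exp P V X)).
pose nu := measure_function_pushforward__canonical__charge_Charge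
  (induced_charge LX) (measurable_funPT V).
pose mu : {sigma_finite_measure set T' -> \bar R} := distribution P V.
have dom : nu `<< mu.
  apply/null_content_dominatesP => A mA; rewrite /mu /nu /= => A0.
  apply: null_set_integral => //.
    by rewrite -[X in measurable X]setTI; exact: measurable_funPT.
  exact: measurable_funTS (measurable_int _ LX).
have RNi := Radon_Nikodym_integrable dom.
have RNf x := Radon_Nikodym_fin_num x dom.
pose e x := fine (Radon_Nikodym nu mu x).
have eE x : (e x)%:E = Radon_Nikodym nu mu x by rewrite fineK.
have me : measurable_fun setT e.
  by apply: measurableT_comp => //; exact: measurable_int RNi.
have ie : P.-integrable setT (EFin \o (e \o V)).
  have : mu.-integrable setT (EFin \o e).
    by rewrite (_ : EFin \o e = Radon_Nikodym nu mu)//; exact/funext.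
  move=> /integrableP[m1 m2]; apply/integrableP; split.
    by apply/measurable_EFinP; exact: measurableT_comp.
  move: m2; rewrite /mu /distribution ge0_integral_pushforward//.
  by apply: measurableT_comp => //; exact/measurable_EFinP.
exists e; split=> // B mB.
have := Radon_Nikodym_integral dom mB.
rewrite {1}/nu /= /pushforward /induced_charge /= => ->.
under eq_integral do rewrite -eE.
rewrite /mu /distribution integral_pushforward//.
- exact/measurable_EFinP.
- apply: integrableS ie => //.
  by rewrite -[X in measurable X]setTI; exact: measurable_funPT.
Qed.

(** The positive and negative parts of [X - m \o V], taken as densities, give two finite measures
    with the same image under [V], and these integrate every nonnegative function of [V] alike. This
    covers an unbounded [g] directly, through its own positive and negative parts. *)
Lemma cond_exp_pull X m g : is_cond_exp P V X m -> L1 P X ->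
  measurable_fun setT g -> L1 P (fun x => g (V x) * X x) ->
  L1 P (fun x => g (V x) * m (V x)) ->
  \int[P]_x (g (V x) * X x) = \int[P]_x (g (V x) * m (V x)).
Proof.
move=> [mm im Xm] LX mg LgX Lgm.
pose Z x := X x - m (V x).
have LZ : L1 P Z by exact: L1B.
have mZ := L1_meas LZ.
have LgZ : L1 P (fun x => g (V x) * Z x).
  by apply: L1_ext (L1B LgX Lgm) => x; rewrite /Z mulrBr.
pose Zp x := Num.max (Z x) 0; pose Zn x := Num.max (- Z x) 0.
have mZp : measurable_fun setT Zp by exact: measurable_maxr.
have mZn : measurable_fun setT Zn.
  by apply: measurable_maxr => //; exact: measurableT_comp.
have Zp0 x : 0 <= Zp x by rewrite le_max lexx orbT.
have Zn0 x : 0 <= Zn x by rewrite le_max lexx orbT.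
have ZE x : Z x = Zp x - Zn x.
  by rewrite /Zp /Zn; case: (lerP (Z x) 0); case: (lerP (- Z x) 0); lra.
have Zple x : `|Zp x| <= `|Z x|.
  rewrite ger0_norm// /Zp; case: (lerP (Z x) 0) => // _; exact: ler_norm.
have Znle x : `|Zn x| <= `|Z x|.
  rewrite ger0_norm// /Zn -normrN; case: (lerP (- Z x) 0) => // _; exact: ler_norm.
have LZp : L1 P Zp by exact: L1_le LZ.
have LZn : L1 P Zn by exact: L1_le LZ.
have eqw B : measurable B ->
    weighted Zp0 LZp (V @^-1` B) = weighted Zn0 LZn (V @^-1` B).
  move=> mB; have mVB : measurable (V @^-1` B).
    by rewrite -[X in measurable X]setTI; exact: measurable_funPT.
  have iB f : L1 P f -> P.-integrable (V @^-1` B) (EFin \o f).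
    by move=> Lf; apply: integrableS Lf.
  have := Xm _ mB; rewrite /weighted => XmB.
  have iX := iB _ LX; have im' := iB _ im.
  have iZp := iB _ LZp; have iZn := iB _ LZn.
  have : \int[P]_(x in V @^-1` B) Z x = 0.
    rewrite RintegralB//; apply/eqP; rewrite subr_eq0; apply/eqP.
    exact: congr1 XmB.
  under eq_Rintegral do rewrite ZE.
  rewrite RintegralB// => /eqP; rewrite subr_eq0 => /eqP ZpZn.
  rewrite -[LHS]fineK; last exact: integrable_fin_num.
  rewrite -[RHS]fineK; last exact: integrable_fin_num.
  by congr EFin.
have eqh (h : T' -> R) : measurable_fun setT h -> (forall y, 0 <= h y) ->
    (\int[P]_x (h (V x) * Zp x)%:E = \int[P]_x (h (V x) * Zn x)%:E)%E.
  move=> mh h0.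
  have mhV : measurable_fun setT (h \o V) by exact: measurableT_comp.
  have aux Q (Q0 : forall x, 0 <= Q x) (LQ : L1 P Q) :
      (\int[P]_x (h (V x) * Q x)%:E =
       \int[pushforward (weighted Q0 LQ) V]_y (h y)%:E)%E.
    rewrite ge0_integral_pushforward//.
    - rewrite (@ge0_integral_density _ _ _ (weighted Q0 LQ) P Q (h \o V))//.
        exact: L1_meas LQ.
      by move=> x; exact: h0.
    - exact/measurable_EFinP.
    - by move=> y _; rewrite lee_fin.
  rewrite (aux _ Zp0 LZp) (aux _ Zn0 LZn).
  by apply: eq_measure_integral => A mA _; exact: eqw.
pose gp y := Num.max (g y) 0; pose gn y := Num.max (- g y) 0.
have mgp : measurable_fun setT gp by exact: measurable_maxr.
have mgn : measurable_fun setT gn.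
  by apply: measurable_maxr => //; exact: measurableT_comp.
have gp0 x : 0 <= gp x by rewrite le_max lexx orbT.
have gn0 x : 0 <= gn x by rewrite le_max lexx orbT.
have gE x : g x = gp x - gn x.
  by rewrite /gp /gn; case: (lerP (g x) 0); case: (lerP (- g x) 0); lra.
have gple x : `|gp x| <= `|g x|.
  rewrite ger0_norm// /gp; case: (lerP (g x) 0) => // _; exact: ler_norm.
have gnle x : `|gn x| <= `|g x|.
  rewrite ger0_norm// /gn -normrN; case: (lerP (- g x) 0) => // _; exact: ler_norm.
have LhQ (h : T' -> R) (Q : T -> R) : measurable_fun setT h -> (forall y, `|h y| <= `|g y|) ->
    measurable_fun setT Q -> (forall x, `|Q x| <= `|Z x|) ->
    L1 P (fun x => h (V x) * Q x).
  move=> mh hg mQ QZ; apply: L1_le LgZ.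
    by apply: measurable_funM => //; exact: measurableT_comp.
  by move=> x; rewrite !normrM ler_pM.
have Rp : \int[P]_x (gp (V x) * Zp x) = \int[P]_x (gp (V x) * Zn x).
  by rewrite /Rintegral (eqh _ mgp gp0).
have Rn : \int[P]_x (gn (V x) * Zp x) = \int[P]_x (gn (V x) * Zn x).
  by rewrite /Rintegral (eqh _ mgn gn0).
apply/eqP; rewrite -subr_eq0 -RintB//.
rewrite (_ : \int[P]_x _ = \int[P]_x ((gp (V x) * Zp x - gp (V x) * Zn x) -
   (gn (V x) * Zp x - gn (V x) * Zn x))); last first.
  apply: Rint_eq => x; rewrite -mulrBr -[X x - _]/(Z x) ZE gE; ring.
have L1' := LhQ gp Zp mgp gple mZp Zple; have L2' := LhQ gp Zn mgp gple mZn Znle.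
have L3' := LhQ gn Zp mgn gnle mZp Zple; have L4' := LhQ gn Zn mgn gnle mZn Znle.
rewrite RintB; [|exact: L1B|exact: L1B].
by rewrite !RintB// Rp Rn !subrr.
Qed.

Lemma bmV g : bm g -> bm (g \o V).
Proof.
move=> [mg [C hC]]; split; first exact: measurableT_comp.
by exists C => x; exact: hC.
Qed.

(** The hypothesis is applied to the set [[set y | 0 < Z y]], over which the integrand is
    nonnegative and must therefore vanish almost surely. *)
Lemma ae_le0_comp (Z : T' -> R) : measurable_fun setT Z -> L1 P (Z \o V) ->
  (forall B, measurable B -> \int[P]_x (\1_B (V x) * Z (V x)) <= 0) ->
  {ae P, forall x, Z (V x) <= 0}.
Proof.
move=> mZ LZ ZB.
pose B := [set y | 0 < Z y].
have mB : measurable B.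
  have := mZ measurableT `]0, +oo[%classic (measurable_itv _).
  rewrite setTI (_ : _ @^-1` _ = B)//.
  by apply/seteqP; split => y; rewrite /B /= in_itv/= andbT.
have LL : L1 P (fun x => \1_B (V x) * Z (V x)).
  exact: (L1_bm (bmV (bm_indic mB))).
have ge0 x : 0 <= \1_B (V x) * Z (V x).
  rewrite indicE; case: (boolP (V x \in B)) => [/set_mem|_]; last by rewrite mul0r.
  by rewrite /B /= mul1r => /ltW.
have eq0 : (\int[P]_x (\1_B (V x) * Z (V x))%:E = 0)%E.
  rewrite EFin_Rint//; congr EFin; apply/eqP; rewrite eq_le ZB//.
  exact: Rint_ge0.
have : ae_eq P setT (fun x => (\1_B (V x) * Z (V x))%:E) (cst 0%E).
  apply/ae_eq_integral_abs => //; first exact/measurable_EFinP/(L1_meas LL).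
  rewrite -[RHS]eq0; apply: eq_integral => x _.
  by rewrite gee0_abs// lee_fin.
apply: filterS => x /= /(_ I)[].
rewrite leNgt indicE; case: (boolP (V x \in B)).
  by rewrite mul1r => /set_mem; rewrite /B /= => h0 h; lra.
by move=> h _; apply/negP => cm; move/negP: h; apply; exact/mem_set.
Qed.

Lemma Rint_cst c : \int[P]_x (fun=> c) x = c :> R.
Proof. by rewrite Rintegral_cst// [X in fine X](probability_setT P) mulr1. Qed.

Lemma L1_cst c : L1 P (fun=> c).
Proof. exact: finite_measure_integrable_cst. Qed.

Lemma bm_L1 (h : T -> R) : bm h -> L1 P h.
Proof.
move=> bh; apply: L1_ext (L1_bm bh (L1_cst 1)) => x; exact: mulr1.
Qed.

Lemma bm_L2 (h : T -> R) : bm h -> L2 P h.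
Proof.
move=> bh; split; first exact: bm_meas.
by apply: bm_L1; exact: (bmM bh bh).
Qed.

Lemma L2_L1 (h : T -> R) : L2 P h -> L1 P h.
Proof.
move=> Lh; apply: L1_ext (L2L2 Lh (bm_L2 (bm_cst 1))) => x; exact: mulr1.
Qed.

Lemma cond_exp_pullB X m B : is_cond_exp P V X m -> L1 P X -> measurable B ->
  \int[P]_x (\1_B (V x) * X x) = \int[P]_x (\1_B (V x) * m (V x)).
Proof.
move=> cXm LX mB; have [mm im _] := cXm.
have bB : bm (\1_B : T' -> R) by exact: bm_indic.
by apply: (cond_exp_pull cXm LX (bm_meas bB)); exact: (L1_bm (bmV bB)).
Qed.

Lemma cond_exp_le X m c : is_cond_exp P V X m -> L1 P X ->
  {ae P, forall x, X x <= c} -> {ae P, forall x, m (V x) <= c}.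
Proof.
move=> cXm LX Xc; have [mm im _] := cXm.
have LB B f : measurable B -> L1 P f -> L1 P (fun x => \1_B (V x) * f x).
  by move=> mB Lf; apply: (L1_bm (bmV (bm_indic mB))).
have := @ae_le0_comp (fun y => m y - c).
move=> h; have {h} : {ae P, forall x, m (V x) - c <= 0}; last first.
  by apply: filterS => x; rewrite subr_le0.
apply: h; first exact: measurable_funB.
  by apply: L1B => //; exact: L1_cst.
move=> B mB; rewrite (_ : \int[P]_x _ =
    \int[P]_x (\1_B (V x) * m (V x) - \1_B (V x) * c)); last first.
  by apply: Rint_eq => x; rewrite mulrBr.
have LBc := LB _ _ mB (L1_cst c).
rewrite RintB//; last exact: LB.
rewrite -(cond_exp_pullB cXm)// subr_le0; apply: Rint_ae_le => //.
  exact: LB.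
by apply: filterS Xc => x xc; rewrite ler_wpM2l// indicE.
Qed.

Lemma cond_exp_ge X m c : is_cond_exp P V X m -> L1 P X ->
  {ae P, forall x, c <= X x} -> {ae P, forall x, c <= m (V x)}.
Proof.
move=> cXm LX Xc; have [mm im _] := cXm.
have LB B f : measurable B -> L1 P f -> L1 P (fun x => \1_B (V x) * f x).
  by move=> mB Lf; apply: (L1_bm (bmV (bm_indic mB))).
have := @ae_le0_comp (fun y => c - m y).
move=> h; have {h} : {ae P, forall x, c - m (V x) <= 0}; last first.
  by apply: filterS => x; rewrite subr_le0.
apply: h; first exact: measurable_funB.
  by apply: L1B => //; exact: L1_cst.
move=> B mB; rewrite (_ : \int[P]_x _ =
    \int[P]_x (\1_B (V x) * c - \1_B (V x) * m (V x))); last first.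
  by apply: Rint_eq => x; rewrite mulrBr.
have LBc := LB _ _ mB (L1_cst c).
rewrite RintB//; last exact: LB.
rewrite -(cond_exp_pullB cXm)// subr_le0; apply: Rint_ae_le => //.
  exact: LB.
by apply: filterS Xc => x xc; rewrite ler_wpM2l// indicE.
Qed.

Lemma cond_exp_abs_le X m c : is_cond_exp P V X m -> L1 P X ->
  {ae P, forall x, `|X x| <= c} -> {ae P, forall x, `|m (V x)| <= c}.
Proof.
move=> cXm LX Xc.
have h1 : {ae P, forall x, m (V x) <= c}.
  by apply: (cond_exp_le cXm) => //; apply: filterS Xc => x; rewrite ler_norml => /andP[].
have h2 : {ae P, forall x, - c <= m (V x)}.
  by apply: (cond_exp_ge cXm) => //; apply: filterS Xc => x; rewrite ler_norml => /andP[].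
by apply: filterS2 h1 h2 => x a b; rewrite ler_norml a b.
Qed.

(** Square integrability of [m] is part of the claim, so the contraction is first shown for [m] cut
    off at level [k]: pulling out [g k] and applying Cauchy-Schwarz bounds its second moment by [b],
    uniformly in [k]. Monotone convergence removes the cut-off. *)
Lemma cond_exp_L2 X m : is_cond_exp P V X m -> L2 P X ->
  L2 P (m \o V) /\ \int[P]_x m (V x) ^+ 2 <= \int[P]_x X x ^+ 2.
Proof.
move=> cXm LX; have [mm im _] := cXm.
have L1X := L2_L1 LX.
pose D (k : nat) := [set y | `|m y| <= k%:R].
have mD k : measurable (D k).
  have : measurable_fun setT (fun y => `|m y|) by exact: measurableT_comp.
  move=> /(_ measurableT `]-oo, k%:R]%classic (measurable_itv _)).
  by rewrite setTI.
pose g k y := \1_(D k) y * m y.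
have bg k : bm (g k).
  split; first by apply: measurable_funM => //; exact: measurable_indic.
  exists k%:R => y; rewrite /g indicE; case: (boolP (y \in D k)) => [/set_mem|_].
    by rewrite mul1r.
  by rewrite mul0r normr0.
have g2 k y : g k y ^+ 2 = g k y * m y.
  by rewrite /g indicE; case: (y \in D k); rewrite ?mul1r ?mul0r// expr0n.
set b := \int[P]_x X x ^+ 2.
have b0 : 0 <= b by apply: Rint_ge0 => x; exact: sqr_ge0.
have gle k : \int[P]_x g k (V x) ^+ 2 <= b.
  have E : \int[P]_x g k (V x) ^+ 2 = \int[P]_x (g k (V x) * X x).
    rewrite (cond_exp_pull cXm)//.
    - by apply: Rint_eq => x; exact: g2.
    - exact: bm_meas (bg k).
    - exact: (L1_bm (bmV (bg k))).
    - exact: (L1_bm (bmV (bg k))).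
  set a := \int[P]_x _ in E *.
  have a0 : 0 <= a by apply: Rint_ge0 => x; exact: sqr_ge0.
  have : a ^+ 2 <= a * b.
    by rewrite {1}E; exact: cauchy_schwarz (bm_L2 (bmV (bg k))) LX.
  rewrite expr2 => h; have [->//|an0] := eqVneq a 0.
  by rewrite -(ler_pM2l (_ : 0 < a))// lt_neqAle eq_sym an0.
have mf k : measurable_fun setT (fun x => (g k (V x) ^+ 2)%:E).
  apply/measurable_EFinP/measurable_funX.
  exact: bm_meas (bmV (bg k)).
have nd x : {homo (fun k => (g k (V x) ^+ 2)%:E) : k l / (k <= l)%N >-> (k <= l)%E}.
  move=> k l kl; rewrite lee_fin /g !indicE.
  case: (boolP (V x \in D k)) => [/set_mem|_]; last first.
    by rewrite mul0r expr0n/= sqr_ge0.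
  rewrite /D /= => h; rewrite mem_set//= /D /=.
  by rewrite (le_trans h)// ler_nat.
have limE x : lim ((fun k => (g k (V x) ^+ 2)%:E) @ \oo) = (m (V x) ^+ 2)%:E.
  apply: lim_near_cst => //.
  have [k0 hk0] : exists k0 : nat, `|m (V x)| <= k0%:R.
    exists (Num.truncn `|m (V x)|).+1; apply: ltW; exact: truncnS_gt.
  exists k0 => // k /= k0k; rewrite /g indicE mem_set/= ?mul1r//.
  by rewrite /D /= (le_trans hk0)// ler_nat.
have MC : (\int[P]_x (m (V x) ^+ 2)%:E <= b%:E)%E.
  under eq_integral do rewrite -limE.
  rewrite monotone_convergence//; first last.
    by move=> k x _; rewrite lee_fin sqr_ge0.
  apply: lime_le.
    apply: ereal_nondecreasing_is_cvgn => k l kl.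
    by apply: ge0_le_integral => //= x _; [rewrite lee_fin sqr_ge0..|exact: nd].
  apply: nearW => k; rewrite EFin_Rint ?lee_fin//.
  by case: (bm_L2 (bmV (bg k))).
have mmV : measurable_fun setT (m \o V) by exact: measurableT_comp.
have LmV : L2 P (m \o V).
  split => //; apply/integrableP; split.
    by apply/measurable_EFinP; exact: measurable_funX.
  apply: le_lt_trans (ltry b); apply: le_trans MC.
  by under eq_integral do rewrite /= ger0_norm ?sqr_ge0//.
split=> //; rewrite -lee_fin -EFin_Rint//; by case: LmV.
Qed.

End conditional_expectation.

(** * Hellinger bounds along a path differentiable in quadratic mean *)

Lemma ler_norm_sqr {R : realDomainType} (a b : R) :
  0 <= b -> a ^+ 2 <= b ^+ 2 -> `|a| <= b.
Proof.
by move=> b0 ab; rewrite -(ler_pXn2r (ltn0Sn 1)) ?nnegrE// real_normK ?num_real.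
Qed.

Lemma measurable_sqrt {R : realType} {d : measure_display} {T : measurableType d}
  (f : T -> R) : measurable_fun setT f ->
  measurable_fun setT (fun x => Num.sqrt (f x)).
Proof.
move=> mf; apply: measurableT_comp => //.
by apply: continuous_measurable_fun; exact: sqrt_continuous.
Qed.

Section density.
Context {R : realType} {d : measure_display} {T : measurableType d}.
Variables (mu : {sigma_finite_measure set T -> \bar R}) (P : probability T R).
Variable p : T -> R.
Hypotheses (mp : measurable_fun setT p) (p0 : forall x, 0 <= p x).
Hypothesis PE : forall B, measurable B -> (P B = \int[mu]_(x in B) (p x)%:E)%E.

Lemma L1_density f : L1 P f -> L1 mu (fun x => f x * p x).
Proof.
move=> Lf; have mf := L1_meas Lf.
apply/integrableP; split; first exact/measurable_EFinP/measurable_funM.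
move: (L1_abs Lf) => /integrableP[_].
rewrite (eq_integral (fun x => `|f x|%:E)) => [|x _]; last first.
  by rewrite /= normr_id.
rewrite (ge0_integral_density mp p0 PE)//; last exact: measurableT_comp.
apply: le_lt_trans; rewrite le_eqVlt; apply/orP; left; apply/eqP.
by apply: eq_integral => x _; rewrite /= normrM [`|p x|]ger0_norm.
Qed.

Lemma Rint_density f : L1 P f -> \int[P]_x f x = \int[mu]_x (f x * p x).
Proof.
move=> Lf; have mf := L1_meas Lf.
pose fp x := Num.max (f x) 0; pose fn x := Num.max (- f x) 0.
have mfp : measurable_fun setT fp by exact: measurable_maxr.
have mfn : measurable_fun setT fn.
  by apply: measurable_maxr => //; exact: measurableT_comp.
have fp0 x : 0 <= fp x by rewrite le_max lexx orbT.
have fn0 x : 0 <= fn x by rewrite le_max lexx orbT.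
have fE x : f x = fp x - fn x.
  by rewrite /fp /fn; case: (lerP (f x) 0); case: (lerP (- f x) 0); lra.
have Lfp : L1 P fp.
  apply: L1_le Lf => // x; rewrite ger0_norm// /fp.
  by case: (lerP (f x) 0) => // _; exact: ler_norm.
have Lfn : L1 P fn.
  apply: L1_le Lf => // x; rewrite ger0_norm// /fn -normrN.
  by case: (lerP (- f x) 0) => // _; exact: ler_norm.
have Ep : \int[P]_x fp x = \int[mu]_x (fp x * p x).
  by rewrite /Rintegral (ge0_integral_density mp p0 PE mfp fp0).
have En : \int[P]_x fn x = \int[mu]_x (fn x * p x).
  by rewrite /Rintegral (ge0_integral_density mp p0 PE mfn fn0).
rewrite (Rint_eq P fE) RintB// Ep En -RintB; [|exact: L1_density..].
by apply: Rint_eq => x; rewrite fE mulrBl.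
Qed.

(** Multiplication by the root of the density embeds L^2(P) isometrically into L^2(mu), the space in
    which differentiability in quadratic mean is formulated. *)
Lemma L2_density f : L2 P f -> L2 mu (fun x => f x * Num.sqrt (p x)).
Proof.
move=> [mf Lf]; split.
  by apply: measurable_funM => //; exact: measurable_sqrt.
by apply: L1_ext (L1_density Lf) => x; rewrite exprMn sqr_sqrtr.
Qed.

Lemma Rint_density_sqr f : L2 P f ->
  \int[P]_x f x ^+ 2 = \int[mu]_x (f x * Num.sqrt (p x)) ^+ 2.
Proof.
move=> [mf Lf]; rewrite Rint_density//.
by apply: Rint_eq => x; rewrite exprMn sqr_sqrtr.
Qed.

End density.

(* [H D] stands for the integral of (sqrt q - sqrt p)^2 over [D] with respect to
   a dominating measure; everything needed about the densities is recorded here,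
   so that neither they nor the dominating measure are mentioned afterwards. *)
Record hellinger_bounds {R : realType} {d : measure_display}
    {T : measurableType d} (P Q : probability T R) (s : T -> R) (t r : R)
    (H : set T -> R) : Prop := HellingerBounds {
  hell_ge0 : forall D, 0 <= H D;
  hell_cs : forall D X, measurable D -> L2 P X -> L2 Q X ->
    (\int[Q]_x (\1_D x * X x) - \int[P]_x (\1_D x * X x)) ^+ 2 <=
    H D * (2 * (\int[Q]_x (\1_D x * X x ^+ 2) + \int[P]_x (\1_D x * X x ^+ 2)));
  hell_dom : forall D X K, measurable D -> bm X ->
    (forall x, 0 <= X x <= K) ->
    \int[Q]_x (\1_D x * X x) <= 2 * K * H D + 2 * \int[P]_x (\1_D x * X x);
  hell_dom' : forall D X K, measurable D -> bm X ->
    (forall x, 0 <= X x <= K) ->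
    \int[P]_x (\1_D x * X x) <= 2 * K * H D + 2 * \int[Q]_x (\1_D x * X x);
  hell_lin : forall D (X : T -> R) K C, measurable D -> measurable_fun setT X ->
    (forall x, \1_D x * `|X x| <= K) ->
    0 <= C -> \int[P]_x (\1_D x * X x ^+ 2) <= C ^+ 2 ->
    `|\int[Q]_x (\1_D x * X x) - \int[P]_x (\1_D x * X x)
      - t * \int[P]_x (\1_D x * (X x * s x))|
    <= K * H D + 2 * `|t| * r * C;
  hell_small : forall D, measurable D ->
    H D <= t ^+ 2 * (2^-1 * \int[P]_x (\1_D x * s x ^+ 2) + 2 * r ^+ 2) }.

Section hellinger.
Context {R : realType} {d : measure_display} {T : measurableType d}.
Variables (mu : {sigma_finite_measure set T -> \bar R}) (P Q : probability T R).
Variables (p q s : T -> R) (t r : R).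
Hypotheses (mp : measurable_fun setT p) (p0 : forall x, 0 <= p x).
Hypothesis PE : forall B, measurable B -> (P B = \int[mu]_(x in B) (p x)%:E)%E.
Hypotheses (mq : measurable_fun setT q) (q0 : forall x, 0 <= q x).
Hypothesis QE : forall B, measurable B -> (Q B = \int[mu]_(x in B) (q x)%:E)%E.
Hypotheses (Ls : L2 P s) (t0 : t != 0) (r0 : 0 <= r).
Hypothesis rE : (\int[mu]_x (((Num.sqrt (q x) - Num.sqrt (p x)) / t
          - s x * Num.sqrt (p x) / 2) ^+ 2)%:E <= (r ^+ 2)%:E)%E.

Let sp x := Num.sqrt (p x).
Let sq x := Num.sqrt (q x).
Let a x := sq x - sp x.
Let rem x := a x / t - s x * sp x / 2.

(** The indicator stands inside the square so that this is literally a squared L^2 norm, ready for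
    Cauchy-Schwarz. *)
Definition hell_dist D := \int[mu]_x (\1_D x * a x) ^+ 2.
Local Notation H := hell_dist.

Let sp2 x : sp x ^+ 2 = p x. Proof. exact: sqr_sqrtr. Qed.
Let sq2 x : sq x ^+ 2 = q x. Proof. exact: sqr_sqrtr. Qed.

Let Lsp : L2 mu sp.
Proof.
apply: (_ : L2 mu (fun x => sp x)).
rewrite (_ : sp = fun x => 1 * sp x); last by apply/funext => x; rewrite mul1r.
exact: (L2_density mp p0 PE (bm_L2 P (bm_cst 1))).
Qed.

Let Lsq : L2 mu sq.
Proof.
rewrite (_ : sq = fun x => 1 * sq x); last by apply/funext => x; rewrite mul1r.
exact: (L2_density mq q0 QE (bm_L2 Q (bm_cst 1))).
Qed.

Let La : L2 mu a. Proof. exact: L2B. Qed.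

Let Lsps : L2 mu (fun x => s x * sp x).
Proof. exact: (L2_density mp p0 PE). Qed.

Let Lrem : L2 mu rem.
Proof.
have := L2B (L2_bm (bm_cst t^-1) La) (L2_bm (bm_cst 2^-1) Lsps).
by rewrite (_ : (fun x => _ - _) = rem)//; apply/funext => x; rewrite /rem; ring.
Qed.

Let rem2 : \int[mu]_x rem x ^+ 2 <= r ^+ 2.
Proof. by rewrite -lee_fin -EFin_Rint//; case: Lrem. Qed.

Let aE x : a x = t * (s x * sp x / 2 + rem x).
Proof. by rewrite /rem addrC subrK mulrC divfK. Qed.

Let LaD D : measurable D -> L2 mu (fun x => \1_D x * a x).
Proof. by move=> mD; apply: L2_bm => //; exact: bm_indic. Qed.

Let ind2 (D : set T) x : (\1_D x) ^+ 2 = \1_D x :> R.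
Proof. by rewrite indicE; case: (_ \in _); rewrite ?expr1n ?expr0n. Qed.

Let indge0 (D : set T) x : 0 <= \1_D x :> R.
Proof. by rewrite indicE. Qed.

Lemma hellinger_boundsP : hellinger_bounds P Q s t r H.
Proof.
split.
- by move=> D; apply: Rint_ge0 => x; exact: sqr_ge0.
(* The difference of the densities factors as [(sq x - sp x) * (sq x + sp x)]. Cauchy-Schwarz
   separates the factors, and the square of the second is at most twice the sum of the densities. *)
- move=> D X mD LPX LQX.
  have LPDX := L2_bm (bm_indic mD) LPX.
  have LQDX := L2_bm (bm_indic mD) LQX.
  have Lb : L2 mu (fun x => \1_D x * X x * (sq x + sp x)).
    have := L2D (L2_density mq q0 QE LQDX) (L2_density mp p0 PE LPDX).
    by rewrite (_ : (fun x => _ + _) = (fun x => \1_D x * X x * (sq x + sp x)))//;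
      apply/funext => x; rewrite -mulrDr.
  have := cauchy_schwarz (LaD mD) Lb.
  rewrite -/(H D) (_ : \int[mu]_x (_ * _) =
    \int[Q]_x (\1_D x * X x) - \int[P]_x (\1_D x * X x)); last first.
    rewrite (Rint_density mq q0 QE); last exact: L2_L1.
    rewrite (Rint_density mp p0 PE); last exact: L2_L1.
    rewrite -RintB; last 2 first.
    - by apply: (L1_density mq q0 QE); exact: L2_L1.
    - by apply: (L1_density mp p0 PE); exact: L2_L1.
    apply: Rint_eq => x; rewrite -sp2 -sq2 /a -[in RHS](ind2 D x).
    ring.
  move=> /le_trans; apply; apply: ler_wpM2l.
    by apply: Rint_ge0 => x; exact: sqr_ge0.
  have eqm f : \int[f]_x (\1_D x * X x ^+ 2) = \int[f]_x (\1_D x * X x) ^+ 2.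
    by apply: Rint_eq => x; rewrite exprMn ind2.
  have LPDX2 : L1 P (fun x => (\1_D x * X x) ^+ 2) by case: LPDX.
  have LQDX2 : L1 Q (fun x => (\1_D x * X x) ^+ 2) by case: LQDX.
  have L1Q := L1_density mq q0 QE LQDX2.
  have L1P := L1_density mp p0 PE LPDX2.
  rewrite !eqm (Rint_density mq q0 QE)// (Rint_density mp p0 PE)//.
  rewrite -RintD// -RintZ; last exact: L1D.
  apply: Rint_le; [by case: Lb|by apply: L1Z; exact: L1D|].
  move=> x; rewrite exprMn -mulrDr [leRHS]mulrCA ler_wpM2l ?sqr_ge0//.
  rewrite -sp2 -sq2 -subr_ge0.
  by rewrite (_ : _ - _ = (sq x - sp x) ^+ 2) ?sqr_ge0//; ring.
- move=> D X K mD bX X0K.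
  have LQX : L1 Q (fun x => \1_D x * X x).
    by apply: L1_bm; [exact: bm_indic|exact: bm_L1].
  have LPX : L1 P (fun x => \1_D x * X x).
    by apply: L1_bm; [exact: bm_indic|exact: bm_L1].
  have La2 : L1 mu (fun x => (\1_D x * a x) ^+ 2) by case: (LaD mD).
  rewrite (Rint_density mq q0 QE)// (Rint_density mp p0 PE)//.
  have L1Q := L1_density mq q0 QE LQX.
  have L1P := L1_density mp p0 PE LPX.
  rewrite -!RintZ// -RintD//; [|exact: L1Z..].
  apply: Rint_le => //; first by apply: L1D; exact: L1Z.
  move=> x; rewrite exprMn ind2 -sp2 -sq2 /a.
  have /andP[X0 XK] := X0K x; have i0 := indge0 D x.
  rewrite -subr_ge0.
  (* The defect of the pointwise inequality is a sum of squares whose weights are nonnegative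
     because [0 <= X x <= K]. The symmetric bound below exchanges [sp] and [sq]. *)
  rewrite (_ : _ - _ = \1_D x * (2 * (K - X x) * (sq x - sp x) ^+ 2
     + X x * (sq x - 2 * sp x) ^+ 2)); last by ring.
  apply: mulr_ge0 => //; apply: addr_ge0; apply: mulr_ge0 => //;
    rewrite ?sqr_ge0 ?mulr_ge0 ?subr_ge0//.
- move=> D X K mD bX X0K.
  have LQX : L1 Q (fun x => \1_D x * X x).
    by apply: L1_bm; [exact: bm_indic|exact: bm_L1].
  have LPX : L1 P (fun x => \1_D x * X x).
    by apply: L1_bm; [exact: bm_indic|exact: bm_L1].
  have La2 : L1 mu (fun x => (\1_D x * a x) ^+ 2) by case: (LaD mD).
  rewrite (Rint_density mq q0 QE)// (Rint_density mp p0 PE)//.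
  have L1Q := L1_density mq q0 QE LQX.
  have L1P := L1_density mp p0 PE LPX.
  rewrite -!RintZ// -RintD//; [|exact: L1Z..].
  apply: Rint_le => //; first by apply: L1D; exact: L1Z.
  move=> x; rewrite exprMn ind2 -sp2 -sq2 /a.
  have /andP[X0 XK] := X0K x; have i0 := indge0 D x.
  rewrite -subr_ge0.
  rewrite (_ : _ - _ = \1_D x * (2 * (K - X x) * (sq x - sp x) ^+ 2
     + X x * (sp x - 2 * sq x) ^+ 2)); last by ring.
  apply: mulr_ge0 => //; apply: addr_ge0; apply: mulr_ge0 => //;
    rewrite ?sqr_ge0 ?mulr_ge0 ?subr_ge0//.
- move=> D X K C mD mX XK C0 XC.
  have bX : bm (fun x => \1_D x * X x).
    split; first by apply: measurable_funM => //; exact: measurable_indic.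
    by exists K => x; rewrite normrM [`|\1_D x|]ger0_norm ?XK.
  have LQX := bm_L1 Q bX; have LPX := bm_L1 P bX.
  have LPXs : L1 P (fun x => \1_D x * (X x * s x)).
    by apply: L1_ext (L1_bm bX (L2_L1 Ls)) => x; rewrite mulrA.
  rewrite (Rint_density mq q0 QE LQX) (Rint_density mp p0 PE LPX).
  rewrite (Rint_density mp p0 PE LPXs).
  have L1Q := L1_density mq q0 QE LQX.
  have L1P := L1_density mp p0 PE LPX.
  have L1Ps := L1_density mp p0 PE LPXs.
  rewrite -RintB// -RintZ// -RintB//; [|exact: L1B|exact: L1Z].
  have LaD2 : L1 mu (fun x => (\1_D x * a x) ^+ 2) by case: (LaD mD).
  have LDXp : L2 mu (fun x => \1_D x * X x * sp x).
    exact: (L2_density mp p0 PE (bm_L2 P bX)).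
  have La2X : L1 mu (fun x => \1_D x * X x * (\1_D x * a x) ^+ 2).
    exact: L1_bm.
  have Lpr := L2L2 LDXp Lrem.
  (* The densities differ by [a ^+ 2 + 2 * sp * a], and [aE] turns the linear part into the score
     term, which cancels, plus [2 * t * sp * rem]. *)
  rewrite (_ : \int[mu]_x _ = \int[mu]_x (\1_D x * X x * (\1_D x * a x) ^+ 2
     + 2 * t * (\1_D x * X x * sp x * rem x))); last first.
    apply: Rint_eq => x; have sqE : sq x = sp x + a x by rewrite /a; ring.
    have aE' := aE x; have i2 := ind2 D x.
    rewrite -sp2 -sq2 sqE.
    move: (\1_D x) (X x) (s x) (sp x) (a x) (rem x) aE' i2 => i X' s' u a' v aE' i2.
    have -> : i * X' * (i * a') ^+ 2 = i ^+ 2 * i * (X' * a' ^+ 2) by ring.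
    rewrite i2 -expr2 i2.
    have -> : (u + a') ^+ 2 = u ^+ 2 + 2 * (u * a') + a' ^+ 2 by ring.
    have -> : u * a' = u * (t * (s' * u / 2 + v)) by rewrite -aE'.
    by field.
  rewrite RintD//; last exact: L1Z.
  rewrite (RintZ _ Lpr); apply: (le_trans (ler_normD _ _)); apply: lerD.
    apply: (le_trans (Rint_abs _)) => //.
    rewrite -RintZ//; apply: Rint_le => //; [exact: L1_abs|exact: L1Z|].
    move=> x; rewrite normrM [`|_ ^+ 2|]ger0_norm ?sqr_ge0//.
    by rewrite ler_wpM2r ?sqr_ge0// normrM [`|\1_D x|]ger0_norm.
  rewrite !normrM [`|2|]ger0_norm// -!mulrA ler_wpM2l// ler_wpM2l//.
  apply: ler_norm_sqr; first exact: mulr_ge0.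
  apply: le_trans (cauchy_schwarz LDXp Lrem) _.
  rewrite -(Rint_density_sqr mp p0 PE (bm_L2 P bX)) mulrC exprMn.
  apply: ler_pM => //; [by apply: Rint_ge0 => x; exact: sqr_ge0..|].
  apply: le_trans XC; rewrite le_eqVlt; apply/orP; left; apply/eqP.
  by apply: Rint_eq => x; rewrite exprMn ind2.
- move=> D mD.
  have LDs : L2 P (fun x => \1_D x * s x) by apply: L2_bm => //; exact: bm_indic.
  have LDs2 : L1 P (fun x => (\1_D x * s x) ^+ 2) by case: LDs.
  have -> : \int[P]_x (\1_D x * s x ^+ 2) = \int[P]_x ((\1_D x * s x) ^+ 2).
    by apply: Rint_eq => x; rewrite exprMn ind2.
  have LmDs : L1 mu (fun x => (\1_D x * s x * sp x) ^+ 2).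
    by case: (L2_density mp p0 PE LDs).
  have Lr2 : L1 mu (fun x => rem x ^+ 2) by case: Lrem.
  rewrite (Rint_density_sqr mp p0 PE LDs).
  apply: (@le_trans _ _ (t ^+ 2 * (2^-1 * \int[mu]_x (\1_D x * s x * sp x) ^+ 2
     + 2 * \int[mu]_x rem x ^+ 2))); last first.
    by rewrite ler_wpM2l ?sqr_ge0// lerD2l ler_wpM2l.
  rewrite -!RintZ// -RintD//; [|exact: L1Z..].
  rewrite -RintZ; last by apply: L1D; exact: L1Z.
  apply: Rint_le; first by case: (LaD mD).
    by apply: L1Z; apply: L1D; exact: L1Z.
  move=> x; rewrite aE !exprMn !ind2.
  have := indge0 D x; have : (\1_D x : R) <= 1.
    by rewrite indicE; case: (_ \in _).
  set i := \1_D x; set u := s x * sp x; set v := rem x => i1 i0.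
  rewrite mulrCA ler_wpM2l ?sqr_ge0//.
  rewrite -mulrA -exprMn -/u.
  (* The square of [u / 2 + v] is at most twice the sum of the squares of its terms, whence the
     factors one half and two. *)
  apply: (@le_trans _ _ (i * (2^-1 * u ^+ 2 + 2 * v ^+ 2))).
    rewrite ler_wpM2l// -subr_ge0.
    by rewrite (_ : _ - _ = (u / 2 - v) ^+ 2) ?sqr_ge0//; field.
  rewrite mulrDr mulrCA lerD2l.
  by rewrite ler_piMl// mulr_ge0// sqr_ge0.
Qed.

End hellinger.

Section hellinger_pair.
Context {R : realType} {d : measure_display} {T : measurableType d}.
Variables (P Q : probability T R) (s : T -> R) (t r : R) (H : set T -> R).
Hypothesis hell : hellinger_bounds P Q s t r H.
Hypotheses (Ls : L2 P s) (r0 : 0 <= r) (r1 : r <= 1).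

(** The summand 2 absorbs the [2 * r ^+ 2] of [hell_small] when [r <= 1] and makes the constant at
    least 1. *)
Definition hell_cst := \int[P]_x s x ^+ 2 + 2.
Local Notation h := hell_cst.

Lemma hell_cst_ge1 : 1 <= h.
Proof.
have : 0 <= \int[P]_x s x ^+ 2 by apply: Rint_ge0 => x; exact: sqr_ge0.
rewrite /h; lra.
Qed.

Lemma Rint_indic_le (D : set T) (f : T -> R) : measurable D -> L1 P f ->
  (forall x, 0 <= f x) -> \int[P]_x (\1_D x * f x) <= \int[P]_x f x.
Proof.
move=> mD Lf f0; apply: Rint_le => //; first by apply: L1_bm => //; exact: bm_indic.
by move=> x; rewrite ler_piMl// indicE; case: (_ \in _).
Qed.

Lemma hell_le D : measurable D -> H D <= h * t ^+ 2.
Proof.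
move=> mD; apply: le_trans (hell_small hell mD) _; rewrite mulrC ler_wpM2r ?sqr_ge0//.
have r2 : r ^+ 2 <= 1 by rewrite expr_le1.
have [_ Ls2] := Ls.
have : \int[P]_x (\1_D x * s x ^+ 2) <= \int[P]_x s x ^+ 2.
  by apply: Rint_indic_le => // x; exact: sqr_ge0.
have : 0 <= \int[P]_x s x ^+ 2 by apply: Rint_ge0 => x; exact: sqr_ge0.
rewrite /h; lra.
Qed.

(** On events that carry little of [s ^+ 2], the O(t^2) of [hell_le] improves to a small multiple of
    t^2. The factor 4 covers 1/2 + 2. *)
Lemma hell_le_small D e : measurable D -> 0 <= e -> r <= e ->
  \int[P]_x (\1_D x * s x ^+ 2) <= e ^+ 2 -> H D <= (2 * e * t) ^+ 2.
Proof.
move=> mD e0 re De; apply: le_trans (hell_small hell mD) _.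
rewrite exprMn mulrC ler_wpM2r ?sqr_ge0//.
have r2 : r ^+ 2 <= e ^+ 2 by rewrite lerXn2r.
have e2 := sqr_ge0 e.
rewrite exprMn; lra.
Qed.

(** The laws are within O(t) in total variation. Cauchy-Schwarz produces the root of [h], which is
    replaced by [h] itself because [h] is at least 1. *)
Lemma hell_tv (X : T -> R) c : measurable_fun setT X -> 0 <= c ->
  (forall x, `|X x| <= c) ->
  `|\int[Q]_x X x - \int[P]_x X x| <= 2 * h * c * `|t|.
Proof.
move=> mX c0 Xc; have bX : bm X by split => //; exists c.
have h1 := hell_cst_ge1.
apply: ler_norm_sqr; first by rewrite !mulr_ge0//; lra.
have := hell_cs hell measurableT (bm_L2 P bX) (bm_L2 Q bX).
have e1 (f : T -> R) x : \1_[set: T] x * f x = f x.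
  by rewrite indicE in_setT mul1r.
have e2 (f : T -> R) (P' : probability T R) :
    \int[P']_x (\1_[set: T] x * f x) = \int[P']_x f x by exact: Rint_eq.
rewrite !e2 => /le_trans; apply.
have le2 (P' : probability T R) : \int[P']_x X x ^+ 2 <= c ^+ 2.
  rewrite -[leRHS](Rint_cst P'); apply: Rint_le; [|exact: L1_cst|].
    by apply: bm_L1; exact: (bmM bX bX).
  by move=> x; rewrite -[X x ^+ 2]real_normK ?num_real// lerXn2r ?nnegrE.
have ge2 (P' : probability T R) : 0 <= \int[P']_x X x ^+ 2.
  by apply: Rint_ge0 => x; exact: sqr_ge0.
apply: (@le_trans _ _ (h * t ^+ 2 * (2 * (c ^+ 2 + c ^+ 2)))).
  apply: ler_pM; [exact: (hell_ge0 hell)| |exact: hell_le|].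
    by rewrite mulr_ge0// addr_ge0.
  by rewrite ler_wpM2l// lerD.
have -> : (2 * h * c * `|t|) ^+ 2 = h * (h * t ^+ 2 * (2 * (c ^+ 2 + c ^+ 2))).
  by rewrite exprMn real_normK ?num_real//; ring.
have h0 : 0 <= h by lra.
rewrite ler_peMl//; apply: mulr_ge0; first by apply: mulr_ge0 => //; exact: sqr_ge0.
by apply: mulr_ge0 => //; apply: addr_ge0; exact: sqr_ge0.
Qed.

(* Split at |Phi| = C / w: below, the linearization is exact up to a bounded
   multiple of [H]; above, an event of probability at most w^2 carries little of
   s^2, hence little of [H], and Cauchy-Schwarz needs only second moments. *)
Lemma hell_linearization (Phi : T -> R) C e w : L2 P Phi -> L2 Q Phi -> 1 <= C ->
  \int[P]_x Phi x ^+ 2 <= C ^+ 2 -> \int[Q]_x Phi x ^+ 2 <= C ^+ 2 ->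
  0 < e <= 1 -> 0 < w <= 1 -> r <= e -> `|t| <= e ^+ 2 * w ^+ 2 ->
  (forall D, measurable D -> \int[P]_x \1_D x <= w ^+ 2 ->
     \int[P]_x (\1_D x * s x ^+ 2) <= e ^+ 2) ->
  `|\int[Q]_x Phi x - \int[P]_x Phi x - t * \int[P]_x (Phi x * s x)|
    <= C * (h + 7) * e * `|t|.
Proof.
move=> LP LQ C1 PC QC /andP[e0 e1] /andP[w0 w1] re te UI.
have h1 := hell_cst_ge1.
have mPhi := L2_meas LP.
have C0 : 0 < C by lra.
(* By Chebyshev, |Phi| exceeds this level with [P]-probability at most [w ^+ 2]. *)
pose K := C / w.
have K0 : 0 < K by exact: divr_gt0.
pose D := [set x | `|Phi x| <= K]; pose D' := [set x | K < `|Phi x|].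
have mn : measurable_fun setT (fun x => `|Phi x|) by exact: measurableT_comp.
have mD : measurable D.
  by have := mn measurableT `]-oo, K]%classic (measurable_itv _); rewrite setTI.
have mD' : measurable D'.
  have := mn measurableT `]K, +oo[%classic (measurable_itv _); rewrite setTI.
  by rewrite (_ : _ @^-1` _ = D')//; apply/seteqP; split => y; rewrite /D' /= in_itv/= andbT.
have DD' x : \1_D x + \1_D' x = 1 :> R.
  rewrite !indicE; case: (leP `|Phi x| K) => hx.
    rewrite mem_set// memNset ?addr0//; rewrite /D' /= => hx'; lra.
  rewrite memNset ?add0r ?mem_set//; rewrite /D /= => hx'; lra.
have split_ (P' : probability T R) f : L1 P' f ->
    \int[P']_x f x = \int[P']_x (\1_D x * f x) + \int[P']_x (\1_D' x * f x).
  move=> Lf; rewrite -RintD.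
  - by apply: Rint_eq => x; rewrite -mulrDl DD' mul1r.
  - by apply: L1_bm => //; exact: bm_indic.
  - by apply: L1_bm => //; exact: bm_indic.
have LP1 := L2_L1 LP; have LQ1 := L2_L1 LQ; have LPs := L2L2 LP Ls.
have [_ LP2] := LP; have [_ LQ2] := LQ; have [_ Ls2] := Ls.
rewrite (split_ P _ LP1) (split_ Q _ LQ1) (split_ P _ LPs).
have lin : `|\int[Q]_x (\1_D x * Phi x) - \int[P]_x (\1_D x * Phi x)
      - t * \int[P]_x (\1_D x * (Phi x * s x))| <= K * H D + 2 * `|t| * r * C.
  apply: (hell_lin hell) => //; last 2 first.
  - exact: ltW.
  - by apply: le_trans PC; apply: Rint_indic_le => // x; exact: sqr_ge0.
  move=> x; rewrite indicE; case: (boolP (x \in D)) => [/set_mem|_].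
    by rewrite mul1r.
  by rewrite mul0r ltW.
have PD' : \int[P]_x \1_D' x <= w ^+ 2.
  apply: (@le_trans _ _ (\int[P]_x ((w / C) ^+ 2 * Phi x ^+ 2))).
    apply: Rint_le; [|exact: L1Z|].
      by apply: bm_L1; exact: bm_indic.
    move=> x; rewrite indicE; case: (boolP (x \in D')) => [/set_mem|_]; last first.
      by rewrite -exprMn sqr_ge0.
    rewrite /D' /= -exprMn -[leRHS]real_normK ?num_real// normrM => hx.
    rewrite -[leLHS](expr1n _ 2) lerXn2r ?nnegrE//.
    rewrite [`|w / C|]gtr0_norm ?divr_gt0//.
    rewrite -ler_pdivrMl ?divr_gt0// mulr1 invf_div; exact: ltW.
  rewrite RintZ// exprMn -mulrA ler_piMr ?sqr_ge0//.
  by rewrite exprVn mulrC ler_pdivrMr ?exprn_gt0// mul1r.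
have sD' := UI _ mD' PD'.
have HD' := hell_le_small mD' (ltW e0) re sD'.
have cs : `|\int[Q]_x (\1_D' x * Phi x) - \int[P]_x (\1_D' x * Phi x)|
    <= 4 * C * e * `|t|.
  apply: ler_norm_sqr; first by rewrite !mulr_ge0// ltW.
  apply: le_trans (hell_cs hell mD' LP LQ) _.
  apply: (@le_trans _ _ ((2 * e * t) ^+ 2 * (2 * (C ^+ 2 + C ^+ 2)))).
    have ge2 (P' : probability T R) : 0 <= \int[P']_x (\1_D' x * Phi x ^+ 2).
      by apply: Rint_ge0 => x; rewrite mulr_ge0 ?sqr_ge0// indicE.
    apply: ler_pM => //; [exact: (hell_ge0 hell)|by rewrite mulr_ge0 ?addr_ge0|].
    rewrite ler_wpM2l// lerD//.
      apply: le_trans QC; apply: Rint_le => //.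
        by apply: L1_bm => //; exact: bm_indic.
      by move=> x; rewrite ler_piMl ?sqr_ge0// indicE; case: (_ \in _).
    by apply: le_trans PC; apply: Rint_indic_le => // x; exact: sqr_ge0.
  rewrite [leRHS]exprMn real_normK ?num_real//.
  by rewrite le_eqVlt; apply/orP; left; apply/eqP; ring.
have lins : `|\int[P]_x (\1_D' x * (Phi x * s x))| <= C * e.
  apply: ler_norm_sqr; first by rewrite mulr_ge0// ltW.
  have LDs : L2 P (fun x => \1_D' x * s x) by apply: L2_bm => //; exact: bm_indic.
  have -> : \int[P]_x (\1_D' x * (Phi x * s x)) = \int[P]_x (Phi x * (\1_D' x * s x)).
    by apply: Rint_eq => x; rewrite mulrCA.
  apply: le_trans (cauchy_schwarz LP LDs) _.
  rewrite exprMn; apply: ler_pM => //; [by apply: Rint_ge0 => x; exact: sqr_ge0..|].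
  apply: le_trans sD'; rewrite le_eqVlt; apply/orP; left; apply/eqP.
  apply: Rint_eq => x; rewrite exprMn; congr (_ * _).
  by rewrite indicE; case: (_ \in _); rewrite ?expr1n ?expr0n.
have KH : K * H D <= C * h * e * `|t|.
  apply: (@le_trans _ _ (K * (h * t ^+ 2))).
    by rewrite ler_wpM2l ?(ltW K0)//; exact: hell_le.
  rewrite -[t ^+ 2]real_normK ?num_real//.
  (* The level grows like [1 / w]; the restriction on [t] absorbs this growth, so that [K * t ^+ 2]
     is still a small multiple of |t|. *)
  have Kt : K * `|t| <= C * e.
    apply: (@le_trans _ _ (K * (e ^+ 2 * w ^+ 2))); first by rewrite ler_wpM2l// ltW.
    rewrite (_ : K * _ = C * e * (e * w)); last first.
      by rewrite /K; field; rewrite gt_eqF.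
    rewrite ler_piMr ?mulr_ge0 ?(ltW C0) ?(ltW e0)//.
    by rewrite mulr_ile1 ?(ltW e0) ?(ltW w0).
  rewrite (_ : K * _ = h * `|t| * (K * `|t|)); last by ring.
  rewrite (_ : C * h * e * `|t| = h * `|t| * (C * e)); last by ring.
  by rewrite ler_wpM2l// mulr_ge0//; lra.
set A := \int[Q]_x (\1_D x * _); set B := \int[Q]_x (\1_D' x * _).
set A' := \int[P]_x (\1_D x * Phi x); set B' := \int[P]_x (\1_D' x * Phi x).
set A'' := \int[P]_x (\1_D x * (_ * _)); set B'' := \int[P]_x (\1_D' x * (_ * _)).
rewrite (_ : _ - _ = (A - A' - t * A'') + (B - B') - t * B''); last by ring.
apply: (le_trans (ler_normB _ _)).
have tr : 2 * `|t| * r * C <= C * 2 * e * `|t|.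
  rewrite (_ : 2 * _ * _ * _ = 2 * `|t| * C * r); last by ring.
  rewrite (_ : C * 2 * _ * _ = 2 * `|t| * C * e); last by ring.
  by rewrite ler_wpM2l// !mulr_ge0// ltW.
have ts : `|t * B''| <= C * e * `|t|.
  by rewrite normrM mulrC ler_wpM2r.
have := ler_normD (A - A' - t * A'') (B - B').
(* 7 = 2 + 4 + 1: the quadratic mean remainder on [D], Cauchy-Schwarz on [D'], and the score term on
   [D']. *)
rewrite (_ : C * (h + 7) * e * `|t| = C * h * e * `|t| + C * 2 * e * `|t| +
  4 * C * e * `|t| + C * e * `|t|); last by ring.
lra.
Qed.

End hellinger_pair.

(** * Conditional moments of a law *)

(** These bounds hold almost surely, but only under the law to which the functions belong. As an
    explicit set of values of [V] they can be imposed under another law as well. The last bound is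
    the product of [2 * M] for each centred variable. *)
Definition good_set {R : realType} {T' : Type} (M eps : R)
    (rho delta kappa : T' -> R) : set T' :=
  [set l | [/\ `|rho l| <= M, `|delta l| <= M,
    eps <= `|kappa l| & `|kappa l| <= 4 * M ^+ 2]].

(* [mo_resid] is the weak form of
   Cov(Y - e - c (X - a), W | V) = (gamma - c) kappa; as [e], [c] and [a] are
   arbitrary, it applies under one law with the nuisance functions of another. *)
Record moments {R : realType} {d d' : measure_display}
    {T : measurableType d} {T' : measurableType d'} (V : T -> T')
    (W X Y : T -> R) (M eps : R) (P : probability T R)
    (rho delta eta kappa gamma : T' -> R) : Prop := Moments {
  mo_rho : measurable_fun setT rho;
  mo_delta : measurable_fun setT delta;
  mo_eta : measurable_fun setT eta;
  mo_kappa : measurable_fun setT kappa;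
  mo_gamma : measurable_fun setT gamma;
  mo_good : measurable (good_set M eps rho delta kappa);
  mo_good_ae : {ae P, forall x, good_set M eps rho delta kappa (V x)};
  mo_L2eta : L2 P (eta \o V);
  mo_L2gamma : L2 P (gamma \o V);
  mo_gamma_le : \int[P]_x gamma (V x) ^+ 2 <=
    16 * M ^+ 2 / eps ^+ 2 * \int[P]_x Y x ^+ 2;
  mo_orth : forall g, measurable_fun setT g -> L2 P (g \o V) ->
    \int[P]_x (g (V x) * (W x - rho (V x))) = 0;
  mo_kappaE : forall g, bm g ->
    \int[P]_x (g (V x) * X x * (W x - rho (V x))) =
    \int[P]_x (g (V x) * kappa (V x));
  mo_resid : forall g e c a, bm g ->
    measurable_fun setT e -> measurable_fun setT c -> measurable_fun setT a ->
    L2 P (fun x => g (V x) * e (V x)) -> L2 P (fun x => g (V x) * c (V x)) ->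
    L2 P (fun x => g (V x) * c (V x) * a (V x)) ->
    \int[P]_x (g (V x) * (Y x - e (V x) - c (V x) * (X x - a (V x)))
      * (W x - rho (V x))) =
    \int[P]_x (g (V x) * ((gamma (V x) - c (V x)) * kappa (V x)));
  mo_resid0 : forall g, bm g ->
    \int[P]_x (g (V x) *
      (Y x - eta (V x) - gamma (V x) * (X x - delta (V x)))) = 0 }.

Section conditional_moments.
Context {R : realType} {d d' : measure_display}
  {T : measurableType d} {T' : measurableType d'}.
Variables (V : {mfun T >-> T'}) (W X Y : T -> R) (M : R).
Hypotheses (mW : measurable_fun setT W) (WM : forall x, `|W x| <= M).
Hypotheses (mX : measurable_fun setT X) (XM : forall x, `|X x| <= M).
Variable P : probability T R.
Hypothesis LY : L2 P Y.

Variables rho delta eta kappa nu : T' -> R.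
Hypotheses (cW : is_cond_exp P V W rho) (cX : is_cond_exp P V X delta).
Hypothesis cY : is_cond_exp P V Y eta.
Hypothesis cK : is_cond_exp P V
  (fun x => (X x - delta (V x)) * (W x - rho (V x))) kappa.
Hypothesis cN : is_cond_exp P V
  (fun x => (Y x - eta (V x)) * (W x - rho (V x))) nu.
Local Notation gamma := (fun l => nu l / kappa l).

Let bW : bm W. Proof. by split => //; exists M. Qed.
Let bX : bm X. Proof. by split => //; exists M. Qed.
Let LW : L2 P W. Proof. exact: bm_L2. Qed.
Let LX : L2 P X. Proof. exact: bm_L2. Qed.


Lemma measurable_rho : measurable_fun setT rho. Proof. by case: cW. Qed.
Lemma measurable_delta : measurable_fun setT delta. Proof. by case: cX. Qed.
Lemma measurable_eta : measurable_fun setT eta. Proof. by case: cY. Qed.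

Lemma L2_rho : L2 P (rho \o V). Proof. by case: (cond_exp_L2 cW LW). Qed.
Lemma L2_delta : L2 P (delta \o V). Proof. by case: (cond_exp_L2 cX LX). Qed.
Lemma L2_eta : L2 P (eta \o V). Proof. by case: (cond_exp_L2 cY LY). Qed.

Lemma eta_sqr_le : \int[P]_x eta (V x) ^+ 2 <= \int[P]_x Y x ^+ 2.
Proof. by case: (cond_exp_L2 cY LY). Qed.

Lemma rho_le : {ae P, forall x, `|rho (V x)| <= M}.
Proof. by apply: (cond_exp_abs_le cW); [exact: L2_L1|exact: aeW]. Qed.

Lemma delta_le : {ae P, forall x, `|delta (V x)| <= M}.
Proof. by apply: (cond_exp_abs_le cX); [exact: L2_L1|exact: aeW]. Qed.

Let Wr x := W x - rho (V x).
Let Xd x := X x - delta (V x).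
Let Ye x := Y x - eta (V x).

Let LWr : L2 P Wr. Proof. by apply: L2B => //; exact: L2_rho. Qed.
Let LXd : L2 P Xd. Proof. by apply: L2B => //; exact: L2_delta. Qed.
Let LYe : L2 P Ye. Proof. by apply: L2B => //; exact: L2_eta. Qed.

Let Wr_le : {ae P, forall x, `|Wr x| <= 2 * M}.
Proof.
apply: filterS rho_le => x h; apply: (le_trans (ler_normB _ _)).
by have := WM x; lra.
Qed.

Let Xd_le : {ae P, forall x, `|Xd x| <= 2 * M}.
Proof.
apply: filterS delta_le => x h; apply: (le_trans (ler_normB _ _)).
by have := XM x; lra.
Qed.

Lemma measurable_kappa : measurable_fun setT kappa. Proof. by case: cK. Qed.
Lemma measurable_nu : measurable_fun setT nu. Proof. by case: cN. Qed.
Lemma measurable_gamma : measurable_fun setT gamma.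
Proof.
by apply: measurable_funM; [exact: measurable_nu|exact/measurable_inv/measurable_kappa].
Qed.

Let mul_Wr Z : L2 P Z ->
  L2 P (fun x => Z x * Wr x) /\
  \int[P]_x (Z x * Wr x) ^+ 2 <= (2 * M) ^+ 2 * \int[P]_x Z x ^+ 2.
Proof.
move=> LZ; have mZ := L2_meas LZ; have [_ LZ2] := LZ.
have LZW : L2 P (fun x => Z x * Wr x).
  apply: (@L2_ae_le _ _ _ P _ (fun x => (2 * M) * Z x)).
  - by apply: measurable_funM => //; exact: L2_meas LWr.
  - apply: filterS Wr_le => x h; rewrite !normrM mulrC ler_wpM2r//.
    by rewrite -normrM (le_trans h)// ler_norm.
  - by apply: L2_bm => //; exact: bm_cst.
split=> //; rewrite -RintZ//; apply: Rint_ae_le; [by case: LZW|exact: L1Z|].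
apply: filterS Wr_le => x h; rewrite exprMn mulrC ler_wpM2r ?sqr_ge0//.
by rewrite -[leLHS]real_normK ?num_real// lerXn2r ?nnegrE// (le_trans _ h).
Qed.

Lemma L2_kappa : L2 P (kappa \o V).
Proof. by case: (cond_exp_L2 cK) => //; case: (mul_Wr LXd). Qed.

Lemma kappa_le : {ae P, forall x, `|kappa (V x)| <= 4 * M ^+ 2}.
Proof.
apply: (cond_exp_abs_le cK); first exact: L2L2.
apply: filterS2 Wr_le Xd_le => x h1 h2; rewrite normrM.
rewrite (_ : 4 * M ^+ 2 = 2 * M * (2 * M)); last by ring.
exact: ler_pM.
Qed.

Lemma L2_nu : L2 P (nu \o V).
Proof. by case: (cond_exp_L2 cN) => //; case: (mul_Wr LYe). Qed.

Lemma nu_sqr_le :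
  \int[P]_x nu (V x) ^+ 2 <= 16 * M ^+ 2 * \int[P]_x Y x ^+ 2.
Proof.
have [LYW YW] := mul_Wr LYe.
have [_ h] := cond_exp_L2 cN LYW.
apply: (le_trans h); apply: (le_trans YW).
(* 16 = 4 * 4: the centred weight is at most [2 * M], and centring multiplies the second moment of
   [Y] by at most 4, a crude but sufficient factor. *)
rewrite (_ : 16 * M ^+ 2 * _ = (2 * M) ^+ 2 * (4 * \int[P]_x Y x ^+ 2)); last by ring.
rewrite ler_wpM2l ?sqr_ge0//.
have [_ LY2] := LY; have [_ Le2] := L2_eta; have [_ LYe2] := LYe.
apply: (@le_trans _ _ (\int[P]_x (2 * Y x ^+ 2 + 2 * eta (V x) ^+ 2))).
  apply: Rint_le => //; first by apply: L1D; exact: L1Z.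
  move=> x; rewrite /Ye -subr_ge0.
  by rewrite (_ : _ - _ = (Y x + eta (V x)) ^+ 2) ?sqr_ge0//; ring.
rewrite RintD; [|exact: L1Z..].
rewrite !RintZ//; have := eta_sqr_le; lra.
Qed.

Section relevance.
Variable eps : R.
Hypothesis eps0 : 0 < eps.
Hypothesis rel : {ae P, forall x, eps <= `|kappa (V x)|}.

Lemma gamma_le : {ae P, forall x, `|gamma (V x)| <= `|eps^-1 * nu (V x)|}.
Proof.
apply: filterS rel => x; move: (nu (V x)) (kappa (V x)) => n k h.
rewrite !normrM mulrC ler_wpM2r//.
rewrite !normfV [`|eps|]gtr0_norm// lef_pV2// posrE//.
exact: lt_le_trans h.
Qed.

Lemma L2_gamma : L2 P (gamma \o V).
Proof.
apply: (L2_ae_le _ gamma_le); last by apply: (L2_bm (bm_cst _)); exact: L2_nu.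
exact: (measurableT_comp measurable_gamma (measurable_funPT V)).
Qed.

Lemma gamma_sqr_le :
  \int[P]_x gamma (V x) ^+ 2 <= 16 * M ^+ 2 / eps ^+ 2 * \int[P]_x Y x ^+ 2.
Proof.
have [_ Lg2] := L2_gamma; have [_ Ln2] := L2_nu.
apply: (@le_trans _ _ (\int[P]_x (eps ^- 2 * nu (V x) ^+ 2))).
  apply: Rint_ae_le => //; first exact: L1Z.
  apply: filterS gamma_le => x h.
  rewrite -exprVn -exprMn -[leLHS]real_normK ?num_real//.
  by rewrite -[leRHS]real_normK ?num_real// lerXn2r.
rewrite RintZ// [leRHS](_ : _ = eps ^- 2 * (16 * M ^+ 2 * \int[P]_x Y x ^+ 2)).
  by rewrite ler_wpM2l ?nu_sqr_le// invr_ge0 sqr_ge0.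
by ring.
Qed.

Local Notation good := (good_set M eps rho delta kappa).

Lemma measurable_good : measurable good.
Proof.
have le1 (f g : T' -> R) : measurable_fun setT f -> measurable_fun setT g ->
    measurable [set l | f l <= g l].
  move=> mf mg; have := measurable_fun_ler mf mg.
  move=> /(_ measurableT [set true] I); rewrite setTI.
  by rewrite (_ : _ @^-1` _ = [set l | f l <= g l])//.
have mn (f : T' -> R) : measurable_fun setT f -> measurable_fun setT (fun l => `|f l|).
  by move=> mf; exact: measurableT_comp.
have -> : good = [set l | `|rho l| <= M] `&` [set l | `|delta l| <= M] `&`
    [set l | eps <= `|kappa l|] `&` [set l | `|kappa l| <= 4 * M ^+ 2].
  by apply/seteqP; split => l /= => [[]|[[[]]]].
apply: measurableI; last first.
  by apply: le1 => //; apply: mn; exact: measurable_kappa.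
apply: measurableI; last first.
  by apply: le1 => //; apply: mn; exact: measurable_kappa.
apply: measurableI.
  by apply: le1 => //; apply: mn; exact: measurable_rho.
by apply: le1 => //; apply: mn; exact: measurable_delta.
Qed.

Lemma good_ae : {ae P, forall x, good (V x)}.
Proof.
have h12 : {ae P, forall x, `|rho (V x)| <= M /\ `|delta (V x)| <= M}.
  by apply: filterS2 rho_le delta_le => x.
have h34 : {ae P, forall x, eps <= `|kappa (V x)| /\ `|kappa (V x)| <= 4 * M ^+ 2}.
  by apply: filterS2 rel kappa_le => x.
by apply: filterS2 h12 h34 => x [h1 h2] [h3 h4]; split.
Qed.

Let LgV g : bm g -> L2 P (g \o V).
Proof. by move=> bg; apply: bm_L2; exact: bmV. Qed.

Lemma orth_W g : measurable_fun setT g -> L2 P (g \o V) ->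
  \int[P]_x (g (V x) * (W x - rho (V x))) = 0.
Proof.
move=> mg Lg; have L1W := L2L2 Lg LW; have L1r := L2L2 Lg L2_rho.
have := cond_exp_pull cW (L2_L1 LW) mg L1W L1r.
under [in X in _ -> X]Rint_eq do rewrite mulrBr.
by rewrite RintB// => ->; rewrite subrr.
Qed.

Lemma orth_X g : measurable_fun setT g -> L2 P (g \o V) ->
  \int[P]_x (g (V x) * (X x - delta (V x))) = 0.
Proof.
move=> mg Lg; have L1X := L2L2 Lg LX; have L1d := L2L2 Lg L2_delta.
have := cond_exp_pull cX (L2_L1 LX) mg L1X L1d.
under [in X in _ -> X]Rint_eq do rewrite mulrBr.
by rewrite RintB// => ->; rewrite subrr.
Qed.

Lemma orth_Y g : measurable_fun setT g -> L2 P (g \o V) ->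
  \int[P]_x (g (V x) * (Y x - eta (V x))) = 0.
Proof.
move=> mg Lg; have L1Y := L2L2 Lg LY; have L1e := L2L2 Lg L2_eta.
have := cond_exp_pull cY (L2_L1 LY) mg L1Y L1e.
under [in X in _ -> X]Rint_eq do rewrite mulrBr.
by rewrite RintB// => ->; rewrite subrr.
Qed.

Lemma L2_mul_delta g : measurable_fun setT g -> L2 P (g \o V) ->
  L2 P (fun x => g (V x) * delta (V x)).
Proof.
move=> mg Lg; apply: (@L2_ae_le _ _ _ P _ (fun x => M * g (V x))).
- apply: measurable_funM; first exact: L2_meas Lg.
  exact: L2_meas L2_delta.
- apply: filterS delta_le => x; move: (g (V x)) (delta (V x)) => a b h.
  by rewrite !normrM mulrC ler_wpM2r// (le_trans h)// ler_norm.
- by apply: L2_bm => //; exact: bm_cst.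
Qed.

(** [kappa] is defined with both variables centred, but [g * delta] is a function of [V] and hence
    orthogonal to the centred [W]. As [X] is bounded, square integrability of [g] suffices; this
    admits products [g * c] with an unbounded ratio [c]. *)
Lemma cond_cov_X g : measurable_fun setT g -> L2 P (g \o V) ->
  \int[P]_x (g (V x) * X x * (W x - rho (V x))) =
  \int[P]_x (g (V x) * kappa (V x)).
Proof.
move=> mg Lg.
have [LXW _] := mul_Wr LXd.
have L1K := L2L2 Lg LXW.
rewrite -(cond_exp_pull cK (L2_L1 LXW) mg L1K (L2L2 Lg L2_kappa)).
have Lgd := L2_mul_delta mg Lg.
have mgd : measurable_fun setT (fun l => g l * delta l).
  by apply: measurable_funM => //; exact: measurable_delta.
have LgX : L1 P (fun x => g (V x) * X x * Wr x).
  apply: L2L2 LWr; rewrite (_ : (fun x => _) = (fun x => X x * g (V x))).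
    exact: L2_bm.
  by apply/funext => x; rewrite mulrC.
have := orth_W mgd Lgd => orth.
transitivity (\int[P]_x (g (V x) * X x * Wr x - g (V x) * delta (V x) * Wr x)).
  by rewrite RintB ?[X in _ - X]orth ?subr0//; exact: L2L2 LWr.
by apply: Rint_eq => x; rewrite /Wr; ring.
Qed.

Lemma cond_cov_Y g : bm g ->
  \int[P]_x (g (V x) * Y x * (W x - rho (V x))) =
  \int[P]_x (g (V x) * nu (V x)).
Proof.
move=> bg; have mg := bm_meas bg; have Lg := LgV bg.
have [LYW _] := mul_Wr LYe.
have L1K := L2L2 Lg LYW.
rewrite -(cond_exp_pull cN (L2_L1 LYW) mg L1K (L2L2 Lg L2_nu)).
have Lgd : L2 P (fun x => g (V x) * eta (V x)).
  by apply: (L2_bm (bmV _ bg)); exact: L2_eta.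
have mgd : measurable_fun setT (fun l => g l * eta l).
  by apply: measurable_funM => //; exact: measurable_eta.
have LgX : L1 P (fun x => g (V x) * Y x * Wr x).
  by apply: L2L2 LWr; apply: (L2_bm (bmV _ bg)).
have := orth_W mgd Lgd => orth.
transitivity (\int[P]_x (g (V x) * Y x * Wr x - g (V x) * eta (V x) * Wr x)).
  by rewrite RintB ?[X in _ - X]orth ?subr0//; exact: L2L2 LWr.
by apply: Rint_eq => x; rewrite /Wr; ring.
Qed.

Let kappa_neq0 : {ae P, forall x, kappa (V x) != 0}.
Proof.
by apply: filterS rel => x h; rewrite -normr_gt0 (lt_le_trans eps0 h).
Qed.

(** The terms in [e] and in [c * a] are functions of [V] and are removed by [orth_W]. What remains
    is [nu - c * kappa], which factors because [kappa] is nonzero almost surely. *)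
Lemma cond_cov_residual g e c a : bm g ->
  measurable_fun setT e -> measurable_fun setT c -> measurable_fun setT a ->
  L2 P (fun x => g (V x) * e (V x)) -> L2 P (fun x => g (V x) * c (V x)) ->
  L2 P (fun x => g (V x) * c (V x) * a (V x)) ->
  \int[P]_x (g (V x) * (Y x - e (V x) - c (V x) * (X x - a (V x)))
    * (W x - rho (V x))) =
  \int[P]_x (g (V x) * ((gamma (V x) - c (V x)) * kappa (V x))).
Proof.
move=> bg me mc ma Lge Lgc Lgca; have mg := bm_meas bg.
have mge : measurable_fun setT (fun l => g l * e l) by exact: measurable_funM.
have mgc : measurable_fun setT (fun l => g l * c l) by exact: measurable_funM.
have mgca : measurable_fun setT (fun l => g l * c l * a l) by exact: measurable_funM.
have oe := orth_W mge Lge.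
have oa := orth_W mgca Lgca.
have cy := cond_cov_Y bg; have cx := cond_cov_X mgc Lgc.
have L1y : L1 P (fun x => g (V x) * Y x * Wr x).
  by apply: L2L2 LWr; apply: (L2_bm (bmV _ bg)).
have L1x : L1 P (fun x => g (V x) * c (V x) * X x * Wr x).
  apply: L2L2 LWr.
  rewrite (_ : (fun x => _) = (fun x => X x * (g (V x) * c (V x)))).
    exact: L2_bm.
  by apply/funext => x; rewrite mulrC.
have L1e := L2L2 Lge LWr.
have L1a := L2L2 Lgca LWr.
transitivity (\int[P]_x ((g (V x) * Y x * Wr x - g (V x) * e (V x) * Wr x)
   - (g (V x) * c (V x) * X x * Wr x - g (V x) * c (V x) * a (V x) * Wr x))).
  by apply: Rint_eq => x; rewrite /Wr; ring.
rewrite RintB; [|exact: L1B|exact: L1B].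
rewrite !RintB// [X in _ - X - _]oe [X in _ - (_ - X)]oa cy cx !subr0.
rewrite -RintB; last 2 first.
- exact: (L2L2 (LgV bg) L2_nu).
- exact: (L2L2 Lgc L2_kappa).
have mVk := measurableT_comp measurable_kappa (measurable_funPT V).
have mVn := measurableT_comp measurable_nu (measurable_funPT V).
have mVgm := measurableT_comp measurable_gamma (measurable_funPT V).
have mVc := measurableT_comp mc (measurable_funPT V).
have mVg := measurableT_comp mg (measurable_funPT V).
apply: Rint_ae_eq.
- apply: measurable_funB; first exact: measurable_funM mVn.
  by apply: measurable_funM => //; exact: measurable_funM mVc.
- apply: measurable_funM => //; apply: measurable_funM mVk.
  exact: measurable_funB mVgm mVc.
apply: filterS kappa_neq0 => x; rewrite /=.
move: (kappa (V x)) (nu (V x)) (g (V x)) (c (V x)) => k n g' c' k0.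
by rewrite mulrBl divfK//; ring.
Qed.

Lemma residual_orth g : bm g ->
  \int[P]_x (g (V x) * (Y x - eta (V x) - gamma (V x) * (X x - delta (V x)))) = 0.
Proof.
move=> bg.
have Lgc : L2 P (fun x => g (V x) * gamma (V x)).
  exact: (L2_bm (bmV _ bg) L2_gamma).
have mgc : measurable_fun setT (fun l => g l * gamma l).
  by apply: measurable_funM; [exact: bm_meas bg|exact: measurable_gamma].
have oy := orth_Y (bm_meas bg) (LgV bg).
have ox := orth_X mgc Lgc.
transitivity (\int[P]_x (g (V x) * Ye x - g (V x) * gamma (V x) * Xd x)).
  by apply: Rint_eq => x; rewrite /Ye /Xd; ring.
rewrite RintB; last 2 first.
- exact: (L2L2 (LgV bg) LYe).
- exact: (L2L2 Lgc LXd).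
by rewrite [X in X - _]oy [X in _ - X]ox subr0.
Qed.

Lemma momentsP : moments V W X Y M eps P rho delta eta kappa gamma.
Proof.
split.
- exact: measurable_rho.
- exact: measurable_delta.
- exact: measurable_eta.
- exact: measurable_kappa.
- exact: measurable_gamma.
- exact: measurable_good.
- exact: good_ae.
- exact: L2_eta.
- exact: L2_gamma.
- exact: gamma_sqr_le.
- exact: orth_W.
- by move=> g bg; apply: cond_cov_X; [exact: bm_meas|exact: LgV].
- exact: cond_cov_residual.
- exact: residual_orth.
Qed.

End relevance.

End conditional_moments.

Lemma cond_moments {R : realType} {d d' : measure_display}
    {T : measurableType d} {T' : measurableType d'} (V : {mfun T >-> T'})
    (W X Y : T -> R) (M eps : R) (P : probability T R) :
  measurable_fun setT W -> (forall x, `|W x| <= M) ->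
  measurable_fun setT X -> (forall x, `|X x| <= M) ->
  L2 P Y -> 0 < eps ->
  {ae P, forall x, eps <= `|cond_cov P V X W (V x)|} ->
  moments V W X Y M eps P (cond_exp P V W) (cond_exp P V X) (cond_exp P V Y)
    (cond_cov P V X W) (fun l => cond_cov P V Y W l / cond_cov P V X W l).
Proof.
move=> mW WM mX XM LY eps0 rel.
have LW : L2 P W by apply: bm_L2; split => //; exists M.
have LX : L2 P X by apply: bm_L2; split => //; exists M.
have cW := is_cond_exp_cond_exp V (L2_L1 LW).
have cX := is_cond_exp_cond_exp V (L2_L1 LX).
have cY := is_cond_exp_cond_exp V (L2_L1 LY).
have [LWe _] := cond_exp_L2 cW LW.
have [LXe _] := cond_exp_L2 cX LX.
have [LYe _] := cond_exp_L2 cY LY.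
have cK : is_cond_exp P V (fun x => (X x - cond_exp P V X (V x)) *
    (W x - cond_exp P V W (V x))) (cond_cov P V X W).
  exact: (is_cond_exp_cond_exp V (L2L2 (L2B LX LXe) (L2B LW LWe))).
have cN : is_cond_exp P V (fun x => (Y x - cond_exp P V Y (V x)) *
    (W x - cond_exp P V W (V x))) (cond_cov P V Y W).
  exact: (is_cond_exp_cond_exp V (L2L2 (L2B LY LYe) (L2B LW LWe))).
exact: (momentsP mW WM mX XM LY cW cX cY cK cN eps0 rel).
Qed.

Lemma L2_abs {R : realType} {d : measure_display} {T : measurableType d}
  (mu : {measure set T -> \bar R}) (f : T -> R) :
  L2 mu f -> L2 mu (fun x => `|f x|).
Proof.
move=> Lf; apply: (L2_le _ _ Lf); last by move=> x; rewrite normr_id.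
by apply: measurableT_comp => //; exact: L2_meas Lf.
Qed.

Lemma sqr_norm_le {R : realDomainType} (a b : R) : `|a| <= `|b| -> a ^+ 2 <= b ^+ 2.
Proof.
move=> ab; rewrite -[leLHS]real_normK ?num_real// -[leRHS]real_normK ?num_real//.
by rewrite lerXn2r.
Qed.

(** * The influence function: square integrability and mean zero *)

Section influence.
Context {R : realType} {d d' : measure_display}
  {T : measurableType d} {T' : measurableType d'}.
Variables (V : {mfun T >-> T'}) (W X Y : T -> R) (M eps : R).
Hypotheses (mW : measurable_fun setT W) (WM : forall x, `|W x| <= M).
Hypotheses (mX : measurable_fun setT X) (XM : forall x, `|X x| <= M).
Hypotheses (M0 : 0 <= M) (eps0 : 0 < eps).
Variables (P : probability T R) (rho delta eta kappa gamma : T' -> R).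
Hypothesis LY : L2 P Y.
Hypothesis moP : moments V W X Y M eps P rho delta eta kappa gamma.

Local Notation good := (good_set M eps rho delta kappa).

Definition mean_ratio := \int[P]_x gamma (V x).

Definition residual x := Y x - eta (V x) - gamma (V x) * (X x - delta (V x)).

(** The displayed formula with its terms in [gamma] regrouped: the factor of the normalized weight
    becomes the residual, which is conditionally centred and conditionally uncorrelated with [W]. *)
Definition influence x := gamma (V x) - mean_ratio
  + (W x - rho (V x)) / kappa (V x) * residual x.

Let mV f : measurable_fun setT f -> measurable_fun setT (fun x => f (V x) : R).
Proof. by move=> mf; exact: (measurableT_comp mf (measurable_funPT V)). Qed.

Lemma measurable_residual : measurable_fun setT residual.
Proof.
apply: measurable_funB; first apply: measurable_funB.
- exact: L2_meas LY.
- exact/mV/(mo_eta moP).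
- apply: measurable_funM; first exact/mV/(mo_gamma moP).
  by apply: measurable_funB => //; exact/mV/(mo_delta moP).
Qed.

Lemma measurable_influence : measurable_fun setT influence.
Proof.
apply: measurable_funD.
  by apply: measurable_funB => //; exact/mV/(mo_gamma moP).
apply: measurable_funM; last exact: measurable_residual.
apply: measurable_funM; last exact/measurable_inv/mV/(mo_kappa moP).
by apply: measurable_funB => //; exact/mV/(mo_rho moP).
Qed.

Lemma L2_residual : L2 P residual.
Proof.
apply: L2B; first by apply: L2B => //; exact: mo_L2eta moP.
apply: (@L2_ae_le _ _ _ P _ (fun x => (2 * M) * gamma (V x))).
- apply: measurable_funM; first exact/mV/(mo_gamma moP).
  by apply: measurable_funB => //; exact/mV/(mo_delta moP).
- apply: filterS (mo_good_ae moP) => x [_ h _ _].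
  rewrite !normrM mulrC ler_wpM2r// -normrM.
  apply: le_trans (ler_norm _); apply: (le_trans (ler_normB _ _)).
  by have := XM x; lra.
- by apply: L2_bm; [exact: bm_cst|exact: mo_L2gamma moP].
Qed.

Lemma good_ratio_le x : good (V x) ->
  `|(W x - rho (V x)) / kappa (V x)| <= 2 * M / eps.
Proof.
move=> [h1 _ h2 _]; rewrite normrM normfV; apply: ler_pM => //.
  by apply: (le_trans (ler_normB _ _)); have := WM x; lra.
by rewrite lef_pV2// posrE// (lt_le_trans eps0).
Qed.

Lemma L2_influence : L2 P influence.
Proof.
apply: L2D.
  apply: L2B; first exact: mo_L2gamma moP.
  exact/bm_L2/bm_cst.
apply: (@L2_ae_le _ _ _ P _ (fun x => (2 * M / eps) * residual x)).
- apply: measurable_funM; last exact: measurable_residual.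
  apply: measurable_funM; last exact/measurable_inv/mV/(mo_kappa moP).
  by apply: measurable_funB => //; exact/mV/(mo_rho moP).
- apply: filterS (mo_good_ae moP) => x g.
  rewrite normrM [leRHS]normrM ler_wpM2r//.
  by apply: le_trans (ler_norm _); exact: good_ratio_le.
- by apply: L2_bm L2_residual; exact: bm_cst.
Qed.

(** [1 / kappa] is bounded on the good set only; the indicator makes it an admissible test function
    and changes nothing [P]-almost surely. *)
Lemma bm_good_inv : bm (fun l => \1_good l / kappa l).
Proof.
split.
  apply: measurable_funM; last exact/measurable_inv/(mo_kappa moP).
  by apply: measurable_indic; exact: mo_good moP.
exists eps^-1 => l; rewrite indicE.
case: (boolP (l \in good)) => [/set_mem[_ _ h _]|_]; last first.
  by rewrite mul0r normr0 invr_ge0 ltW.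
by rewrite mul1r normfV lef_pV2// posrE// (lt_le_trans eps0).
Qed.

(** [mo_resid] with [gamma] itself as [c] has right-hand side 0; the division by [kappa] is put into
    the test function. *)
Lemma Rint_influence : \int[P]_x influence x = 0.
Proof.
pose g l := \1_good l / kappa l.
have bg : bm g := bm_good_inv.
have bgd : bm (fun l => g l * delta l).
  split.
    by apply: measurable_funM; [exact: bm_meas bg|exact: mo_delta moP].
  exists (eps^-1 * M) => l; rewrite /g indicE.
  case: (boolP (l \in good)) => [/set_mem[_ h1 h _]|_]; last first.
    by rewrite !mul0r normr0 mulr_ge0// invr_ge0 ltW.
  rewrite mul1r normrM; apply: ler_pM => //.
  by rewrite normfV lef_pV2// posrE// (lt_le_trans eps0).
have r0 : \int[P]_x (g (V x) * residual x * (W x - rho (V x))) = 0.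
  rewrite (mo_resid moP bg (mo_eta moP) (mo_gamma moP) (mo_delta moP)).
  - rewrite (Rint_eq _ (g := fun=> 0)) ?Rint_cst// => x.
    by rewrite subrr mul0r mulr0.
  - exact: (L2_bm (bmV V bg) (mo_L2eta moP)).
  - exact: (L2_bm (bmV V bg) (mo_L2gamma moP)).
  - have := L2_bm (bmV V bgd) (mo_L2gamma moP).
    rewrite (_ : (fun x => _) = (fun x => g (V x) * gamma (V x) * delta (V x)))//.
    by apply/funext => x; rewrite /= mulrAC.
have Lgm := L2_L1 (mo_L2gamma moP).
have Lgr : L1 P (fun x => g (V x) * residual x * (W x - rho (V x))).
  have LgW : L2 P (fun x => \1_good (V x) * (W x - rho (V x))).
    apply: bm_L2; split.
      apply: measurable_funM.
        by apply: mV; apply: measurable_indic; exact: mo_good moP.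
      by apply: measurable_funB => //; exact/mV/(mo_rho moP).
    exists (2 * M) => x; rewrite indicE.
    case: (boolP (V x \in good)) => [/set_mem[h _ _ _]|_]; last first.
      by rewrite mul0r normr0 mulr_ge0.
    rewrite mul1r; apply: (le_trans (ler_normB _ _)).
    by have := WM x; lra.
  apply: L1_ext (L2L2 (L2_bm (bmV V bg) L2_residual) LgW) => x.
  rewrite /g /= [in LHS]indicE [in RHS]indicE.
  by case: (_ \in _); rewrite ?mul1r ?mul0r.
transitivity (\int[P]_x (gamma (V x) - mean_ratio +
    g (V x) * residual x * (W x - rho (V x)))).
  apply: Rint_ae_eq; first exact: measurable_influence.
    apply: measurable_funD; last exact: L1_meas Lgr.
    by apply: measurable_funB => //; exact/mV/(mo_gamma moP).
  apply: filterS (mo_good_ae moP) => x gx.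
  by rewrite /influence /g indicE mem_set// mul1r; congr (_ + _); rewrite [RHS]mulrC mulrA.
have Lc := L1_cst P mean_ratio.
rewrite RintD//; last exact: L1B.
by rewrite r0 addr0 RintB// Rint_cst subrr.
Qed.

End influence.

(** * Expansion of the functional *)

(** Used as a test function, the sign turns a weak identity for [f] into a bound on its L^1 norm. *)
Lemma measurable_sign {R : realType} {d : measure_display} {T : measurableType d}
    (f : T -> R) : measurable_fun setT f ->
  exists sg : T -> R, [/\ measurable_fun setT sg, forall x, `|sg x| <= 1 &
    forall x, sg x * f x = `|f x|].
Proof.
move=> mf; pose A := [set x | 0 <= f x].
have mA : measurable A.
  have := mf measurableT `[0, +oo[%classic (measurable_itv _); rewrite setTI.
  by rewrite (_ : _ @^-1` _ = A)//; apply/seteqP; split => y; rewrite /A /= in_itv/= andbT.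
exists (fun x => 2 * \1_A x - 1); split.
- apply: measurable_funB => //; apply: measurable_funM => //.
- by move=> x; rewrite indicE; case: (_ \in _); rewrite ?mulr1 ?mulr0 ler_norml; apply/andP; split; lra.
- move=> x; rewrite indicE; case: (boolP (x \in A)) => [/set_mem|/negP nA].
    by rewrite /A /= => f0; rewrite ger0_norm//; ring.
  have f0 : f x < 0.
    by rewrite ltNge; apply/negP => f0; apply: nA; exact/mem_set.
  by rewrite ltr0_norm// mulr0 sub0r mulN1r.
Qed.

Section expansion.
Context {R : realType} {d d' : measure_display}
  {T : measurableType d} {T' : measurableType d'}.
Variables (V : {mfun T >-> T'}) (W X Y : T -> R) (M eps MY : R).
Hypotheses (mW : measurable_fun setT W) (WM : forall x, `|W x| <= M).
Hypotheses (mX : measurable_fun setT X) (XM : forall x, `|X x| <= M).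
Hypotheses (M0 : 0 <= M) (eps0 : 0 < eps).
Variables (P : probability T R) (rho delta eta kappa gamma : T' -> R).
Hypotheses (LY : L2 P Y) (YM : \int[P]_x Y x ^+ 2 <= MY).
Hypothesis moP : moments V W X Y M eps P rho delta eta kappa gamma.
Variable s : T -> R.
Hypothesis Ls : L2 P s.

Local Notation psi0 := (mean_ratio V P gamma).
Local Notation h := (hell_cst P s).
Local Notation res := (residual V X Y delta eta gamma).
Local Notation phi := (influence V W X Y P rho delta eta kappa gamma).

Definition sqr_sum l := eta l ^+ 2 + gamma l ^+ 2.
Local Notation um := sqr_sum.

Definition mean_sqr_sum := \int[P]_x um (V x).
(** Bounds the weight [(W - rho) / kappa] on a good set. *)
Definition ratio_cst := 2 * M / eps.
(** In [Phi_pt] the integrand is at most a sum of four terms, in [Y], [eta], [gamma] and [psi0]. The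
    4 is the loss in squaring such a sum; the bracket collects the squared coefficients. *)
Definition Phi_cst := 4 * (ratio_cst ^+ 2 + (1 + 2 * M * ratio_cst) ^+ 2 + psi0 ^+ 2).
(** [1 + z] stands in for the root of [z], since [z <= (1 + z) ^+ 2] for [z >= 0]. The same device
    gives [gamma_bound], [phi_bound] and [res_bound]. *)
Definition Phi_bound := 1 + Phi_cst * (MY + 2 * h + 2 * mean_sqr_sum + 1).
(** From [zeta_pt]: [eps^-1] times the constant of [P_drho], plus [2 * M / eps ^+ 2] times that of
    [P_dkappa]. *)
Definition zeta_cst := 8 * h * M / eps + 64 * h * M ^+ 3 / eps ^+ 2.
(** The summands bound, in units of [w ^+ 2], the probabilities of the exceptional events [B], [N2],
    [N1] and [Dz], in this order, so that [UI] applies to each of them. *)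
Definition small_cst := 9 + mean_sqr_sum + 2 * h + zeta_cst.
Definition gamma_bound := 1 + 16 * M ^+ 2 / eps ^+ 2 * MY.
Definition phi_bound := 1 + \int[P]_x phi x ^+ 2.
Definition res_bound := 1 + \int[P]_x res x ^+ 2.
Definition expansion_cst := Phi_bound * (h + 7) + (phi_bound + (res_bound + h) + 2 * ratio_cst * res_bound)
  + 12 * gamma_bound + 26 * `|psi0|.

Variables (Q : probability T R) (rhoq deltaq etaq kappaq gammaq : T' -> R).
Hypotheses (LYq : L2 Q Y) (YMq : \int[Q]_x Y x ^+ 2 <= MY).
Hypothesis moQ : moments V W X Y M eps Q rhoq deltaq etaq kappaq gammaq.
Variables (t r e w : R) (H : set T -> R).
Hypothesis hell : hellinger_bounds P Q s t r H.
Hypotheses (t0 : t != 0) (r0 : 0 <= r) (re : r <= e).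
Hypotheses (e01 : 0 < e <= 1) (w01 : 0 < w <= 1).
Hypothesis tew : `|t| <= e ^+ 2 * w ^+ 2.
Hypothesis UI : forall D, measurable D -> \int[P]_x \1_D x <= small_cst * w ^+ 2 ->
  \int[P]_x (\1_D x * (s x ^+ 2 + um (V x))) <= e ^+ 2.

Let good := good_set M eps rho delta kappa.
Let goodq := good_set M eps rhoq deltaq kappaq.
(* On [low] the functions [eta] and [gamma], which need not be [Q]-integrable, are
   bounded by a power of 1 / t, and its complement has probability o(t^2). *)
Let low := [set l | t ^+ 2 * um l <= 1].
Let G := good `&` goodq `&` low.

Let e0 : 0 < e. Proof. by case/andP: e01. Qed.
Let e1 : e <= 1. Proof. by case/andP: e01. Qed.
Let w0 : 0 < w. Proof. by case/andP: w01. Qed.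
Let w1 : w <= 1. Proof. by case/andP: w01. Qed.
Let r1 : r <= 1. Proof. exact: le_trans re e1. Qed.
Let h1 : 1 <= h. Proof. exact: hell_cst_ge1. Qed.
Let h0 : 0 <= h. Proof. exact: le_trans h1. Qed.

Let e2w2 : e ^+ 2 * w ^+ 2 <= 1.
Proof. by rewrite -exprMn expr_le1 ?mulr_ge0 ?mulr_ile1 ?(ltW e0) ?(ltW w0). Qed.

Let t1 : `|t| <= 1. Proof. exact: le_trans tew e2w2. Qed.

Let t2 : t ^+ 2 <= `|t|.
Proof. by rewrite -[leLHS]real_normK ?num_real// expr2 ler_piMl. Qed.

Let t2w : t ^+ 2 <= w ^+ 2.
Proof.
apply: (le_trans t2); apply: (le_trans tew).
by rewrite ler_piMl ?sqr_ge0// expr_le1// ltW.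
Qed.

Let mV f : measurable_fun setT f -> measurable_fun setT (fun x => f (V x) : R).
Proof. by move=> mf; exact: (measurableT_comp mf (measurable_funPT V)). Qed.

Let mum : measurable_fun setT um.
Proof.
apply: measurable_funD; apply: measurable_funX; first exact: mo_eta moP.
exact: mo_gamma moP.
Qed.

Let um0 l : 0 <= um l. Proof. by rewrite addr_ge0 ?sqr_ge0. Qed.

Let Lum : L1 P (fun x => um (V x)).
Proof. by apply: L1D; [case: (mo_L2eta moP)|case: (mo_L2gamma moP)]. Qed.

Let U0 : 0 <= mean_sqr_sum. Proof. exact: Rint_ge0. Qed.

Let cc0 : 0 <= ratio_cst. Proof. by rewrite divr_ge0 ?mulr_ge0// ltW. Qed.

Let cz0 : 0 <= zeta_cst.
Proof.
by rewrite addr_ge0// !mulr_ge0 ?invr_ge0 ?exprn_ge0// ?(ltW eps0)// ?exprn_ge0// ltW.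
Qed.

Let MY0 : 0 <= MY.
Proof. by apply: le_trans YM; apply: Rint_ge0 => x; exact: sqr_ge0. Qed.

Let c1w x : 0 <= x -> x <= small_cst -> x * t ^+ 2 <= small_cst * w ^+ 2.
Proof. by move=> x0 xc; apply: ler_pM => //; exact: sqr_ge0. Qed.

Let c1_parts : [/\ 9 <= small_cst, mean_sqr_sum <= small_cst, 2 * h <= small_cst & zeta_cst <= small_cst].
Proof. by rewrite /small_cst; move: U0 h1 cz0 => a b c; split; lra. Qed.

Let mlow : measurable low.
Proof.
have mu : measurable_fun setT (fun l => t ^+ 2 * um l).
  by apply: measurable_funM.
have := mu measurableT `]-oo, 1]%classic (measurable_itv _); by rewrite setTI.
Qed.

Let mG : measurable G.
Proof.
apply: measurableI => //; apply: measurableI; first exact: mo_good moP.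
exact: mo_good moQ.
Qed.

Let mVs (A : set T') : measurable A -> measurable (V @^-1` A).
Proof. by move=> mA; rewrite -[X in measurable X]setTI; exact: measurable_funPT. Qed.

Let split_UI D : measurable D -> \int[P]_x \1_D x <= small_cst * w ^+ 2 ->
  \int[P]_x (\1_D x * s x ^+ 2) <= e ^+ 2 /\
  \int[P]_x (\1_D x * um (V x)) <= e ^+ 2.
Proof.
move=> mD PD; have [_ Ls2] := Ls.
have L1 : L1 P (fun x => \1_D x * (s x ^+ 2 + um (V x))).
  by apply: L1_bm; [exact: bm_indic|exact: L1D].
split; apply: le_trans (UI mD PD).
  apply: Rint_le => //; first by apply: L1_bm => //; exact: bm_indic.
  by move=> x; rewrite ler_wpM2l ?indicE// lerDl.
apply: Rint_le => //; first by apply: L1_bm => //; exact: bm_indic.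
by move=> x; rewrite ler_wpM2l ?indicE// lerDr sqr_ge0.
Qed.

Let small_H D : measurable D -> \int[P]_x \1_D x <= small_cst * w ^+ 2 ->
  H D <= 4 * e ^+ 2 * t ^+ 2.
Proof.
move=> mD /(split_UI mD)[sD _].
apply: le_trans (hell_le_small hell r0 mD (ltW e0) re sD) _.
by rewrite le_eqVlt; apply/orP; left; apply/eqP; ring.
Qed.

Let L1ind (P' : probability T R) D : measurable D -> L1 P' (\1_D).
Proof. by move=> mD; apply: bm_L1; exact: bm_indic. Qed.

Let Rint_ind1 (P' : probability T R) (D : set T) :
  \int[P']_x (\1_D x * 1) = \int[P']_x \1_D x :> R.
Proof. by apply: Rint_eq => x; rewrite mulr1. Qed.

Let one01 (x : T) : 0 <= (1 : R) <= 1. Proof. by rewrite ler01 lexx. Qed.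

(** * Probability of the exceptional event [B] *)

Let N1 := V @^-1` (~` goodq).
Let N2 := V @^-1` (~` low).
Let B := V @^-1` (~` G).

Let mN1 : measurable N1.
Proof. by apply: mVs; apply: measurableC; exact: mo_good moQ. Qed.
Let mN2 : measurable N2. Proof. by apply: mVs; exact: measurableC. Qed.
Let mB : measurable B. Proof. by apply: mVs; exact: measurableC. Qed.

(** [N1] is null under [Q], so its [P]-probability is at most [2 * H N1]. The estimate runs twice:
    the crude O(t^2) bound on [H] makes the event small enough for [UI], which then improves [H] and
    with it the probability. *)
Let PN1 : \int[P]_x \1_N1 x <= 8 * e ^+ 2 * t ^+ 2.
Proof.
have QN1 : \int[Q]_x \1_N1 x = 0 :> R.
  rewrite -[RHS](Rint_cst Q 0); apply: Rint_ae_eq => //.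
  apply: filterS (mo_good_ae moQ) => x gx.
  by rewrite indicE memNset.
have := hell_dom' hell mN1 (bm_cst 1) one01.
rewrite !Rint_ind1 QN1 mulr0 addr0 mulr1 => PN.
have PN' : \int[P]_x \1_N1 x <= small_cst * w ^+ 2.
  apply: (le_trans PN); have [_ _ hc _] := c1_parts.
  apply: (@le_trans _ _ (2 * (h * t ^+ 2))).
    by rewrite ler_wpM2l//; exact: (hell_le hell).
  by rewrite mulrA; apply: c1w => //; rewrite mulr_ge0.
have := small_H mN1 PN'; move: PN; lra.
Qed.

(** On [N2] one has [1 < t ^+ 2 * um], so Markov gives a crude bound; the event is then small enough
    for [UI] to bound the integral of [um] over it by [e ^+ 2]. *)
Let PN2 : \int[P]_x \1_N2 x <= e ^+ 2 * t ^+ 2.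
Proof.
have N2x x : \1_N2 x <= t ^+ 2 * (\1_N2 x * um (V x)).
  rewrite indicE; case: (boolP (x \in N2)) => [/set_mem|_]; last first.
    by rewrite mul0r mulr0.
  by rewrite mul1r /N2 /low /= => /negP; rewrite -ltNge => /ltW.
have LN : L1 P (fun x => \1_N2 x * um (V x)).
  by apply: L1_bm => //; exact: bm_indic.
have PN : \int[P]_x \1_N2 x <= t ^+ 2 * \int[P]_x (\1_N2 x * um (V x)).
  by rewrite -RintZ//; apply: Rint_le => //; [exact: L1ind|exact: L1Z].
have PN' : \int[P]_x \1_N2 x <= small_cst * w ^+ 2.
  apply: (le_trans PN); have [_ hc _ _] := c1_parts.
  apply: (@le_trans _ _ (mean_sqr_sum * t ^+ 2)); last exact: c1w.
  rewrite mulrC ler_wpM2r ?sqr_ge0//.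
  exact: Rint_indic_le.
have [_ uN] := split_UI mN2 PN'.
by apply: (le_trans PN); rewrite mulrC ler_wpM2r ?sqr_ge0.
Qed.

(** 9 = 8 + 1, from [N1] and [N2]; the complement of [good] is [P]-null. *)
Let PB : \int[P]_x \1_B x <= 9 * e ^+ 2 * t ^+ 2.
Proof.
apply: (@le_trans _ _ (\int[P]_x (\1_N1 x + \1_N2 x))).
  apply: Rint_ae_le; [exact: L1ind|by apply: L1D; exact: L1ind|].
  apply: filterS (mo_good_ae moP) => x gx.
  rewrite !indicE; case: (boolP (x \in B)) => [/set_mem Bx|_]; last first.
    by rewrite addr_ge0.
  case: (boolP (x \in N1)) => [_|/negP n1]; first by rewrite lerDl.
  rewrite mem_set ?lerDr//; apply: contrapT => n2; apply: Bx; split; first split.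
  - exact: gx.
  - by apply: contrapT => n; apply: n1; apply/mem_set.
  - by apply: contrapT => n; apply: n2.
rewrite RintD; [|exact: L1ind..]; move: PN1 PN2; lra.
Qed.

Let PB' : \int[P]_x \1_B x <= small_cst * w ^+ 2.
Proof.
apply: (le_trans PB); have [hc _ _ _] := c1_parts.
apply: c1w; first by rewrite mulr_ge0 ?sqr_ge0.
by apply: le_trans hc; rewrite ler_piMr// expr_le1// ltW.
Qed.

Let HB : H B <= 4 * e ^+ 2 * t ^+ 2. Proof. exact: small_H. Qed.

Let QB : \int[Q]_x \1_B x <= 26 * e ^+ 2 * t ^+ 2.
Proof.
(* 26 = 2 * 4 + 2 * 9, from [HB] and [PB]. *)
have := hell_dom hell mB (bm_cst 1) one01.
by rewrite !Rint_ind1 mulr1; move: HB PB; lra.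
Qed.

(** By Cauchy-Schwarz an event of probability O(e^2 t^2) contributes only O(e t) to the integral of
    a function with bounded second moment. The square 36 covers both 9 and 26. *)
Let bad_part (P' : probability T R) f : L2 P' (f \o V) ->
  \int[P']_x \1_B x <= 36 * e ^+ 2 * t ^+ 2 ->
  \int[P']_x f (V x) ^+ 2 <= gamma_bound ^+ 2 ->
  `|\int[P']_x (\1_B x * f (V x))| <= 6 * gamma_bound * e * `|t|.
Proof.
move=> Lf PB36 fg.
have cg0 : 0 <= gamma_bound.
  by rewrite addr_ge0// !mulr_ge0 ?invr_ge0 ?sqr_ge0.
have LB : L2 P' (\1_B) by apply: bm_L2; exact: bm_indic.
apply: ler_norm_sqr; first by rewrite !mulr_ge0// ltW.
apply: le_trans (cauchy_schwarz LB Lf) _.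
rewrite (_ : (6 * gamma_bound * e * `|t|) ^+ 2 = 36 * e ^+ 2 * t ^+ 2 * gamma_bound ^+ 2).
  apply: ler_pM => //; [by apply: Rint_ge0 => x; exact: sqr_ge0..|].
  apply: le_trans PB36; rewrite le_eqVlt; apply/orP; left; apply/eqP.
  by apply: Rint_eq => x; rewrite indicE; case: (_ \in _); rewrite ?expr1n ?expr0n.
by rewrite exprMn real_normK ?num_real//; ring.
Qed.

Let gamma_cg (P' : probability T R) y : y <= 16 * M ^+ 2 / eps ^+ 2 * \int[P']_x Y x ^+ 2 ->
  \int[P']_x Y x ^+ 2 <= MY -> y <= gamma_bound ^+ 2.
Proof.
move=> yl YMY.
have q0 : 0 <= 16 * M ^+ 2 / eps ^+ 2 by rewrite !mulr_ge0 ?invr_ge0 ?sqr_ge0.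
have z0 : 0 <= 16 * M ^+ 2 / eps ^+ 2 * MY by rewrite mulr_ge0.
apply: (le_trans yl); apply: (@le_trans _ _ (16 * M ^+ 2 / eps ^+ 2 * MY)).
  by rewrite ler_wpM2l.
rewrite /gamma_bound; move: (_ * MY) z0 => z z0; nra.
Qed.

Let PBg : `|\int[P]_x (\1_B x * gamma (V x))| <= 6 * gamma_bound * e * `|t|.
Proof.
apply: (bad_part (mo_L2gamma moP)).
  by have := sqr_ge0 (e * t); rewrite exprMn; move: PB; lra.
exact: gamma_cg (mo_gamma_le moP) YM.
Qed.

Let QBg : `|\int[Q]_x (\1_B x * gammaq (V x))| <= 6 * gamma_bound * e * `|t|.
Proof.
apply: (bad_part (mo_L2gamma moQ)).
  by have := sqr_ge0 (e * t); rewrite exprMn; move: QB; lra.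
exact: gamma_cg (mo_gamma_le moQ) YMq.
Qed.

(** * The exact identity restricted to [G] *)

Let iG x : R := \1_G (V x).

Let iGB x : iG x = 1 - \1_B x.
Proof.
rewrite /iG !indicE; case: (boolP (V x \in G)) => [/set_mem g|/negP g].
  by rewrite memNset ?subr0//; exact.
by rewrite mem_set ?subrr// => g'; apply: g; exact: mem_set.
Qed.

Let bmG (f : T' -> R) K : measurable_fun setT f -> 0 <= K -> (forall l, G l -> `|f l| <= K) ->
  bm (fun l => \1_G l * f l).
Proof.
move=> mf K0 fK; split; first by apply: measurable_funM => //; exact: measurable_indic.
exists K => l; rewrite indicE; case: (boolP (l \in G)) => [/set_mem|_].
  by rewrite mul1r; exact: fK.
by rewrite mul0r normr0.
Qed.

Let Gum l : G l -> um l <= t ^- 2.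
Proof.
move=> [_ gl]; rewrite -[leRHS]mulr1 ler_pdivlMl//.
by rewrite exprn_even_gt0.
Qed.

(** This bound only serves to make test functions bounded at a fixed [t]; its growth as [t] tends to
    0 enters no estimate. *)
Let Geta l : G l -> `|eta l| <= 1 + t ^- 2.
Proof.
move=> /Gum; rewrite /um; have := sqr_ge0 (gamma l); have := sqr_ge0 (`|eta l| - 1).
rewrite sqrrB real_normK ?num_real//.
have := normr_ge0 (eta l); lra.
Qed.

Let Ggamma l : G l -> `|gamma l| <= 1 + t ^- 2.
Proof.
move=> /Gum; rewrite /um; have := sqr_ge0 (eta l); have := sqr_ge0 (`|gamma l| - 1).
rewrite sqrrB real_normK ?num_real//.
have := normr_ge0 (gamma l); lra.
Qed.

Let tK0 : 0 <= 1 + t ^- 2. Proof. by rewrite addr_ge0// invr_ge0 sqr_ge0. Qed.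

Let Gkq l : G l -> `|(kappaq l)^-1| <= eps^-1.
Proof.
by move=> [[_ [_ _ h' _]] _]; rewrite normfV lef_pV2// posrE// (lt_le_trans eps0).
Qed.

Let gq l := \1_G l * (kappaq l)^-1.

Let bgq : bm gq.
Proof.
apply: (@bmG _ eps^-1) => //; last by rewrite invr_ge0 ltW.
by apply: measurable_inv; exact: mo_kappa moQ.
Qed.

Let bgq_mul (f : T' -> R) K : measurable_fun setT f -> 0 <= K ->
  (forall l, G l -> `|f l| <= K) -> bm (fun l => gq l * f l).
Proof.
move=> mf K0 fK.
rewrite (_ : (fun l => _) = (fun l => \1_G l * ((kappaq l)^-1 * f l))); last first.
  by apply/funext => l; rewrite /gq mulrA.
apply: (@bmG _ (eps^-1 * K)).
- by apply: measurable_funM => //; apply: measurable_inv; exact: mo_kappa moQ.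
- by rewrite mulr_ge0// invr_ge0 ltW.
- by move=> l Gl; rewrite normrM; apply: ler_pM => //; [exact: Gkq|exact: fK].
Qed.

(* The integrand of the exact identity of the header, on [G]. *)
Let Phi x := iG x * (gamma (V x) - psi0) + gq (V x) * res x * (W x - rhoq (V x)).

Let bgeta := bgq_mul (mo_eta moP) tK0 Geta.
Let bggamma := bgq_mul (mo_gamma moP) tK0 Ggamma.

Let bggd : bm (fun l => gq l * gamma l * delta l).
Proof.
have m : measurable_fun setT (fun l => gamma l * delta l).
  by apply: measurable_funM; [exact: mo_gamma moP|exact: mo_delta moP].
have := @bgq_mul _ ((1 + t ^- 2) * M) m.
rewrite (_ : (fun l => gq l * (_ * _)) = (fun l => gq l * gamma l * delta l)).
  apply; first exact: mulr_ge0.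
  move=> l Gl; rewrite normrM; apply: ler_pM => //; first exact: Ggamma.
  by case: Gl => [[[]]].
by apply/funext => l; rewrite mulrA.
Qed.

Let LbV (P' : probability T R) f : bm f -> L2 P' (fun x => f (V x)).
Proof. by move=> bf; apply: bm_L2; exact: (bmV V bf). Qed.

Let bGg : bm (fun l => \1_G l * gamma l).
Proof. exact: (bmG (mo_gamma moP) tK0 Ggamma). Qed.

Let mres : measurable_fun setT res.
Proof. exact: (measurable_residual mX LY moP). Qed.

Let gqW x : `|iG x * (W x - rhoq (V x))| <= 2 * M.
Proof.
rewrite /iG indicE; case: (boolP (V x \in G)) => [/set_mem[[_ [h' _ _ _]] _]|_].
  rewrite mul1r; apply: (le_trans (ler_normB _ _)); have := WM x; lra.
by rewrite mul0r normr0 mulr_ge0.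
Qed.

Let biG : bm iG. Proof. by apply: (bmV V); exact: bm_indic. Qed.

Let iG2 x : iG x * iG x = iG x.
Proof. by rewrite /iG indicE; case: (_ \in _); rewrite ?mulr1 ?mulr0. Qed.

Let gqE x : gq (V x) * res x * (W x - rhoq (V x)) =
  gq (V x) * (iG x * (W x - rhoq (V x))) * res x.
Proof.
by rewrite /gq -/(iG x) -[in LHS]iG2; ring.
Qed.

Let bgqW : bm (fun x => gq (V x) * (iG x * (W x - rhoq (V x)))).
Proof.
apply: bmM; first exact: (bmV V bgq).
split; last by exists (2 * M).
apply: measurable_funM; first exact: bm_meas biG.
by apply: measurable_funB => //; exact/mV/(mo_rho moQ).
Qed.

Let iGres x : `|iG x * res x| <=
  `| `|Y x| + iG x * (`|eta (V x)| + 2 * M * `|gamma (V x)|)|.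
Proof.
have i0 : 0 <= iG x by rewrite /iG indicE.
rewrite [leRHS]ger0_norm; last first.
  by rewrite addr_ge0// mulr_ge0// addr_ge0// !mulr_ge0.
rewrite normrM ger0_norm// /iG indicE; case: (boolP (V x \in G)) => [/set_mem g|_].
  rewrite !mul1r /residual; apply: (le_trans (ler_normB _ _)).
  rewrite [leRHS]addrA; apply: lerD; first exact: ler_normB.
  rewrite normrM mulrC ler_wpM2r//; apply: (le_trans (ler_normB _ _)).
  by have := XM x; case: g => [[[_ h2 _ _] _] _]; lra.
by rewrite !mul0r addr0.
Qed.

Let biGum : bm (fun l => \1_G l * (`|eta l| + 2 * M * `|gamma l|)).
Proof.
apply: (@bmG _ ((1 + t ^- 2) + 2 * M * (1 + t ^- 2))).
- apply: measurable_funD; first by apply: measurableT_comp => //; exact: mo_eta moP.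
  apply: measurable_funM => //; apply: measurableT_comp => //; exact: mo_gamma moP.
- by rewrite addr_ge0// !mulr_ge0.
- move=> l Gl; rewrite ger0_norm ?addr_ge0 ?mulr_ge0//.
  apply: lerD; first exact: Geta.
  by rewrite ler_wpM2l ?mulr_ge0//; exact: Ggamma.
Qed.

(** On [G] the residual is at most |Y| plus a bounded function, so the second moment of [Y] under
    the law at hand controls it, be it [P] or [Q]. *)
Let LiGres (P' : probability T R) : L2 P' Y -> L2 P' (fun x => iG x * res x).
Proof.
move=> LY'; apply: (L2_le _ iGres).
  by apply: measurable_funM => //; exact: bm_meas biG.
by apply: L2D; [exact: L2_abs|exact: LbV biGum].
Qed.

Let L2gqres (P' : probability T R) : L2 P' Y ->
  L2 P' (fun x => gq (V x) * res x * (W x - rhoq (V x))).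
Proof.
move=> LY'.
rewrite (_ : (fun x => _) =
    (fun x => gq (V x) * (iG x * (W x - rhoq (V x))) * (iG x * res x))).
  by apply: L2_bm => //; exact: LiGres.
apply/funext => x; rewrite gqE.
by rewrite -[in LHS]iG2; ring.
Qed.

Let L2Phi (P' : probability T R) : L2 P' Y -> L2 P' Phi.
Proof.
move=> LY'; apply: L2D; last exact: L2gqres.
rewrite (_ : (fun x => _) = (fun x => (\1_G (V x) * gamma (V x)) - iG x * psi0)).
  apply: L2B; first exact: (LbV _ bGg).
  by apply: bm_L2; apply: bmM => //; exact: bm_cst.
by apply/funext => x; rewrite /iG; ring.
Qed.

Let RintPhi (P' : probability T R) : L2 P' Y -> \int[P']_x Phi x =
  \int[P']_x (iG x * gamma (V x)) - psi0 * \int[P']_x iG x +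
  \int[P']_x (gq (V x) * res x * (W x - rhoq (V x))).
Proof.
move=> LY'.
have a1 : L1 P' (fun x => iG x * gamma (V x)) by apply: L2_L1; exact: (LbV _ bGg).
have a2 : L1 P' iG by apply: bm_L1.
have a3 := L2_L1 (L2gqres LY').
rewrite -RintZ// -RintB//; last exact: L1Z.
rewrite -RintD//; last by apply: L1B => //; exact: L1Z.
by apply: Rint_eq => x; rewrite /Phi; ring.
Qed.

(** [mo_resid] for [Q], with the nuisance functions of [P] as [e], [c] and [a], yields
    [(gammaq - gamma) * kappaq]; the test function [gq] cancels [kappaq] on [G]. *)
Let Q_gq : \int[Q]_x (gq (V x) * res x * (W x - rhoq (V x))) =
  \int[Q]_x (iG x * gammaq (V x)) - \int[Q]_x (iG x * gamma (V x)).
Proof.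
rewrite (mo_resid moQ bgq (mo_eta moP) (mo_gamma moP) (mo_delta moP)); last 3 first.
- exact: (LbV _ bgeta).
- exact: (LbV _ bggamma).
- exact: (LbV _ bggd).
rewrite -RintB; last 2 first.
- by apply: L1_bm => //; exact: L2_L1 (mo_L2gamma moQ).
- by apply: L2_L1; exact: (LbV _ bGg).
apply: Rint_eq => x; rewrite /gq -/(iG x) /iG indicE.
case: (boolP (V x \in G)) => [/set_mem[[_ [_ _ k0 _]] _]|_]; last by rewrite !mul0r subrr.
rewrite !mul1r mulrC mulfK//.
by rewrite -normr_gt0 (lt_le_trans eps0).
Qed.

(** [W - rhoq] is [W - rho] minus [rhoq - rho]. The residual of [P] is orthogonal to the first by
    [mo_resid] with [c] equal to [gamma], and to the second, a function of [V], by [mo_resid0]. *)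
Let P_gq : \int[P]_x (gq (V x) * res x * (W x - rhoq (V x))) = 0.
Proof.
have o1 : \int[P]_x (gq (V x) * res x * (W x - rho (V x))) = 0.
  rewrite (mo_resid moP bgq (mo_eta moP) (mo_gamma moP) (mo_delta moP)).
  - rewrite -[RHS](Rint_cst P 0); apply: Rint_eq => x.
    by rewrite subrr mul0r mulr0.
  - exact: (LbV _ bgeta).
  - exact: (LbV _ bggamma).
  - exact: (LbV _ bggd).
have b2 : bm (fun l => gq l * (rhoq l - rho l)).
  apply: (@bgq_mul _ (2 * M)); last 2 first.
  - by rewrite mulr_ge0.
  - move=> l [[[h1' _ _ _] [h2' _ _ _]] _].
    by apply: (le_trans (ler_normB _ _)); lra.
  by apply: measurable_funB; [exact: mo_rho moQ|exact: mo_rho moP].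
have o2 := mo_resid0 moP b2.
have L1a := L2_L1 (L2gqres LY).
have L1b : L1 P (fun x => gq (V x) * (rhoq (V x) - rho (V x)) * res x).
  by apply: L2_L1; apply: (L2_bm (bmV V b2)); exact: (L2_residual mX XM LY moP).
have : \int[P]_x (gq (V x) * res x * (W x - rhoq (V x)) +
   gq (V x) * (rhoq (V x) - rho (V x)) * res x) = 0.
  by rewrite -[RHS]o1; apply: Rint_eq => x; ring.
by rewrite RintD// [X in _ + X]o2 addr0.
Qed.

(** The term in [psi0] remains because the centring in [Phi] is cut off to [G], whose mass may
    differ under the two laws. *)
Let diff_Phi : \int[Q]_x Phi x - \int[P]_x Phi x =
  \int[Q]_x (iG x * gammaq (V x)) - \int[P]_x (iG x * gamma (V x))
  - psi0 * (\int[P]_x \1_B x - \int[Q]_x \1_B x).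
Proof.
have iGE (P' : probability T R) : \int[P']_x iG x = 1 - \int[P']_x \1_B x.
  rewrite (Rint_eq _ iGB) RintB ?Rint_cst//; first exact: L1_cst.
  exact: L1ind.
rewrite !RintPhi// Q_gq P_gq !iGE; ring.
Qed.

Let psi_split (P' : probability T R) f : L2 P' (f \o V) ->
  \int[P']_x f (V x) = \int[P']_x (iG x * f (V x)) + \int[P']_x (\1_B x * f (V x)).
Proof.
move=> Lf; have L1f := L2_L1 Lf.
rewrite -RintD.
- by apply: Rint_eq => x; rewrite -mulrDl iGB subrK mul1r.
- exact: L1_bm.
- by apply: L1_bm => //; exact: bm_indic.
Qed.

(** Only [B] contributes: 12 = 6 + 6 from the two ratios integrated over it, and 26 from the
    difference of its masses. *)
Lemma psi_diff : `|\int[Q]_x gammaq (V x) - psi0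
    - (\int[Q]_x Phi x - \int[P]_x Phi x)| <= (12 * gamma_bound + 26 * `|psi0|) * e * `|t|.
Proof.
rewrite {1}/mean_ratio (psi_split (mo_L2gamma moQ)) (psi_split (mo_L2gamma moP)) diff_Phi.
set a := \int[Q]_x (iG x * _); set b := \int[P]_x (iG x * _).
set p := \int[P]_x \1_B x; set q := \int[Q]_x \1_B x.
move: PBg QBg; set c := \int[P]_x _; set f := \int[Q]_x _ => cP' fQ'.
rewrite (_ : _ - _ = f - c + psi0 * (p - q)); last by ring.
have p0 : 0 <= p by apply: Rint_ge0 => x; rewrite indicE.
have q0 : 0 <= q by apply: Rint_ge0 => x; rewrite indicE.
have e2 : e ^+ 2 <= e by rewrite expr2 ler_piMl// ltW.
have et : e ^+ 2 * t ^+ 2 <= e * `|t|.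
  by apply: ler_pM => //; exact: sqr_ge0.
have pq : `|p - q| <= 26 * (e * `|t|).
  have : 0 <= e * `|t| by rewrite mulr_ge0// ltW.
  by rewrite ler_norml; move: PB QB; rewrite -/p -/q; lra.
have pq' : `|psi0 * (p - q)| <= `|psi0| * (26 * (e * `|t|)).
  by rewrite normrM ler_wpM2l.
apply: (le_trans (ler_normD _ _)).
have := ler_normB f c.
rewrite (_ : (12 * gamma_bound + _) * e * `|t| = 6 * gamma_bound * e * `|t| + 6 * gamma_bound * e * `|t| +
  `|psi0| * (26 * (e * `|t|))); last by ring.
lra.
Qed.

(** * Second moments of [Phi] under both laws, and its linearization *)

Let Phi_pt x : Phi x ^+ 2 <= Phi_cst * (Y x ^+ 2 + iG x * um (V x) + 1).
Proof.
rewrite /Phi /gq /iG indicE; case: (boolP (V x \in G)) => [/set_mem g|_]; last first.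
  rewrite !mul0r add0r expr0n/=.
  by rewrite !mulr_ge0 ?addr_ge0 ?sqr_ge0.
rewrite !mul1r.
have R1 := iGres x; rewrite /iG indicE mem_set// !mul1r in R1.
have W1 := gqW x; rewrite /iG indicE mem_set// !mul1r in W1.
have K1 := Gkq g.
pose A := ratio_cst * `|Y x|; pose B0 := ratio_cst * `|eta (V x)|.
pose C0 := (1 + 2 * M * ratio_cst) * `|gamma (V x)|; pose D0 := `|psi0|.
have bound : `|gamma (V x) - psi0 + (kappaq (V x))^-1 * res x * (W x - rhoq (V x))|
    <= A + B0 + C0 + D0.
  apply: (le_trans (ler_normD _ _)).
  have b1 : `|(kappaq (V x))^-1 * res x * (W x - rhoq (V x))| <=
      ratio_cst * (`|Y x| + (`|eta (V x)| + 2 * M * `|gamma (V x)|)).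
    rewrite !normrM mulrAC; apply: ler_pM; [exact: mulr_ge0|exact: normr_ge0| |].
    - by rewrite /ratio_cst mulrC; apply: ler_pM.
    - by rewrite -[leRHS]ger0_norm// addr_ge0// addr_ge0// !mulr_ge0.
  have b2 := ler_normB (gamma (V x)) psi0.
  rewrite /A /B0 /C0 /D0; move: b1 b2; lra.
apply: (@le_trans _ _ ((A + B0 + C0 + D0) ^+ 2)).
  rewrite -[leLHS]real_normK ?num_real// lerXn2r ?nnegrE//.
  have c'0 : 0 <= 1 + 2 * M * ratio_cst.
    exact: (addr_ge0 ler01 (mulr_ge0 (mulr_ge0 (ler0n _ 2) M0) cc0)).
  have A0 : 0 <= A by exact: mulr_ge0.
  have B00 : 0 <= B0 by exact: mulr_ge0.
  have C00 : 0 <= C0 by exact: mulr_ge0.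
  have D00 : 0 <= D0 by exact: normr_ge0.
  by rewrite !addr_ge0.
apply: (@le_trans _ _ (4 * (A ^+ 2 + B0 ^+ 2 + C0 ^+ 2 + D0 ^+ 2))).
  rewrite -subr_ge0 (_ : _ - _ = (A - B0) ^+ 2 + (A - C0) ^+ 2 + (A - D0) ^+ 2 +
    (B0 - C0) ^+ 2 + (B0 - D0) ^+ 2 + (C0 - D0) ^+ 2); last by ring.
  by rewrite !addr_ge0 ?sqr_ge0.
have nn (a b : R) : (a * `|b|) ^+ 2 = a ^+ 2 * b ^+ 2.
  by rewrite exprMn real_normK ?num_real.
rewrite /A /B0 /C0 /D0 /Phi_cst /um !nn [`|psi0| ^+ 2]real_normK ?num_real//.
rewrite -[leRHS]mulrA ler_wpM2l//.
move: (sqr_ge0 ratio_cst) (sqr_ge0 (1 + 2 * M * ratio_cst)) (sqr_ge0 psi0).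
move: (sqr_ge0 (Y x)) (sqr_ge0 (eta (V x))) (sqr_ge0 (gamma (V x))).
move: (Y x ^+ 2) (eta (V x) ^+ 2) (gamma (V x) ^+ 2) (ratio_cst ^+ 2).
move: ((1 + 2 * M * ratio_cst) ^+ 2) (psi0 ^+ 2) => p q y z u v y0 z0 u0 v0 p0 q0.
by rewrite -subr_ge0 (_ : _ - _ = v * u + p * y + p * z + q * y + q * (z + u) + p + v);
  [rewrite !addr_ge0// !mulr_ge0// addr_ge0|ring].
Qed.

Let biGumV : bm (fun l => \1_G l * um l).
Proof.
apply: (@bmG _ (t ^- 2)) => //; first by rewrite invr_ge0 sqr_ge0.
by move=> l Gl; rewrite ger0_norm// Gum.
Qed.

Let H_setT : H setT <= h * t ^+ 2. Proof. exact: (hell_le hell). Qed.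

Let setTE (P' : probability T R) (f : T -> R) :
  \int[P']_x (\1_[set: T] x * f x) = \int[P']_x f x.
Proof. by apply: Rint_eq => x; rewrite indicE in_setT mul1r. Qed.

Let PGum : \int[P]_x (iG x * um (V x)) <= mean_sqr_sum.
Proof.
apply: Rint_le => //; first by apply: L1_bm.
by move=> x; rewrite ler_piMl// /iG indicE; case: (_ \in _).
Qed.

(** The level in [low] is matched to this bound: the integrand is at most [t ^- 2], so the Hellinger
    term of [hell_dom] is of order [t ^- 2 * t ^+ 2] and stays bounded as [t] tends to 0. *)
Let QGum : \int[Q]_x (iG x * um (V x)) <= 2 * h + 2 * mean_sqr_sum.
Proof.
have b01 x : 0 <= iG x * um (V x) <= t ^- 2.
  rewrite /iG indicE; case: (boolP (V x \in G)) => [/set_mem g|_].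
    by rewrite mul1r um0 Gum.
  by rewrite mul0r lexx invr_ge0 sqr_ge0.
have := hell_dom hell measurableT (bmV V biGumV) b01.
rewrite !setTE => hq; apply: (le_trans hq); apply: lerD; last first.
  by rewrite ler_wpM2l.
rewrite -mulrA ler_wpM2l//.
apply: (@le_trans _ _ (t ^- 2 * (h * t ^+ 2))).
  by rewrite ler_wpM2l// invr_ge0 sqr_ge0.
by rewrite mulrCA mulVf ?mulr1// sqrf_eq0.
Qed.

Let cKb0 : 0 <= Phi_cst. Proof. by rewrite mulr_ge0// !addr_ge0 ?sqr_ge0. Qed.

Let Phi_sqr (P' : probability T R) : L2 P' Y -> \int[P']_x Y x ^+ 2 <= MY ->
  \int[P']_x (iG x * um (V x)) <= 2 * h + 2 * mean_sqr_sum ->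
  \int[P']_x Phi x ^+ 2 <= Phi_bound ^+ 2.
Proof.
move=> LY' Y1 G1; have [_ LY2] := LY'.
have LG : L1 P' (fun x => iG x * um (V x)) by exact: (bm_L1 P' (bmV V biGumV)).
have Lc := L1_cst P' 1.
have z0 : 0 <= Phi_cst * (MY + 2 * h + 2 * mean_sqr_sum + 1).
  by rewrite mulr_ge0// !addr_ge0// mulr_ge0.
apply: (@le_trans _ _ (Phi_cst * (MY + 2 * h + 2 * mean_sqr_sum + 1))); last first.
  rewrite /Phi_bound; move: (Phi_cst * _) z0 => z z0; nra.
apply: (@le_trans _ _ (\int[P']_x (Phi_cst * (Y x ^+ 2 + iG x * um (V x) + 1)))).
  apply: Rint_le => //; first by case: (L2Phi LY').
  by apply: L1Z; apply: L1D => //; exact: L1D.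
rewrite RintZ; last by apply: L1D => //; exact: L1D.
rewrite RintD//; last exact: L1D.
rewrite RintD// Rint_cst ler_wpM2l//; lra.
Qed.

Let cb1 : 1 <= Phi_bound.
Proof. by rewrite lerDl mulr_ge0// !addr_ge0// mulr_ge0. Qed.

Let Phi_lin : `|\int[Q]_x Phi x - \int[P]_x Phi x - t * \int[P]_x (Phi x * s x)|
  <= Phi_bound * (h + 7) * e * `|t|.
Proof.
apply: (hell_linearization hell Ls r0 r1 (L2Phi LY) (L2Phi LYq) cb1 _ _ e01 w01 re tew).
- by apply: Phi_sqr => //; apply: (le_trans PGum); move: U0 h0; lra.
- exact: Phi_sqr.
- move=> D mD PD; have [c9 _ _ _] := c1_parts.
  have : \int[P]_x \1_D x <= small_cst * w ^+ 2.
    by apply: (le_trans PD); rewrite ler_peMl ?sqr_ge0//; lra.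
  by case/(split_UI mD).
Qed.

(** * Drift of the nuisance functions between [P] and [Q] *)

Let drho l := rhoq l - rho l.
Let dkappa l := kappaq l - kappa l.

Let mdrho : measurable_fun setT drho.
Proof. by apply: measurable_funB; [exact: mo_rho moQ|exact: mo_rho moP]. Qed.
Let mdkappa : measurable_fun setT dkappa.
Proof. by apply: measurable_funB; [exact: mo_kappa moQ|exact: mo_kappa moP]. Qed.

Let Gdrho l : G l -> `|drho l| <= 2 * M.
Proof.
by move=> [[[a _ _ _] [b _ _ _]] _]; apply: (le_trans (ler_normB _ _)); lra.
Qed.
Let Gdkappa l : G l -> `|dkappa l| <= 8 * M ^+ 2.
Proof.
by move=> [[[_ _ _ a] [_ _ _ b]] _]; apply: (le_trans (ler_normB _ _)); lra.
Qed.

Let tv (f : T -> R) c : measurable_fun setT f -> 0 <= c -> (forall x, `|f x| <= c) ->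
  `|\int[Q]_x f x - \int[P]_x f x| <= 2 * h * c * `|t|.
Proof. exact: (hell_tv hell). Qed.

Let ind_le (a : R) c x : 0 <= c -> (G (V x) -> `|a| <= c) ->
  `|\1_G (V x) * a| <= c.
Proof.
move=> c0 fc; rewrite indicE; case: (boolP (V x \in G)) => [/set_mem /fc|_].
  by rewrite mul1r.
by rewrite mul0r normr0.
Qed.

Let biGf (f : T' -> R) c : measurable_fun setT f -> 0 <= c ->
  (forall l, G l -> `|f l| <= c) -> bm (fun x => iG x * f (V x)).
Proof. by move=> mf c0 fc; exact: (bmV V (bmG mf c0 fc)). Qed.

Let M20 : 0 <= 2 * M. Proof. exact: mulr_ge0. Qed.
Let MM0 : 0 <= M ^+ 2. Proof. exact: sqr_ge0. Qed.

(** Tested against the sign of [drho] on [G], the variable [W - rho] has integral 0 under [P] and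
    the wanted L^1 norm under [Q]. It is bounded by [2 * M] there, so [hell_tv] applies. *)
Let Q_drho : \int[Q]_x (iG x * `|drho (V x)|) <= 4 * h * M * `|t|.
Proof.
have [sg [msg sg1 sgE]] := measurable_sign mdrho.
pose g l := \1_G l * sg l.
have bg : bm g by apply: (@bmG _ 1).
have oQ := mo_orth moQ (bm_meas bg) (LbV Q bg).
have oP := mo_orth moP (bm_meas bg) (LbV P bg).
pose F x := g (V x) * (W x - rho (V x)).
have F2 x : `|F x| <= 2 * M.
  rewrite /F /g -mulrA; apply: ind_le => // gx.
  rewrite normrM -[leRHS]mul1r; apply: ler_pM => //.
  by case: gx => [[[a _ _ _] _] _]; apply: (le_trans (ler_normB _ _)); have := WM x; lra.
have mF : measurable_fun setT F.
  apply: measurable_funM; first exact: mV (bm_meas bg).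
  by apply: measurable_funB => //; exact/mV/(mo_rho moP).
have bF : bm F by split => //; exists (2 * M).
have := tv mF M20 F2; rewrite [X in _ - X]oP subr0 => FQ.
have -> : \int[Q]_x (iG x * `|drho (V x)|) = \int[Q]_x F x.
  have LW' : L1 Q (fun x => g (V x) * (W x - rhoq (V x))).
    rewrite (_ : (fun x => _) = (fun x => sg (V x) * (iG x * (W x - rhoq (V x))))).
      apply: bm_L1; apply: bmM.
        by split; [exact: mV|exists 1].
      split; last by exists (2 * M).
      apply: measurable_funM; first exact: bm_meas biG.
      by apply: measurable_funB => //; exact/mV/(mo_rho moQ).
    by apply/funext => x; rewrite /g -/(iG x); ring.
  have := RintB (bm_L1 Q bF) LW'; rewrite oQ subr0 => <-.
  by apply: Rint_eq => x; rewrite -sgE /F /g -/(iG x) /drho; ring.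
by apply: le_trans (ler_norm _) _; apply: (le_trans FQ); lra.
Qed.

(** Passing from [Q] to [P] costs a second total variation bound, which doubles the constant;
    likewise in [P_dkappa]. *)
Let P_drho : \int[P]_x (iG x * `|drho (V x)|) <= 8 * h * M * `|t|.
Proof.
have b : bm (fun x => iG x * `|drho (V x)|).
  apply: (@biGf (fun l => `|drho l|) (2 * M)) => //; first exact: measurableT_comp.
  by move=> l /Gdrho; rewrite normr_id.
have b2 x : `|iG x * `|drho (V x)| | <= 2 * M.
  by apply: ind_le => // /Gdrho; rewrite normr_id.
have := tv (bm_meas b) M20 b2; rewrite ler_norml => /andP[h' _].
move: h' Q_drho; lra.
Qed.

(** The same test for [X * (W - rho) - kappa], bounded on [G] by [2 * M ^+ 2 + 4 * M ^+ 2]. Under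
    [Q] its weight is centred at [rho] instead of [rhoq]; [Q_drho] controls the correction [E].
    Hence 16 = 12 + 4. *)
Let Q_dkappa : \int[Q]_x (iG x * `|dkappa (V x)|) <= 16 * h * M ^+ 2 * `|t|.
Proof.
have [sg [msg sg1 sgE]] := measurable_sign mdkappa.
pose g l := \1_G l * sg l.
have bg : bm g by apply: (@bmG _ 1).
have kQ := mo_kappaE moQ bg.
have kP := mo_kappaE moP bg.
pose F x := g (V x) * (X x * (W x - rho (V x)) - kappa (V x)).
have F6 x : `|F x| <= 6 * M ^+ 2.
  rewrite /F /g -mulrA; apply: ind_le => // [|gx]; first by rewrite mulr_ge0.
  rewrite normrM -[leRHS]mul1r; apply: ler_pM => //.
  case: gx => [[[a _ _ k4] _] _].
  apply: (le_trans (ler_normB _ _)).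
  have : `|X x * (W x - rho (V x))| <= M * (2 * M).
    rewrite normrM; apply: ler_pM => //.
    by apply: (le_trans (ler_normB _ _)); have := WM x; lra.
  move: k4; rewrite (_ : M * (2 * M) = 2 * M ^+ 2); last by ring.
  lra.
have mWr (q : T' -> R) : measurable_fun setT q -> measurable_fun setT (fun x => W x - q (V x)).
  by move=> mq; apply: measurable_funB => //; exact: mV.
have mF : measurable_fun setT F.
  apply: measurable_funM; first exact: mV (bm_meas bg).
  apply: measurable_funB; last exact/mV/(mo_kappa moP).
  by apply: measurable_funM => //; exact: mWr (mo_rho moP).
have bF : bm F by split => //; exists (6 * M ^+ 2).
have bXr (q : T' -> R) : measurable_fun setT q -> (forall l, G l -> `|q l| <= M) ->
    bm (fun x => g (V x) * X x * (W x - q (V x))).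
  move=> mq qM; split.
    apply: measurable_funM; last exact: mWr.
    by apply: measurable_funM => //; exact: mV (bm_meas bg).
  exists (1 * (M * (2 * M))) => x.
  rewrite /g (_ : \1_G _ * _ * _ * _ = iG x * (sg (V x) * (X x * (W x - q (V x)))));
    last by rewrite /iG; ring.
  apply: ind_le => [|gx]; first by rewrite mul1r !mulr_ge0.
  rewrite normrM; apply: ler_pM => //; rewrite normrM; apply: ler_pM => //.
  by apply: (le_trans (ler_normB _ _)); have := WM x; have := qM _ gx; lra.
have bk (k : T' -> R) : measurable_fun setT k -> (forall l, G l -> `|k l| <= 4 * M ^+ 2) ->
    bm (fun x => g (V x) * k (V x)).
  move=> mk k4; split; first by apply: measurable_funM; [exact: mV (bm_meas bg)|exact: mV].
  exists (4 * M ^+ 2) => x; rewrite /g -mulrA; apply: ind_le => [|gx].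
    by rewrite mulr_ge0.
  by rewrite normrM -[leRHS]mul1r; apply: ler_pM => //; exact: k4.
have bkP := bk _ (mo_kappa moP) (fun l gl => let: conj (conj (And4 _ _ _ a) _) _ := gl in a).
have bkQ := bk _ (mo_kappa moQ) (fun l gl => let: conj (conj _ (And4 _ _ _ a)) _ := gl in a).
have bXP := bXr _ (mo_rho moP) (fun l gl => let: conj (conj (And4 a _ _ _) _) _ := gl in a).
have bXQ := bXr _ (mo_rho moQ) (fun l gl => let: conj (conj _ (And4 a _ _ _)) _ := gl in a).
have FP0 : \int[P]_x F x = 0.
  have := RintB (bm_L1 P bXP) (bm_L1 P bkP); rewrite kP subrr => <-.
  by apply: Rint_eq => x; rewrite /F; ring.
have := tv mF (mulr_ge0 (ler0n _ 6) MM0) F6; rewrite FP0 subr0 => FQ.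
pose E x := g (V x) * X x * drho (V x).
have bdr : bm (fun x => iG x * `|drho (V x)|).
  apply: (@biGf (fun l => `|drho l|) (2 * M)) => //; first exact: measurableT_comp.
  by move=> l /Gdrho; rewrite normr_id.
have Ele x : `|E x| <= M * (iG x * `|drho (V x)|).
  rewrite /E /g (_ : \1_G _ * _ * _ * _ = sg (V x) * X x * (iG x * drho (V x)));
    last by rewrite /iG; ring.
  rewrite normrM [`|iG x * _|]normrM [`|iG x|]ger0_norm; last by rewrite /iG indicE.
  apply: ler_pM => //; first by rewrite mulr_ge0// /iG indicE.
  by rewrite normrM -[leRHS]mul1r; apply: ler_pM.
have mE : measurable_fun setT E.
  apply: measurable_funM; last exact: mV.
  by apply: measurable_funM => //; exact: mV (bm_meas bg).
have LE : L1 Q E.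
  apply: (L1_le mE _ (L1Z M (bm_L1 Q bdr))) => x.
  by apply: (le_trans (Ele x)); exact: ler_norm.
have EQ : `|\int[Q]_x E x| <= M * (4 * h * M * `|t|).
  apply: (le_trans (Rint_abs LE)).
  apply: (@le_trans _ _ (\int[Q]_x (M * (iG x * `|drho (V x)|)))).
    apply: Rint_le => //; first exact: L1_abs.
    by apply: L1Z; exact: bm_L1.
  by rewrite RintZ ?ler_wpM2l//; exact: bm_L1.
have -> : \int[Q]_x (iG x * `|dkappa (V x)|) = \int[Q]_x F x - \int[Q]_x E x.
  transitivity (\int[Q]_x (g (V x) * kappaq (V x)) - \int[Q]_x (g (V x) * kappa (V x))).
    rewrite -RintB; [|exact: bm_L1|exact: bm_L1].
    by apply: Rint_eq => x; rewrite -sgE /g -/(iG x) /dkappa; ring.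
  rewrite -kQ -RintB; [|exact: bm_L1|exact: bm_L1].
  rewrite -RintB//; last exact: bm_L1.
  by apply: Rint_eq => x; rewrite /F /E /drho; ring.
apply: (le_trans (ler_norm _)); apply: (le_trans (ler_normB _ _)).
rewrite (_ : 16 * _ * _ * _ = 2 * h * (6 * M ^+ 2) * `|t| + M * (4 * h * M * `|t|)); last by ring.
exact: lerD.
Qed.

Let P_dkappa : \int[P]_x (iG x * `|dkappa (V x)|) <= 32 * h * M ^+ 2 * `|t|.
Proof.
have M80 : 0 <= 8 * M ^+ 2 by rewrite mulr_ge0.
have b : bm (fun x => iG x * `|dkappa (V x)|).
  apply: (@biGf (fun l => `|dkappa l|) (8 * M ^+ 2)) => //; first exact: measurableT_comp.
  by move=> l /Gdkappa; rewrite normr_id.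
have b2 x : `|iG x * `|dkappa (V x)| | <= 8 * M ^+ 2.
  by apply: ind_le => // /Gdkappa; rewrite normr_id.
have := tv (bm_meas b) M80 b2; rewrite ler_norml => /andP[h' _].
move: h' Q_dkappa.
rewrite (_ : 2 * h * (8 * M ^+ 2) * `|t| = 16 * h * M ^+ 2 * `|t|); last by ring.
lra.
Qed.

(** The error of weighting with the nuisances of [Q] instead of those of [P]: off [B], the
    difference of [Phi] and the influence function is [zeta] times the residual. *)
Let zeta x := iG x * ((W x - rhoq (V x)) / kappaq (V x) - (W x - rho (V x)) / kappa (V x)).

Let mzeta : measurable_fun setT zeta.
Proof.
apply: measurable_funM; first exact: bm_meas biG.
apply: measurable_funB; apply: measurable_funM.
- by apply: measurable_funB => //; exact/mV/(mo_rho moQ).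
- by apply: measurable_inv; exact/mV/(mo_kappa moQ).
- by apply: measurable_funB => //; exact/mV/(mo_rho moP).
- by apply: measurable_inv; exact/mV/(mo_kappa moP).
Qed.

Let cc2 : 0 <= 2 * ratio_cst. Proof. exact: mulr_ge0. Qed.

Let zeta_le x : `|zeta x| <= 2 * ratio_cst.
Proof.
apply: ind_le => // g; apply: (le_trans (ler_normB _ _)).
have [[g1 g2] _] := g.
have := @good_ratio_le _ _ _ _ _ V W M eps WM eps0 _ _ _ x g1.
have := @good_ratio_le _ _ _ _ _ V W M eps WM eps0 _ _ _ x g2.
rewrite /ratio_cst; lra.
Qed.

(** An error in the numerator is divided by one denominator, an error in the denominator by the
    product of both. *)
Let zeta_pt x : `|zeta x| <= eps^-1 * (iG x * `|drho (V x)|)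
  + 2 * M / eps ^+ 2 * (iG x * `|dkappa (V x)|).
Proof.
rewrite /zeta normrM [`|iG x|]ger0_norm; last by rewrite /iG indicE.
rewrite !(mulrCA _ (iG x)) -mulrDr; rewrite /iG indicE.
case: (boolP (V x \in G)) => [/set_mem [[g1 g2] _]|_]; last by rewrite !mul0r.
rewrite !mul1r.
have [a1 _ k1 _] := g1; have [_ _ k2 _] := g2.
have k10 : kappa (V x) != 0 by rewrite -normr_gt0 (lt_le_trans eps0).
have k20 : kappaq (V x) != 0 by rewrite -normr_gt0 (lt_le_trans eps0).
rewrite (_ : _ - _ = - (drho (V x) / kappaq (V x)) -
  (W x - rho (V x)) * dkappa (V x) * ((kappa (V x))^-1 * (kappaq (V x))^-1)); last first.
  by rewrite /drho /dkappa; field; rewrite k10 k20.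
have i1 : `|(kappa (V x))^-1| <= eps^-1.
  by rewrite normfV lef_pV2// posrE// (lt_le_trans eps0).
have i2 : `|(kappaq (V x))^-1| <= eps^-1.
  by rewrite normfV lef_pV2// posrE// (lt_le_trans eps0).
apply: (le_trans (ler_normB _ _)); apply: lerD.
  by rewrite normrN normrM mulrC ler_wpM2r.
rewrite (_ : 2 * M / _ * _ = 2 * M * `|dkappa (V x)| * (eps^-1 * eps^-1)).
  rewrite 2!normrM; apply: ler_pM => //.
    rewrite ler_wpM2r//; apply: (le_trans (ler_normB _ _)); have := WM x; lra.
  by rewrite normrM; apply: ler_pM.
by rewrite -expr2 exprVn; ring.
Qed.

Let bzeta : bm zeta. Proof. by split => //; exists (2 * ratio_cst). Qed.

Let P_zeta : \int[P]_x `|zeta x| <= zeta_cst * `|t|.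
Proof.
have b1 : L1 P (fun x => iG x * `|drho (V x)|).
  apply: bm_L1; apply: (@biGf (fun l => `|drho l|) (2 * M)) => //.
    exact: measurableT_comp.
  by move=> l /Gdrho; rewrite normr_id.
have b2 : L1 P (fun x => iG x * `|dkappa (V x)|).
  apply: bm_L1; apply: (@biGf (fun l => `|dkappa l|) (8 * M ^+ 2)) => //.
  - exact: measurableT_comp.
  - exact: mulr_ge0.
  - by move=> l /Gdkappa; rewrite normr_id.
apply: (@le_trans _ _ (\int[P]_x (eps^-1 * (iG x * `|drho (V x)|)
  + 2 * M / eps ^+ 2 * (iG x * `|dkappa (V x)|)))).
  apply: Rint_le => //; first by apply: L1_abs; exact: bm_L1.
  by apply: L1D; exact: L1Z.
rewrite RintD; [|exact: L1Z..].
rewrite !RintZ//.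
apply: (@le_trans _ _ (eps^-1 * (8 * h * M * `|t|) +
   2 * M / eps ^+ 2 * (32 * h * M ^+ 2 * `|t|))).
  apply: lerD; first by rewrite ler_wpM2l// invr_ge0 ltW.
  by rewrite ler_wpM2l// mulr_ge0// invr_ge0 sqr_ge0.
by rewrite le_eqVlt; apply/orP; left; apply/eqP; rewrite /zeta_cst; ring.
Qed.

Let Dz := [set x | e < `|zeta x|].

Let mDz : measurable Dz.
Proof.
have mz : measurable_fun setT (fun x => `|zeta x|) by exact: measurableT_comp.
have := mz measurableT `]e, +oo[%classic (measurable_itv _); rewrite setTI.
by rewrite (_ : _ @^-1` _ = Dz)//; apply/seteqP; split => y; rewrite /Dz /= in_itv/= andbT.
Qed.

(** Markov at level [e] loses a factor [e^-1], which the [e ^+ 2] in the restriction on [t]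
    absorbs. *)
Let PDz : \int[P]_x \1_Dz x <= small_cst * w ^+ 2.
Proof.
have Lz : L1 P (fun x => `|zeta x|) by apply: L1_abs; exact: bm_L1.
have : \int[P]_x \1_Dz x <= e^-1 * \int[P]_x `|zeta x|.
  rewrite -RintZ//; apply: Rint_le; [exact: L1ind|exact: L1Z|].
  move=> x; rewrite indicE; case: (boolP (x \in Dz)) => [/set_mem|_].
    by rewrite /Dz /= ler_pdivlMl// mulr1 => /ltW.
  by rewrite mulr_ge0// invr_ge0 ltW.
move=> /le_trans; apply; have [_ _ _ hc] := c1_parts.
apply: (@le_trans _ _ (e^-1 * (zeta_cst * (e ^+ 2 * w ^+ 2)))).
  rewrite ler_wpM2l ?invr_ge0 ?(ltW e0)//.
  by apply: (le_trans P_zeta); rewrite ler_wpM2l.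
rewrite (_ : e^-1 * _ = zeta_cst * w ^+ 2 * e); last by field; rewrite gt_eqF.
apply: (@le_trans _ _ (zeta_cst * w ^+ 2)).
  by rewrite ler_piMr// mulr_ge0// sqr_ge0.
by rewrite ler_wpM2r// sqr_ge0.
Qed.

Let Lres : L2 P res. Proof. exact: (L2_residual mX XM LY moP). Qed.

Let ind_sqr (D : set T) x : (\1_D x) ^+ 2 = \1_D x :> R.
Proof. by rewrite indicE; case: (_ \in _); rewrite ?expr1n ?expr0n. Qed.

Let cs_small (f : T -> R) D c : L2 P f -> measurable D ->
  \int[P]_x \1_D x <= small_cst * w ^+ 2 -> 0 <= c -> \int[P]_x f x ^+ 2 <= c ^+ 2 ->
  `|\int[P]_x (f x * (\1_D x * s x))| <= c * e.
Proof.
move=> Lf mD PD c0 fc.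
have LDs : L2 P (fun x => \1_D x * s x) by apply: L2_bm => //; exact: bm_indic.
apply: ler_norm_sqr; first by rewrite mulr_ge0// ltW.
apply: le_trans (cauchy_schwarz Lf LDs) _.
rewrite exprMn; apply: ler_pM => //; [by apply: Rint_ge0 => x; exact: sqr_ge0..|].
have [sD _] := split_UI mD PD; apply: le_trans sD.
rewrite le_eqVlt; apply/orP; left; apply/eqP.
by apply: Rint_eq => x; rewrite exprMn ind_sqr.
Qed.

Let sq1 (f : T -> R) : \int[P]_x f x ^+ 2 <= (1 + \int[P]_x f x ^+ 2) ^+ 2.
Proof.
have : 0 <= \int[P]_x f x ^+ 2 by apply: Rint_ge0 => x; exact: sqr_ge0.
move: (\int[P]_x _) => z z0; nra.
Qed.

Let one_int (f : T -> R) : 0 <= 1 + \int[P]_x f x ^+ 2.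
Proof. by rewrite addr_ge0//; apply: Rint_ge0 => x; exact: sqr_ge0. Qed.

Let Lrs : L1 P (fun x => res x * s x). Proof. exact: L2L2. Qed.

(** [zeta] is O(t) in L^1, but [res * s] is merely integrable, so no rate is available for the
    product. Off [Dz] the factor [zeta] is at most [e]; on [Dz] it is bounded and the event carries
    little of [s ^+ 2]. *)
Let zeta_res : `|\int[P]_x (zeta x * (res x * s x))| <=
  (res_bound + h) * e + 2 * ratio_cst * res_bound * e.
Proof.
have Ls' := L2_abs Ls; have Lr' := L2_abs Lres.
have LDs : L2 P (fun x => \1_Dz x * `|s x|) by apply: L2_bm => //; exact: bm_indic.
have La : L1 P (fun x => e * `|res x * s x|) by apply: L1Z; exact: L1_abs.
have Lb := L2L2 Lr' LDs.
apply: (le_trans (Rint_abs (L1_bm bzeta Lrs))).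
apply: (@le_trans _ _ (\int[P]_x (e * `|res x * s x| +
    2 * ratio_cst * (`|res x| * (\1_Dz x * `|s x|))))).
  apply: Rint_le; [by apply: L1_abs; exact: L1_bm|by apply: L1D => //; exact: L1Z|].
  move=> x; rewrite normrM indicE; case: (boolP (x \in Dz)) => [_|/negP n].
    rewrite mul1r -[`|res x| * _]normrM; apply: (@le_trans _ _ (2 * ratio_cst * `|res x * s x|)).
      by rewrite ler_wpM2r.
    by rewrite lerDr mulr_ge0// ltW.
  rewrite mul0r !mulr0 addr0 ler_wpM2r// leNgt; apply/negP => ez.
  by apply: n; exact/mem_set.
rewrite RintD//; last exact: L1Z.
rewrite (RintZ _ Lb) RintZ; last exact: L1_abs.
apply: lerD.
  rewrite mulrC ler_wpM2r ?(ltW e0)//.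
  have [_ Lr2] := Lres; have [_ Ls2] := Ls.
  apply: (@le_trans _ _ (\int[P]_x (res x ^+ 2 + s x ^+ 2))).
    apply: Rint_le; [exact: L1_abs|exact: L1D|].
    by move=> x; rewrite ler_norml; apply/andP; split; nra.
  rewrite RintD// /res_bound; apply: lerD; first by rewrite lerDr.
  by rewrite /hell_cst lerDl.
rewrite -[leRHS]mulrA ler_wpM2l//.
(* [cs_small] has the absolute value outside the integral; moving the sign of [s] into the other
   factor brings it inside. *)
have [sg [msg sg1 sgE]] := measurable_sign (L2_meas Ls).
pose f x := `|res x| * sg x.
have mf : measurable_fun setT f.
  by apply: measurable_funM => //; exact: L2_meas Lr'.
have fres x : `|f x| <= `|res x|.
  by rewrite /f normrM normr_id ler_piMr.
have Lf : L2 P f by exact: (L2_le mf fres Lres).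
have f2 : \int[P]_x f x ^+ 2 <= res_bound ^+ 2.
  apply: (le_trans _ (sq1 res)); apply: Rint_le; [by case: Lf|by case: Lres|].
  by move=> x; exact: sqr_norm_le.
have := cs_small Lf mDz PDz (one_int res) f2.
move=> /(le_trans (ler_norm _)); apply: le_trans.
rewrite le_eqVlt; apply/orP; left; apply/eqP; apply: Rint_eq => x.
by rewrite /f -sgE; ring.
Qed.

Let Lphi : L2 P phi. Proof. exact: (L2_influence mW WM mX XM eps0 LY moP). Qed.

Let Phi_phi : `|\int[P]_x (Phi x * s x) - \int[P]_x (phi x * s x)| <=
  (phi_bound + (res_bound + h) + 2 * ratio_cst * res_bound) * e.
Proof.
have L1a := L2L2 (L2Phi LY) Ls; have L1b := L2L2 Lphi Ls.
have Lz := L1_bm bzeta Lrs.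
have LBs : L2 P (fun x => \1_B x * s x) by apply: L2_bm => //; exact: bm_indic.
have L1c := L2L2 Lphi LBs.
rewrite -RintB// (_ : \int[P]_x _ =
    \int[P]_x (zeta x * (res x * s x) - phi x * (\1_B x * s x))); last first.
  apply: Rint_eq => x; rewrite /Phi /zeta /gq -/(iG x) (_ : \1_B x = 1 - iG x); last first.
    by rewrite iGB; ring.
  rewrite /influence /iG indicE; case: (_ \in _); ring.
rewrite RintB//; apply: (le_trans (ler_normB _ _)).
have := cs_small Lphi mB PB' (one_int phi) (sq1 phi); rewrite -/phi_bound.
move: zeta_res; lra.
Qed.

Lemma psi_expansion : `|\int[Q]_x gammaq (V x) - psi0 - t * \int[P]_x (phi x * s x)|
  <= expansion_cst * e * `|t|.
Proof.
have d1 := psi_diff; have d2 := Phi_lin; have d3 := Phi_phi.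
have d4 : `|t * (\int[P]_x (Phi x * s x) - \int[P]_x (phi x * s x))| <=
    (phi_bound + (res_bound + h) + 2 * ratio_cst * res_bound) * e * `|t|.
  by rewrite normrM mulrC ler_wpM2r.
move: d1 d2 d4; set a := \int[Q]_x gammaq _; set b := _ - \int[P]_x Phi x.
set c := \int[P]_x (Phi x * _); set f := \int[P]_x (phi x * _) => d1 d2 d4.
rewrite (_ : _ - _ = (a - psi0 - b) + (b - t * c) + t * (c - f)); last by ring.
apply: (le_trans (ler_normD _ _)).
have := ler_normD (a - psi0 - b) (b - t * c).
rewrite /expansion_cst; move: d1 d2 d4; lra.
Qed.

End expansion.

(** * The derivative along a path *)

Section cond_exp_eq_measure.
Context {R : realType} {d d' : measure_display}
  {T : measurableType d} {T' : measurableType d'}.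
Variables (P Q : probability T R) (V : T -> T').
Hypothesis PQ : forall B, measurable B -> P B = Q B.

Let intE D (f : T -> \bar R) : (\int[P]_(x in D) f x = \int[Q]_(x in D) f x)%E.
Proof. by apply: eq_measure_integral => A mA _; exact: PQ. Qed.

(** Both laws define the same predicate, so [xget] returns the same version, equal at every point.
    It is applied to [Pt 0], which is given as equal to [P] on measurable sets only. *)
Lemma eq_measure_cond_exp X : cond_exp P V X = cond_exp Q V X.
Proof.
rewrite /cond_exp; congr xget; apply/funext => e; apply/propext.
rewrite /is_cond_exp; have i f : P.-integrable setT f = Q.-integrable setT f.
  by apply/idP/idP => /integrableP[mf h]; apply/integrableP; split=> //;
    move: h; rewrite intE.
rewrite i; split=> -[me ie eE]; split=> // B mB; have := eE B mB.
  by rewrite !intE.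
by rewrite !intE.
Qed.

Lemma eq_measure_cond_cov X W : cond_cov P V X W = cond_cov Q V X W.
Proof. by rewrite /cond_cov !eq_measure_cond_exp. Qed.

Lemma eq_measure_Rint (f : T -> R) : \int[P]_x f x = \int[Q]_x f x.
Proof. by rewrite /Rintegral intE. Qed.

End cond_exp_eq_measure.

Definition cond_ratio {R : realType} {d d' : measure_display}
    {T : measurableType d} {T' : measurableType d'} (V : T -> T')
    (W X Y : T -> R) (Q : probability T R) : R :=
  \int[Q]_x (cond_cov Q V Y W (V x) / cond_cov Q V X W (V x)).

Section derivative.
Context {R : realType} {d d' : measure_display}
  {T : measurableType d} {T' : measurableType d'}.
Variables (V : {mfun T >-> T'}) (W X Y : T -> R) (M eps : R).
Hypotheses (mW : measurable_fun setT W) (WM : forall x, `|W x| <= M).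
Hypotheses (mX : measurable_fun setT X) (XM : forall x, `|X x| <= M).
Hypotheses (M0 : 0 <= M) (eps0 : 0 < eps).
Variable P : probability T R.
Hypothesis LY : L2 P Y.
Hypothesis rel : {ae P, forall x, eps <= `|cond_cov P V X W (V x)|}.

Local Notation phi := (influence V W X Y P (cond_exp P V W) (cond_exp P V X)
  (cond_exp P V Y) (cond_cov P V X W)
  (fun l => cond_cov P V Y W l / cond_cov P V X W l)).

Variables (Pt : R -> probability T R) (s : T -> R).
Hypothesis Pt0 : forall B, measurable B -> Pt 0 B = P B.
Hypothesis Ls : L2 P s.
Hypothesis qmd : qmd_at0 Pt s.
Hypothesis momY : exists MY : R, \forall t \near (0 : R),
  (\int[Pt t]_x ((Y x) ^+ 2)%:E <= MY%:E)%E.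
Hypothesis relt : exists2 eps' : R, 0 < eps' & \forall t \near (0 : R),
  {ae Pt t, forall x, eps' <= `|cond_cov (Pt t) V X W (V x)|}.

Lemma is_derive_cond_ratio :
  is_derive (0 : R) (1 : R) (fun t => cond_ratio V W X Y (Pt t))
    (\int[P]_x (phi x * s x)).
Proof.
have mY := L2_meas LY; have [_ LY2] := LY.
have [eps' eps'0 relt'] := relt.
(* A single relevance constant for [P] and for the laws of the path near it. *)
pose ep := Num.min eps eps'.
have ep0 : 0 < ep by rewrite lt_min eps0 eps'0.
have relP : {ae P, forall x, ep <= `|cond_cov P V X W (V x)|}.
  by apply: filterS rel => x; apply: le_trans; rewrite ge_min lexx.
have [MY0 momY0] := momY.
pose MY := Num.max MY0 (\int[P]_x Y x ^+ 2).
have YM : \int[P]_x Y x ^+ 2 <= MY by rewrite le_max lexx orbT.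
have [mu [p [pE cvg0]]] := qmd.
have moP := cond_moments mW WM mX XM LY ep0 relP.
set rho := cond_exp P V W in moP *.
set delta := cond_exp P V X in moP *.
set eta := cond_exp P V Y in moP *.
set kappa := cond_cov P V X W in moP *.
set nu := cond_cov P V Y W in moP *.
pose gamma l := nu l / kappa l.
rewrite -/gamma in moP *.
set phi0 := influence _ _ _ _ _ _ _ _ _ _.
have psi0E : cond_ratio V W X Y (Pt 0) = mean_ratio V P gamma.
  rewrite /cond_ratio (eq_measure_cond_cov V Pt0) (eq_measure_cond_cov V Pt0).
  exact: (eq_measure_Rint Pt0).
set D := \int[P]_x (phi0 x * s x).
set C := expansion_cst V W X Y M ep MY P rho delta eta kappa gamma s.
have [_ Ls2] := Ls.
pose um := sqr_sum eta gamma.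
have Lum : L1 P (fun x => um (V x)).
  by apply: L1D; [case: (mo_L2eta moP)|case: (mo_L2gamma moP)].
have Lsum : L1 P (fun x => s x ^+ 2 + um (V x)) by exact: L1D.
have sum0 x : 0 <= s x ^+ 2 + um (V x) by rewrite !addr_ge0 ?sqr_ge0.
pose c := small_cst V M ep P eta gamma s.
have c0 : 0 < c.
  have h1 := hell_cst_ge1 P s.
  have U0 : 0 <= mean_sqr_sum V P eta gamma by apply: Rint_ge0 => x; rewrite addr_ge0 ?sqr_ge0.
  have cz0 : 0 <= zeta_cst M ep P s.
    by rewrite addr_ge0// !mulr_ge0 ?invr_ge0 ?sqr_ge0 ?exprn_ge0 ?(ltW ep0) ?(le_trans ler01 h1)//.
  rewrite /c /small_cst; lra.
have key : (fun t => t^-1 *: (cond_ratio V W X Y (Pt (t *: 1 + 0)) -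
    cond_ratio V W X Y (Pt 0))) @ (0 : R)^' --> D.
  apply/cvgrPdist_le => z z0.
  (* [C] is free of [t], [e] and [w], so this choice brings [C * e] below the prescribed [z]; the 1
     keeps the denominator positive. *)
  pose e := Num.min 1 (z / (`|C| + 1)).
  have C10 : 0 < `|C| + 1 by rewrite ltr_wpDl.
  have e0 : 0 < e by rewrite lt_min ltr01 divr_gt0.
  have e1 : e <= 1 by rewrite ge_min lexx.
  have Ce : C * e <= z.
    have ez : (`|C| + 1) * e <= z.
      by rewrite -ler_pdivlMl// mulrC ge_min lexx orbT.
    apply: le_trans ez; rewrite ler_wpM2r ?(ltW e0)//.
    by have := ler_norm C; lra.
  have e20 : 0 < e ^+ 2 by exact: exprn_gt0.
  (* Absolute continuity of the integral of one function under [P] alone, hence uniform in [t]. *)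
  have [dl [dl0 UI]] := integral_normr_continuous Lsum e20.
  pose w := Num.min 1 (dl / (2 * c)).
  have w0 : 0 < w by rewrite lt_min ltr01 divr_gt0// mulr_gt0.
  have w1 : w <= 1 by rewrite ge_min lexx.
  have wdl : c * w ^+ 2 < dl.
    apply: (@le_lt_trans _ _ (dl / 2)); last by lra.
    have : c * w <= dl / 2.
      rewrite -ler_pdivlMl// ge_min; apply/orP; right.
      by rewrite invfM; lra.
    by apply: le_trans; rewrite ler_wpM2l ?(ltW c0)// expr2 ler_piMr// ltW.
  have UI' A : measurable A -> \int[P]_x \1_A x <= c * w ^+ 2 ->
      \int[P]_x (\1_A x * (s x ^+ 2 + um (V x))) <= e ^+ 2.
    move=> mA PA; have PAE : \int[P]_x \1_A x = fine (P A).
      by rewrite /Rintegral integral_indic// setIT.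
    have PAd : (P A < dl%:E)%E.
      rewrite -[P A]fineK ?fin_num_measure// lte_fin -PAE.
      exact: le_lt_trans PA wdl.
    apply: ltW; apply: le_lt_trans (UI _ mA PAd).
    rewrite le_eqVlt; apply/orP; left; apply/eqP.
    rewrite [RHS]Rintegral_mkcond; apply: Rint_eq => x.
    rewrite patchE indicE ger0_norm//.
    by case: (_ \in _); rewrite ?mul1r ?mul0r.
  (* The remainder in quadratic mean tends to 0, so [e] itself serves as the bound [r]. *)
  have r2 : \forall t \near (0 : R)^',
     (\int[mu]_x (((Num.sqrt (p t x) - Num.sqrt (p 0 x)) / t
          - s x * Num.sqrt (p 0 x) / 2) ^+ 2)%:E <= (e ^+ 2)%:E)%E.
    apply: (cvg0 [set y | (y <= (e ^+ 2)%:E)%E]); apply/nbhs_EFin.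
    by near do rewrite /= lee_fin; exact: nbhs0_ltW.
  have [mp0 p00 Pt0E] := nbhs_singleton pE.
  near=> t.
  have t0 : t != 0 by near: t; exact: nbhs_dnbhs_neq.
  have [mpt pt0 PtE] : [/\ measurable_fun setT (p t), forall x, 0 <= p t x &
           forall B, measurable B -> Pt t B = (\int[mu]_(x in B) (p t x)%:E)%E].
    by near: t; exact: nbhs_dnbhs.
  have rt : (\int[mu]_x (((Num.sqrt (p t x) - Num.sqrt (p 0 x)) / t
          - s x * Num.sqrt (p 0 x) / 2) ^+ 2)%:E <= (e ^+ 2)%:E)%E.
    by near: t.
  have PE B : measurable B -> P B = (\int[mu]_(x in B) (p 0 x)%:E)%E.
    by move=> mB; rewrite -Pt0// Pt0E.
  have hell := hellinger_boundsP mp0 p00 PE mpt pt0 PtE Ls t0 (ltW e0) rt.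
  have Yt : (\int[Pt t]_x ((Y x) ^+ 2)%:E <= MY0%:E)%E.
    by near: t; exact: nbhs_dnbhs.
  have LYt : L2 (Pt t) Y.
    split=> //; apply/integrableP; split.
      by apply/measurable_EFinP; exact: measurable_funX.
    rewrite (eq_integral (fun x => (Y x ^+ 2)%:E)) => [|x _]; last first.
      by rewrite /= ger0_norm ?sqr_ge0.
    exact: le_lt_trans Yt (ltry _).
  have YMt : \int[Pt t]_x Y x ^+ 2 <= MY.
    rewrite le_max -lee_fin -EFin_Rint; last by case: LYt.
    by rewrite Yt.
  have relQ : {ae Pt t, forall x, ep <= `|cond_cov (Pt t) V X W (V x)|}.
    have h' : {ae Pt t, forall x, eps' <= `|cond_cov (Pt t) V X W (V x)|}.
      by near: t; exact: nbhs_dnbhs.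
    by apply: filterS h' => x; apply: le_trans; rewrite ge_min lexx orbT.
  have moQ := cond_moments mW WM mX XM LYt ep0 relQ.
  have tew : `|t| <= e ^+ 2 * w ^+ 2.
    by near: t; apply: dnbhs0_le; rewrite mulr_gt0// exprn_gt0.
  have e01 : 0 < e <= 1 by rewrite e0 e1.
  have w01 : 0 < w <= 1 by rewrite w0 w1.
  have := psi_expansion mW WM mX XM M0 ep0 LY YM moP Ls LYt YMt moQ hell t0
    (ltW e0) (lexx e) e01 w01 tew UI'.
  rewrite -/phi0 -/D -/C => exp_t.
  rewrite psi0E /GRing.scale /= mulr1 addr0.
  rewrite distrC.
  rewrite (_ : t^-1 * _ - D = t^-1 * (cond_ratio V W X Y (Pt t) - mean_ratio V P gamma - t * D)).
    rewrite normrM normfV mulrC ler_pdivrMr ?normr_gt0//.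
    apply: (le_trans exp_t); rewrite ler_wpM2r//.
  by field.
have -> : D = 'D_1 (fun t => cond_ratio V W X Y (Pt t)) 0.
  by apply/esym/cvg_lim.
by apply: DeriveDef => //; apply/cvg_ex; exists D.
Unshelve. all: by end_near.
Qed.

End derivative.

(** * Submodels with bounded score *)

Section tilted_law.
Context {R : realType} {d : measure_display} {T : measurableType d}.
Variables (P : probability T R) (g : T -> R).
Hypotheses (g0 : forall x, 0 <= g x) (Lg : L1 P g) (g1 : \int[P]_x g x = 1).

(** The proof that the mass is 1 is an argument so that the term can carry a probability
    structure. *)
Definition tilted of \int[P]_x g x = 1 := weighted g0 Lg.

HB.instance Definition _ := Measure.copy (tilted g1) (weighted g0 Lg).

Let tilted_setT : tilted g1 setT = 1%E.
Proof. by rewrite /tilted /weighted EFin_Rint// g1. Qed.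

HB.instance Definition _ :=
  Measure_isProbability.Build _ _ _ (tilted g1) tilted_setT.

Lemma tilted_probability : exists Q : probability T R,
  forall B, measurable B -> (Q B = \int[P]_(x in B) (g x)%:E)%E.
Proof. by exists (tilted g1). Qed.

End tilted_law.

(* Under a law Q with density 1 + k relative to P and |k| <= b, the weak form of
   conditional expectation bounds the change of every conditional moment by a
   multiple of b, almost surely. *)
Section bounded_tilt.
Context {R : realType} {d d' : measure_display}
  {T : measurableType d} {T' : measurableType d'}.
Variables (V : {mfun T >-> T'}) (W X : T -> R) (M b : R).
Hypotheses (mW : measurable_fun setT W) (WM : forall x, `|W x| <= M).
Hypotheses (mX : measurable_fun setT X) (XM : forall x, `|X x| <= M).
Hypothesis M0 : 0 <= M.
Variables (P Q : probability T R) (k : T -> R).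
Hypotheses (mk : measurable_fun setT k) (kb : forall x, `|k x| <= b) (b2 : b <= 2^-1).
Hypothesis QE : forall B, measurable B -> (Q B = \int[P]_(x in B) (1 + k x)%:E)%E.

Let q x := 1 + k x.

Let q_bounds x : 2^-1 <= q x <= 2.
Proof. by have := kb x; rewrite /q ler_norml => /andP[? ?]; apply/andP; split; move: b2; lra. Qed.

Let q0 x : 0 <= q x. Proof. by have /andP[h _] := q_bounds x; apply: le_trans h. Qed.

Let mq : measurable_fun setT q. Proof. exact: measurable_funD. Qed.

Let bk : bm k. Proof. by split => //; exists b. Qed.
Let bq : bm q. Proof. by apply: bmD => //; exact: bm_cst. Qed.

Lemma tilt_L1 f : L1 P f -> L1 Q f.
Proof.
move=> Lf; have mf := L1_meas Lf.
apply/integrableP; split; first exact/measurable_EFinP.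
rewrite (ge0_integral_density mq q0 QE)//; last exact: measurableT_comp.
have /integrableP[_] := L1_bm bq Lf.
apply: le_lt_trans; rewrite le_eqVlt; apply/orP; left; apply/eqP.
by apply: eq_integral => x _; rewrite /= normrM [`|q x|]ger0_norm// mulrC.
Qed.

Lemma tilt_L2 f : L2 P f -> L2 Q f.
Proof. by move=> [mf Lf]; split => //; exact: tilt_L1. Qed.

Lemma tilt_Rint f : L1 P f -> \int[Q]_x f x = \int[P]_x f x + \int[P]_x (f x * k x).
Proof.
move=> Lf; rewrite (Rint_density mq q0 QE); last exact: tilt_L1.
have Lfk : L1 P (fun x => f x * k x).
  by apply: L1_ext (L1_bm bk Lf) => x; rewrite mulrC.
by rewrite -RintD//; apply: Rint_eq => x; rewrite /q; ring.
Qed.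

Lemma tilt_ae A : {ae P, forall x, A x} -> {ae Q, forall x, A x}.
Proof.
move=> [N [mN PN AN]]; exists N; split => //; rewrite QE//.
apply: null_set_integral => //.
by apply/measurable_funTS/measurable_EFinP.
Qed.

Lemma tilt_Rint_le f : L1 P f -> (forall x, 0 <= f x) ->
  \int[P]_x f x <= 2 * \int[Q]_x f x.
Proof.
move=> Lf f0; rewrite (Rint_density mq q0 QE); last exact: tilt_L1.
have Lfq : L1 P (fun x => f x * q x).
  by apply: L1_ext (L1_bm bq Lf) => x; rewrite mulrC.
rewrite -RintZ//; apply: Rint_le => //; first exact: L1Z.
move=> x; have /andP[h1 h2] := q_bounds x; have := f0 x; nra.
Qed.

Lemma tilt_sqr_le f : L2 P f -> \int[Q]_x f x ^+ 2 <= 2 * \int[P]_x f x ^+ 2.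
Proof.
move=> [mf Lf]; rewrite (Rint_density mq q0 QE); last exact: tilt_L1.
rewrite -RintZ//; apply: Rint_le; [|exact: L1Z|].
  by apply: L1_ext (L1_bm bq Lf) => x; rewrite mulrC.
move=> x; have /andP[h1 h2] := q_bounds x; rewrite mulrC.
by rewrite ler_wpM2r ?sqr_ge0.
Qed.

Variables (rho delta kappa rhoq deltaq kappaq : T' -> R).
Hypotheses (cW : is_cond_exp P V W rho) (cX : is_cond_exp P V X delta).
Hypothesis cK : is_cond_exp P V
  (fun x => (X x - delta (V x)) * (W x - rho (V x))) kappa.
Hypotheses (cWq : is_cond_exp Q V W rhoq) (cXq : is_cond_exp Q V X deltaq).
Hypothesis cKq : is_cond_exp Q V
  (fun x => (X x - deltaq (V x)) * (W x - rhoq (V x))) kappaq.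

(** A space carrying a probability is nonempty, so some value of |k| lies below [b]. *)
Let b0 : 0 <= b.
Proof.
apply: contrapT => /negP; rewrite -ltNge => b0.
have := Rint_cst P 1; rewrite (_ : (fun=> 1) = (fun=> 0)); last first.
  by apply/funext => x; have := le_trans (normr_ge0 (k x)) (kb x); rewrite leNgt b0.
by rewrite Rint_cst => /eqP; rewrite eq_sym oner_eq0.
Qed.

Let bW : bm W. Proof. by split => //; exists M. Qed.
Let bX : bm X. Proof. by split => //; exists M. Qed.
Let LW : L2 P W. Proof. exact: bm_L2. Qed.
Let LX : L2 P X. Proof. exact: bm_L2. Qed.
Let LWq : L2 Q W. Proof. exact: bm_L2. Qed.
Let Lrho : L2 P (rho \o V). Proof. by case: (cond_exp_L2 cW LW). Qed.
Let Lrhoq : L2 Q (rhoq \o V). Proof. by case: (cond_exp_L2 cWq LWq). Qed.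
Let LrhoQ : L2 Q (rho \o V). Proof. exact: tilt_L2. Qed.
Let Lkappa : L2 P (kappa \o V). Proof. exact: (L2_kappa mW WM mX XM cW cX cK). Qed.
Let LkappaQ : L2 Q (kappa \o V). Proof. exact: tilt_L2. Qed.
Let Lkappaq : L2 Q (kappaq \o V). Proof. exact: (L2_kappa mW WM mX XM cWq cXq cKq). Qed.
Let mrho : measurable_fun setT rho. Proof. by case: cW. Qed.
Let mrhoq : measurable_fun setT rhoq. Proof. by case: cWq. Qed.
Let mkappa : measurable_fun setT kappa. Proof. by case: cK. Qed.
Let mkappaq : measurable_fun setT kappaq. Proof. by case: cKq. Qed.

Let rho_M : {ae P, forall x, `|rho (V x)| <= M}.
Proof. exact: (rho_le mW WM cW). Qed.

Let mV f : measurable_fun setT f -> measurable_fun setT (fun x => f (V x) : R).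
Proof. by move=> mf; exact: (measurableT_comp mf (measurable_funPT V)). Qed.

(* F is conditionally centred under P, so only the perturbation k survives. *)
Let tilt_centred F c (sg : T' -> R) B : L1 P F -> 0 <= c ->
  {ae P, forall x, `|F x| <= c} ->
  measurable_fun setT sg -> (forall l, `|sg l| <= 1) -> measurable B ->
  \int[P]_x (\1_B (V x) * sg (V x) * F x) = 0 ->
  \int[Q]_x (\1_B (V x) * sg (V x) * F x) <= 2 * c * b * \int[Q]_x \1_B (V x).
Proof.
move=> LF c0 Fc msg sg1 mB F0.
have biB : bm (fun x => \1_B (V x) : R) by apply: (bmV V); exact: bm_indic.
have bsg : bm (fun x => \1_B (V x) * sg (V x)).
  by apply: bmM => //; split; [exact: mV|exists 1].
have LBF := L1_bm bsg LF.
rewrite tilt_Rint// F0 add0r.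
have LBFk : L1 P (fun x => \1_B (V x) * sg (V x) * F x * k x).
  by apply: L1_ext (L1_bm bk LBF) => x; rewrite mulrC.
apply: (@le_trans _ _ (\int[P]_x (c * b * \1_B (V x)))).
  apply: Rint_ae_le => //; first by apply: L1Z; exact: bm_L1.
  apply: filterS Fc => x Fx; apply: (le_trans (ler_norm _)).
  rewrite -!mulrA normrM ger0_norm ?indicE// mulrC [leRHS]mulrA.
  rewrite ler_wpM2r// normrM -[leRHS]mul1r.
  by apply: ler_pM => //; rewrite normrM; apply: ler_pM.
rewrite RintZ; last exact: bm_L1.
(* The factor 2 pays for returning from [P] to [Q], whose density is at least one half. *)
rewrite (_ : 2 * c * b * _ = c * b * (2 * \int[Q]_x \1_B (V x))); last by ring.
rewrite ler_wpM2l ?mulr_ge0//; apply: tilt_Rint_le => //; first exact: bm_L1.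
Qed.

(** With [B] arbitrary, the L^1 bound obtained from the sign localizes and becomes an almost sure
    bound. *)
Let ae_of_weak (f : T' -> R) c : measurable_fun setT f -> L2 Q (f \o V) ->
  (forall (sg : T' -> R) B, measurable_fun setT sg -> (forall l, `|sg l| <= 1) -> measurable B ->
    (forall l, sg l * f l = `|f l|) ->
    \int[Q]_x (\1_B (V x) * sg (V x) * f (V x)) <= c * \int[Q]_x \1_B (V x)) ->
  {ae Q, forall x, `|f (V x)| <= c}.
Proof.
move=> mf Lf weak; have [sg [msg sg1 sgE]] := measurable_sign mf.
have Lf1 := L1_abs (L2_L1 Lf).
suff : {ae Q, forall x, `|f (V x)| - c <= 0}.
  by apply: filterS => x; rewrite subr_le0.
have mnf : measurable_fun setT (fun l => `|f l| - c).
  by apply: measurable_funB => //; exact: measurableT_comp.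
apply: (ae_le0_comp mnf); first by apply: L1B => //; exact: L1_cst.
move=> B mB.
have biB : bm (fun x => \1_B (V x) : R) by apply: (bmV V); exact: bm_indic.
rewrite (_ : \int[Q]_x _ = \int[Q]_x (\1_B (V x) * `|f (V x)| - c * \1_B (V x))).
  rewrite RintB; [|exact: (L1_bm biB)|by apply: L1Z; exact: bm_L1].
  rewrite RintZ; last exact: bm_L1.
  rewrite subr_le0; apply: le_trans (weak _ _ msg sg1 mB sgE).
  rewrite le_eqVlt; apply/orP; left; apply/eqP.
  by apply: Rint_eq => x; rewrite -mulrA sgE.
by apply: Rint_eq => x; ring.
Qed.

Let drho_le : {ae Q, forall x, `|rhoq (V x) - rho (V x)| <= 4 * M * b}.
Proof.
have LFQ : L2 Q (fun x => W x - rho (V x)) by exact: L2B.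
have LFP : L2 P (fun x => W x - rho (V x)) by exact: L2B.
apply: (ae_of_weak (f := fun l => rhoq l - rho l)).
- exact: measurable_funB.
- exact: L2B.
move=> sg B msg sg1 mB sgE.
pose g l := \1_B l * sg l.
have bg : bm g.
  by apply: bmM; [exact: bm_indic|split => //; exists 1].
have oQ := orth_W mW WM cWq (bm_meas bg) (bm_L2 Q (bmV V bg)).
have oP := orth_W mW WM cW (bm_meas bg) (bm_L2 P (bmV V bg)).
have -> : \int[Q]_x (\1_B (V x) * sg (V x) * (rhoq (V x) - rho (V x))) =
    \int[Q]_x (\1_B (V x) * sg (V x) * (W x - rho (V x))).
  have L1a : L1 Q (fun x => g (V x) * (W x - rho (V x))).
    exact: (L1_bm (bmV V bg) (L2_L1 LFQ)).
  have L1b : L1 Q (fun x => g (V x) * (W x - rhoq (V x))).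
    exact: (L1_bm (bmV V bg) (L2_L1 (L2B LWq Lrhoq))).
  have := RintB L1a L1b; rewrite oQ subr0 => <-.
  by apply: Rint_eq => x; rewrite /g; ring.
have M20 : 0 <= 2 * M by exact: mulr_ge0.
have Fc : {ae P, forall x, `|W x - rho (V x)| <= 2 * M}.
  apply: filterS rho_M => x h; apply: (le_trans (ler_normB _ _)).
  by have := WM x; lra.
have := tilt_centred (L2_L1 LFP) M20 Fc msg sg1 mB oP.
by rewrite (_ : 2 * (2 * M) * b = 4 * M * b)//; ring.
Qed.

(** Relevance is an almost sure condition, which an L^1 bound on the drift of [kappa] would not
    preserve. As in [Q_dkappa], 16 = 2 * 6 + 4: the test variable and the change of [rho]. *)
Lemma dkappa_le : {ae Q, forall x, `|kappaq (V x) - kappa (V x)| <= 16 * M ^+ 2 * b}.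
Proof.
have LFP : L2 P (fun x => X x * (W x - rho (V x)) - kappa (V x)).
  by apply: L2B => //; apply: L2_bm => //; exact: L2B.
apply: (ae_of_weak (f := fun l => kappaq l - kappa l)).
- exact: measurable_funB.
- exact: L2B.
move=> sg B msg sg1 mB sgE.
pose g l := \1_B l * sg l.
have bg : bm g.
  by apply: bmM; [exact: bm_indic|split => //; exists 1].
have bgV := bmV V bg.
have bBV : bm (fun x => \1_B (V x) : R) by apply: (bmV V); exact: bm_indic.
have kQ := cond_cov_X mW WM mX XM cWq cXq cKq (bm_meas bg) (bm_L2 Q bgV).
have kP := cond_cov_X mW WM mX XM cW cX cK (bm_meas bg) (bm_L2 P bgV).
pose F x := X x * (W x - rho (V x)) - kappa (V x).
have L1gXW (P' : probability T R) r : L2 P' (r \o V) ->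
    L1 P' (fun x => g (V x) * X x * (W x - r (V x))).
  move=> Lr; apply: (@L1_bm _ _ _ _ (fun x => W x - r (V x)) (fun x => g (V x) * X x)).
    exact: bmM.
  by apply: L2_L1; apply: L2B => //; exact: bm_L2.
have L1gk (P' : probability T R) r : L2 P' (r \o V) ->
    L1 P' (fun x => g (V x) * r (V x)).
  by move=> Lr; apply: (L1_bm bgV); exact: L2_L1.
have F0 : \int[P]_x (\1_B (V x) * sg (V x) * F x) = 0.
  have := RintB (L1gXW P _ Lrho) (L1gk P _ Lkappa); rewrite kP subrr => <-.
  by apply: Rint_eq => x; rewrite /F /g; ring.
have M60 : 0 <= 6 * M ^+ 2 by rewrite mulr_ge0// sqr_ge0.
have Fc : {ae P, forall x, `|F x| <= 6 * M ^+ 2}.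
  have h4 := kappa_le mW WM mX XM cW cX cK.
  apply: filterS2 rho_M h4 => x h1 h2; apply: (le_trans (ler_normB _ _)).
  have : `|X x * (W x - rho (V x))| <= M * (2 * M).
    rewrite normrM; apply: ler_pM => //.
    by apply: (le_trans (ler_normB _ _)); have := WM x; lra.
  move: h2; rewrite (_ : M * (2 * M) = 2 * M ^+ 2); last by ring.
  lra.
have FQ := tilt_centred (L2_L1 LFP) M60 Fc msg sg1 mB F0.
pose E x := g (V x) * X x * (rhoq (V x) - rho (V x)).
have LE : L1 Q E.
  apply: L1_bm; first exact: bmM.
  by apply: L2_L1; exact: L2B.
have nn (z : R) : - z <= `|z| by have := ler_norm (- z); rewrite normrN.
have EQ : (- (\int[Q]_x E x)) <= 4 * M ^+ 2 * b * \int[Q]_x \1_B (V x).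
  apply: (@le_trans _ _ `|\int[Q]_x E x|); first exact: nn.
  apply: (le_trans (Rint_abs LE)).
  rewrite -RintZ; last exact: bm_L1.
  apply: Rint_ae_le; [exact: L1_abs|by apply: L1Z; exact: bm_L1|].
  apply: filterS drho_le => x h.
  rewrite /E /g -!mulrA normrM ger0_norm ?indicE// mulrC.
  rewrite [leRHS](_ : _ = M * (4 * M * b) * (V x \in B)%:R); last by ring.
  rewrite ler_wpM2r// normrM -[leRHS]mul1r.
  by apply: ler_pM => //; rewrite normrM; apply: ler_pM.
have -> : \int[Q]_x (\1_B (V x) * sg (V x) * (kappaq (V x) - kappa (V x))) =
    \int[Q]_x (\1_B (V x) * sg (V x) * F x) - \int[Q]_x E x.
  transitivity (\int[Q]_x (g (V x) * kappaq (V x)) - \int[Q]_x (g (V x) * kappa (V x))).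
    rewrite -RintB; [|exact: L1gk|exact: L1gk].
    by apply: Rint_eq => x; rewrite /g; ring.
  rewrite -kQ -RintB; [|exact: L1gXW|exact: L1gk].
  rewrite -RintB//; last first.
    by apply: (L1_bm bgV); apply: tilt_L1; exact: L2_L1 LFP.
  by apply: Rint_eq => x; rewrite /F /E /g; ring.
rewrite (_ : 16 * _ * _ * _ = 2 * (6 * M ^+ 2) * b * \int[Q]_x \1_B (V x) +
  4 * M ^+ 2 * b * \int[Q]_x \1_B (V x)); last by ring.
exact: lerD.
Qed.

End bounded_tilt.

Lemma L2_Lfun {R : realType} {d : measure_display} {T : measurableType d}
    (P : probability T R) (f : T -> R) : L2 P f <-> f \in Lfun P 2%:E.
Proof.
split=> [[mf Lf]|Lf]; last first.
  split; last exact: Lfun2_integrable_sqr.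
  by move: Lf; rewrite inE => /andP[]; rewrite inE.
rewrite inE; apply/andP; split; rewrite inE//= /finite_norm unlock/=.
rewrite poweR_lty//; move/integrableP: Lf => [_]; apply: le_lt_trans.
rewrite le_eqVlt; apply/orP; left; apply/eqP; apply: eq_integral => x _ /=.
by rewrite powR_mulrn// normrX.
Qed.

Lemma expectationE {R : realType} {d : measure_display} {T : measurableType d}
    (P : probability T R) (f : T -> R) : fine 'E_P[f] = \int[P]_x f x.
Proof. by rewrite unlock. Qed.

Lemma Rint_ge0_ae_eq0 {R : realType} {d : measure_display} {T : measurableType d}
    (P : probability T R) (f : T -> R) : L1 P f -> (forall x, 0 <= f x) ->
  \int[P]_x f x = 0 -> {ae P, forall x, f x = 0}.
Proof.
move=> Lf f0 If; have mf := L1_meas Lf.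
have : ae_eq P setT (EFin \o f) (cst 0%E).
  apply/ae_eq_integral_abs => //; first exact/measurable_EFinP.
  rewrite (eq_integral (EFin \o f)) => [|x _]; last by rewrite /= ger0_norm.
  by rewrite -[LHS]/(\int[P]_x (f x)%:E)%E EFin_Rint// If.
by apply: filterS => x /= /(_ I)[].
Qed.

Section tilted_path.
Context {R : realType} {d : measure_display} {T : measurableType d}.
Variables (P : probability T R) (s : T -> R) (S : R).
Hypotheses (ms : measurable_fun setT s) (S0 : 0 < S) (sS : forall x, `|s x| <= S).
Hypothesis s_mean0 : \int[P]_x s x = 0.

Let bs : bm s. Proof. by split => //; exists S. Qed.

Let ts_le t x : `|t| * S <= 2^-1 -> `|t * s x| <= 2^-1.
Proof. by apply: le_trans; rewrite normrM ler_wpM2l. Qed.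

(** Where |t| S exceeds one half, [1 + t * s] may fail to be a density and the path is set to [P];
    only its germ at 0 matters. *)
Lemma tilted_path : exists Pt : R -> probability T R,
  (forall B, measurable B -> Pt 0 B = P B) /\
  (forall t, `|t| * S <= 2^-1 -> forall B, measurable B ->
     Pt t B = (\int[P]_(x in B) (1 + t * s x)%:E)%E).
Proof.
have ex t : exists Q : probability T R, (t = 0 -> forall B, measurable B -> Q B = P B) /\
    (`|t| * S <= 2^-1 -> forall B, measurable B ->
       Q B = (\int[P]_(x in B) (1 + t * s x)%:E)%E).
  have [tS|tS] := boolP (`|t| * S <= 2^-1); last first.
    by exists P; split.
  have g0 x : 0 <= 1 + t * s x.
    have := ts_le x tS; rewrite ler_norml => /andP[? ?]; lra.
  have bt : bm (fun x => 1 + t * s x).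
    by apply: bmD; [exact: bm_cst|apply: bmM => //; exact: bm_cst].
  have Lg := bm_L1 P bt.
  have g1 : \int[P]_x (1 + t * s x) = 1.
    have Ls := bm_L1 P bs.
    rewrite RintD; [|exact: L1_cst|exact: L1Z].
    by rewrite RintZ// s_mean0 mulr0 addr0 Rint_cst.
  have [Q QE] := tilted_probability g0 Lg g1.
  exists Q; split=> // t0 B mB; rewrite QE// t0.
  under eq_integral do rewrite mul0r addr0.
  by rewrite integral_cst// mul1e.
have [Pt PtE] := choice ex.
exists Pt; split; first by move=> B mB; have [h _] := PtE 0; exact: h.
by move=> t tS B mB; have [_ h] := PtE t; exact: h.
Qed.

Variable Pt : R -> probability T R.
Hypothesis PtE : forall t, `|t| * S <= 2^-1 -> forall B, measurable B ->
  Pt t B = (\int[P]_(x in B) (1 + t * s x)%:E)%E.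

Lemma near_tS c : 0 < c -> \forall t \near (0 : R), `|t| * S <= c.
Proof.
move=> c0; have cS : 0 < c / S by rewrite divr_gt0.
by near=> t; rewrite -ler_pdivlMr//; near: t; exact: nbhs0_le.
Unshelve. all: by end_near. Qed.

(** [P] itself dominates. With [v] the root of [1 + t * s], the remainder is exactly
    [- ((v - 1) ^+ 2 / (2 * t))], and [(v - 1) * (v + 1) = t * s] bounds |v - 1| by |t| S; so the
    remainder is O(t) uniformly in [x]. *)
Lemma tilted_path_qmd : qmd_at0 Pt s.
Proof.
exists P, (fun t x => 1 + t * s x); split.
  near=> t.
  have tS : `|t| * S <= 2^-1 by near: t; apply: near_tS.
  split; last exact: PtE.
  - by apply: measurable_funD => //; apply: measurable_funM.
  - by move=> x; have := ts_le x tS; rewrite ler_norml => /andP[? ?]; lra.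
pose F t x := (Num.sqrt (1 + t * s x) - Num.sqrt (1 + 0 * s x)) / t
  - s x * Num.sqrt (1 + 0 * s x) / 2.
have Fle t x : t != 0 -> `|t| * S <= 2^-1 -> F t x ^+ 2 <= t ^+ 2 * S ^+ 4.
  move=> t0 tS; rewrite /F mul0r addr0 sqrtr1 mulr1.
  have v0 : 0 <= 1 + t * s x.
    by have := ts_le x tS; rewrite ler_norml => /andP[? ?]; lra.
  set v := Num.sqrt _; have vv : v ^+ 2 = 1 + t * s x by exact: sqr_sqrtr.
  have vge : 0 <= v by exact: sqrtr_ge0.
  have -> : (v - 1) / t - s x / 2 = - ((v - 1) ^+ 2 / (2 * t)).
    have -> : s x = (v ^+ 2 - 1) / t by rewrite vv; field.
    by field.
  have h1 : (v - 1) ^+ 2 <= t ^+ 2 * S ^+ 2.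
    apply: (@le_trans _ _ ((t * s x) ^+ 2)).
      rewrite (_ : t * s x = (v - 1) * (v + 1)); last first.
        by rewrite -subr_sqr expr1n vv; ring.
      rewrite exprMn ler_peMr ?sqr_ge0//.
      by rewrite exprn_ege1// lerDr.
    rewrite exprMn ler_wpM2l ?sqr_ge0//.
    by rewrite -[leLHS]real_normK ?num_real// lerXn2r ?nnegrE// ltW.
  have -> : (- ((v - 1) ^+ 2 / (2 * t))) ^+ 2 = ((v - 1) ^+ 2) ^+ 2 / (4 * t ^+ 2).
    by field.
  have t2 : 0 < t ^+ 2 by rewrite exprn_even_gt0.
  rewrite ler_pdivrMr; last exact: mulr_gt0.
  apply: (@le_trans _ _ ((t ^+ 2 * S ^+ 2) ^+ 2)).
    by rewrite lerXn2r ?nnegrE ?sqr_ge0// mulr_ge0// sqr_ge0.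
  rewrite [leRHS](_ : _ = 4 * (t ^+ 2 * S ^+ 2) ^+ 2); last by ring.
  by rewrite ler_peMl ?sqr_ge0// ler1n.
have ub : (fun t => (t ^+ 2 * S ^+ 4)%:E) @ (0 : R)^' --> (0 : \bar R)%E.
  apply: cvg_EFin; first exact: nearW.
  have : (fun t : R => t ^+ 2 * S ^+ 4) @ (0 : R) --> (0 ^+ 2 * S ^+ 4 : R).
    apply: cvgM; last exact: cvg_cst.
    exact: exprn_continuous.
  rewrite expr0n/= mul0r => h; apply: cvg_trans h; apply: cvg_app.
  exact: nbhs_dnbhs.
have lb : (fun _ : R => 0%E : \bar R) @ (0 : R)^' --> (0 : \bar R)%E by exact: cvg_cst.
apply: (squeeze_cvge _ lb ub).
near=> t.
have t0 : t != 0 by near: t; exact: nbhs_dnbhs_neq.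
have tS : `|t| * S <= 2^-1 by near: t; apply: nbhs_dnbhs; apply: near_tS.
apply/andP; split; first by apply: integral_ge0 => x _; rewrite lee_fin sqr_ge0.
apply: (@le_trans _ _ (\int[P]_x (t ^+ 2 * S ^+ 4)%:E)%E); last first.
  by rewrite integral_cst// [X in (_ * X)%E](probability_setT P) mule1.
apply: ge0_le_integral => //.
- by move=> x _; rewrite lee_fin sqr_ge0.
- apply/measurable_EFinP/measurable_funX.
  have m t' : measurable_fun setT (fun x => Num.sqrt (1 + t' * s x)).
    by apply: measurable_sqrt; apply: measurable_funD => //; apply: measurable_funM.
  apply: measurable_funB.
    by apply: measurable_funM => //; apply: measurable_funB; exact: m.
  by apply: measurable_funM => //; apply: measurable_funM => //; exact: m.
- by move=> x _; rewrite lee_fin; exact: Fle.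
Unshelve. all: by end_near. Qed.

Let mts t : measurable_fun setT (fun x => t * s x).
Proof. exact: measurable_funM. Qed.

Lemma tilted_path_moment (Y : T -> R) : L2 P Y ->
  \forall t \near (0 : R),
    (\int[Pt t]_x ((Y x) ^+ 2)%:E <= (2 * \int[P]_x Y x ^+ 2)%:E)%E.
Proof.
move=> LY; near=> t.
have tS : `|t| * S <= 2^-1 by near: t; apply: near_tS.
have tb x : `|t * s x| <= 2^-1 by exact: ts_le.
have [_ LYt] := tilt_L2 (mts t) tb (lexx _) (PtE tS) LY.
by rewrite EFin_Rint// lee_fin; exact: (tilt_sqr_le (mts t) tb (lexx _) (PtE tS)).
Unshelve. all: by end_near. Qed.

Context {d' : measure_display} {T' : measurableType d'}.
Variables (V : {mfun T >-> T'}) (W X : T -> R) (M eps : R).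
Hypotheses (mW : measurable_fun setT W) (WM : forall x, `|W x| <= M).
Hypotheses (mX : measurable_fun setT X) (XM : forall x, `|X x| <= M).
Hypotheses (M0 : 0 <= M) (eps0 : 0 < eps).
Hypothesis rel : {ae P, forall x, eps <= `|cond_cov P V X W (V x)|}.

Let cond_cov_spec (Q : probability T R) : [/\ is_cond_exp Q V W (cond_exp Q V W),
  is_cond_exp Q V X (cond_exp Q V X) &
  is_cond_exp Q V (fun x => (X x - cond_exp Q V X (V x)) *
    (W x - cond_exp Q V W (V x))) (cond_cov Q V X W)].
Proof.
have LW : L2 Q W by apply: bm_L2; split => //; exists M.
have LX : L2 Q X by apply: bm_L2; split => //; exists M.
have cW := is_cond_exp_cond_exp V (L2_L1 LW).
have cX := is_cond_exp_cond_exp V (L2_L1 LX).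
have [LWe _] := cond_exp_L2 cW LW.
have [LXe _] := cond_exp_L2 cX LX.
split; [exact: cW|exact: cX|].
exact: (is_cond_exp_cond_exp V (L2L2 (L2B LX LXe) (L2B LW LWe))).
Qed.

Lemma tilted_path_relevance : \forall t \near (0 : R),
  {ae Pt t, forall x, eps / 2 <= `|cond_cov (Pt t) V X W (V x)|}.
Proof.
(* Keeps the drift [16 * M ^+ 2 * c] allowed by [dkappa_le] within [eps / 2]; the 1 avoids dividing
   by 0 when [M = 0]. *)
pose c := eps / (32 * (M ^+ 2 + 1)).
have M21 : 0 < M ^+ 2 + 1 by rewrite ltr_wpDl ?sqr_ge0.
have c0 : 0 < c by rewrite divr_gt0// mulr_gt0.
near=> t.
have tS : `|t| * S <= 2^-1 by near: t; apply: near_tS.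
have tSc : `|t| * S <= c by near: t; exact: near_tS.
have tb x : `|t * s x| <= `|t| * S by rewrite normrM ler_wpM2l.
have QE := PtE tS.
have [cW cX cK] := cond_cov_spec P.
have [cWq cXq cKq] := cond_cov_spec (Pt t).
have h1 := dkappa_le mW WM mX XM M0 (mts t) tb tS QE cW cX cK cWq cXq cKq.
have h2 := tilt_ae (mts t) QE rel.
apply: filterS2 h1 h2 => x.
move: (cond_cov (Pt t) V X W (V x)) (cond_cov P V X W (V x)) => a b h1 h2.
have h3 : 16 * M ^+ 2 * (`|t| * S) <= eps / 2.
  apply: (@le_trans _ _ (16 * (M ^+ 2 + 1) * c)).
    apply: ler_pM => //; [by rewrite mulr_ge0 ?sqr_ge0|by rewrite mulr_ge0// ltW|].
    by rewrite ler_wpM2l// lerDl.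
  rewrite le_eqVlt; apply/orP; left; apply/eqP; rewrite /c; field.
  by rewrite gt_eqF.
have h4 : `|b| <= `|a| + `|a - b|.
  by have := ler_normB a (a - b); rewrite opprB addrCA subrr addr0.
lra.
Unshelve. all: by end_near. Qed.

End tilted_path.

(** * Application to the law of the observed data *)

Section observed_data.
Context {R : realType} {dZ dL : measure_display}
  {TZ : measurableType dZ} {TL : measurableType dL}.
Local Notation O := (obs_space R TZ TL).

Lemma measurable_oL : measurable_fun setT (@oL R dZ dL TZ TL).
Proof. exact: measurable_snd. Qed.

HB.instance Definition _ := isMeasurableFun.Build _ _ _ _ (@oL R dZ dL TZ TL) measurable_oL.

Lemma measurable_oY : measurable_fun setT (@oY R dZ dL TZ TL).
Proof. exact: (measurableT_comp measurable_snd measurable_fst). Qed.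

Lemma measurable_oZ : measurable_fun setT (@oZ R dZ dL TZ TL).
Proof.
apply: (measurableT_comp measurable_fst).
exact: (measurableT_comp measurable_fst measurable_fst).
Qed.

Lemma measurable_oA : measurable_fun setT (@oA R dZ dL TZ TL).
Proof.
apply: (@measurableT_comp _ _ _ _ _ _ (fun b : bool => b%:R : R)) => //.
apply: (measurableT_comp measurable_snd).
exact: (measurableT_comp measurable_fst measurable_fst).
Qed.

Lemma measurable_opi (pi : TZ * TL -> R) :
  measurable_fun setT pi -> measurable_fun setT (opi pi).
Proof.
move=> mpi; apply: (measurableT_comp mpi); apply: measurable_fun_pair.
  exact: measurable_oZ.
exact: measurable_oL.
Qed.

Lemma psiE (pi : TZ * TL -> R) (P : probability O R) :
  psi pi P = cond_ratio oL (opi pi) oA oY P.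
Proof. exact: expectationE. Qed.

Lemma phiE (pi : TZ * TL -> R) (P : probability O R) o :
  phi pi (psi pi P) (true_nuisance pi P) o =
  influence oL (opi pi) oA oY P (cond_exp P oL (opi pi)) (cond_exp P oL oA)
    (cond_exp P oL oY) (cond_cov P oL oA (opi pi))
    (fun l => cond_cov P oL oY (opi pi) l / cond_cov P oL oA (opi pi) l) o.
Proof.
rewrite psiE /phi /influence /residual /mean_ratio /cond_ratio /=.
move: (Rintegral _ _ _) (cond_exp _ _ _ _) (cond_exp _ _ _ _) (cond_exp _ _ _ _).
move: (cond_cov _ _ _ _ _) (cond_cov _ _ _ _ _) => a b c d' e f.
ring.
Qed.

Lemma influence_function_phi (P : probability O R) (pi : TZ * TL -> R) :
  L2 P oY -> regular_weighting pi P ->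
  influence_function (regular_submodel pi P) (psi pi) P
    (phi pi (psi pi P) (true_nuisance pi P)).
Proof.
(* The maximum with 1 below gives one bound for [pi] and for [A], whose values are 0 and 1. *)
move=> LY [mpi [M' piM'] [eps eps0 rel]].
pose M := Num.max M' 1.
have M0 : 0 <= M by rewrite le_max ler01 orbT.
have piM o : `|opi pi o| <= M by rewrite le_max piM'.
have AM (o : O) : `|oA o| <= M.
  by rewrite le_max /oA ger0_norm ?ler0n// lern1 leq_b1 orbT.
have mW := measurable_opi mpi; have mA := measurable_oA.
have moP := cond_moments mW piM mA AM LY eps0 rel.
have Lphi := L2_influence mW piM mA AM eps0 LY moP.
have Iphi := Rint_influence mW piM mA AM M0 eps0 LY moP.
have phi_eq : phi pi (psi pi P) (true_nuisance pi P) = _ := funext (phiE pi P).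
rewrite phi_eq; split.
- exact/L2_Lfun.
- by rewrite unlock EFin_Rint ?Iphi//; exact: L2_L1.
- move=> Pt s [Pt0 /L2_Lfun Ls qmd [MY momY] relt].
  rewrite expectationE (funext (fun t => psiE pi (Pt t))).
  apply: (is_derive_cond_ratio mW piM mA AM M0 eps0 LY rel Pt0 Ls qmd) => //.
  exists MY; near=> t.
  have : ('E_(Pt t)[fun o => (oY o ^+ 2)%R] <= MY%:E)%E by near: t.
  by rewrite unlock.
Unshelve. all: by end_near. Qed.

(** Derivatives are unique, so [D = f1 - f2] is orthogonal to the score of every submodel. The score
    used is the centred sign of [D]; as [D] has mean 0, the centring does not matter, and
    orthogonality says that the L^1 norm of [D] is 0. *)
Lemma influence_function_unique (P : probability O R) (pi : TZ * TL -> R) f1 f2 :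
  L2 P oY -> regular_weighting pi P ->
  influence_function (regular_submodel pi P) (psi pi) P f1 ->
  influence_function (regular_submodel pi P) (psi pi) P f2 ->
  {ae P, forall x, f1 x = f2 x}.
Proof.
move=> LY [mpi [M' piM'] [eps eps0 rel]].
move=> [/L2_Lfun L1f mean1 der1] [/L2_Lfun L2f mean2 der2].
pose M := Num.max M' 1.
have M0 : 0 <= M by rewrite le_max ler01 orbT.
have piM o : `|opi pi o| <= M by rewrite le_max piM'.
have AM (o : O) : `|oA o| <= M.
  by rewrite le_max /oA ger0_norm ?ler0n// lern1 leq_b1 orbT.
have mW := measurable_opi mpi; have mA := measurable_oA.
pose D x := f1 x - f2 x.
have LD : L2 P D by exact: L2B.
have LD1 := L2_L1 LD.
have D0 : \int[P]_x D x = 0.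
  rewrite RintB; [|exact: L2_L1..].
  by rewrite -!expectationE mean1 mean2 subrr.
have [sg [msg sg1 sgE]] := measurable_sign (L2_meas LD).
have bsg : bm sg by split => //; exists 1.
have Lsg := bm_L1 P bsg.
pose m := \int[P]_x sg x.
pose s x := sg x - m.
have bs : bm s by apply: bmB => //; exact: bm_cst.
have s0 : \int[P]_x s x = 0.
  by rewrite RintB ?Rint_cst ?subrr//; exact: L1_cst.
have sS x : `|s x| <= 1 + `|m|.
  by apply: (le_trans (ler_normB _ _)); rewrite lerD2r.
have S0 : 0 < 1 + `|m| by rewrite ltr_pwDl.
have ms := bm_meas bs; have Ls := bm_L2 P bs.
have [Pt [Pt0 PtE]] := tilted_path ms sS s0.
have sub : regular_submodel pi P Pt s.
  split => //.
  - exact/L2_Lfun.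
  - exact: (tilted_path_qmd ms S0 sS PtE).
  - exists (2 * \int[P]_x oY x ^+ 2); near=> t; rewrite unlock.
    near: t; exact: (tilted_path_moment ms S0 sS PtE LY).
  - exists (eps / 2); first by rewrite divr_gt0.
    exact: (tilted_path_relevance ms S0 sS PtE mW piM mA AM M0 eps0 rel).
have e1 := @derive_val _ _ _ _ _ _ _ (der1 _ _ sub).
have e2 := @derive_val _ _ _ _ _ _ _ (der2 _ _ sub).
have L1s := L2L2 L1f Ls; have L2s := L2L2 L2f Ls.
have Ds : \int[P]_x (D x * s x) = 0.
  transitivity (\int[P]_x (f1 x * s x - f2 x * s x)).
    by apply: Rint_eq => x; rewrite mulrBl.
  by rewrite RintB// -!expectationE -e1 -e2 subrr.
have absD : \int[P]_x `|D x| = 0.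
  rewrite -[RHS]Ds.
  transitivity (\int[P]_x (D x * s x + m * D x)).
    by apply: Rint_eq => x; rewrite -sgE /s; ring.
  by rewrite RintD ?RintZ ?D0 ?mulr0 ?addr0//; [exact: L2L2|exact: L1Z].
have := Rint_ge0_ae_eq0 (L1_abs LD1) (fun x => normr_ge0 _) absD.
by apply: filterS => x /eqP; rewrite normr_eq0 subr_eq0 => /eqP.
Unshelve. all: by end_near. Qed.

End observed_data.

Theorem theorem3p1 (R : realType) (d dZ dU dL : measure_display)
    (T : measurableType d) (TZ : measurableType dZ) (TU : measurableType dU)
    (TL : measurableType dL) (P : probability T R)
    (Z : {mfun T >-> TZ}) (U : {mfun T >-> TU}) (L : {mfun T >-> TL})
    (A : {mfun T >-> bool}) (Y : {mfun T >-> R}) (Ypot : bool -> {mfun T >-> R})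
    (consistency : {ae P, forall w, Y w = Ypot (A w) w})
    (latent_ignorability : forall a : bool,
       cond_indep P (Ypot a) (fun w => (A w, Z w)) (fun w => (U w, L w)))
    (IV_independence : cond_indep P Z U L)
    (Y_square_integrable : (Y : T -> R) \in Lfun P 2%:E)
    (pi : TZ * TL -> R)
    (pi_regular : regular_weighting pi (observed_law P Z A Y L)) :
  let Po := observed_law P Z A Y L in
  nonparametric_eif (regular_submodel pi Po) (psi pi) Po
    (phi pi (psi pi Po) (true_nuisance pi Po)).
Proof.
move=> Po.
have LY : L2 Po oY.
  split; first exact: measurable_oY.
  have /L2_Lfun[mY LY2] := Y_square_integrable.
  have mo2 : measurable_fun setT (fun o : obs_space R TZ TL => (oY o ^+ 2)%:E).
    by apply/measurable_EFinP; apply: measurable_funX; exact: measurable_oY.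
  apply: (integrable_pushforward (measurable_funPT (observation Z A Y L)) mo2) => //.
split=> [|f inf].
  exact: influence_function_phi.
by apply: (influence_function_unique LY pi_regular inf); exact: influence_function_phi.
Qed.
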